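(* Let $\boldsymbol\mu\in\mathcal{PM}_+(\mathbb T^2)$, and let $L_1,L_2$ be the bounded operators on $\mathcal D^2(\boldsymbol\mu)$ given by $$(L_1f)(z_1,z_2)=\frac{f(z_1,z_2)-f(0,z_2)}{z_1},\qquad (L_2f)(z_1,z_2)=\frac{f(z_1,z_2)-f(z_1,0)}{z_2}.$$ Then $L_1$ and $L_2$ are left inverses of $M_{z_1}$ and $M_{z_2}$ respectively. Moreover, $L_1M_{z_2}=M_{z_2}L_1$ and $L_2M_{z_1}=M_{z_1}L_2$.
   Context: $\mathcal M_+(\mathbb T)$ is the set of finite positive Borel measures on the unit circle $\mathbb T$ (parametrized by $t\in[0,2\pi)$); $\mathcal{PM}_+(\mathbb T^2)$ is the set of measures $\boldsymbol\mu=\mu_1\times\mu_2$ on $\mathbb T^2$ with $\mu_1,\mu_2\in\mathcal M_+(\mathbb T)$. For $\nu\in\mathcal M_+(\mathbb T)$, $P_\nu(z)=\frac1{2\pi}\int_0^{2\pi}\frac{1-|z|^2}{|e^{it}-z|^2}\,d\nu(t)$, $z\in\mathbb D$. $dA$ is normalized area measure on $\mathbb D$. For $f$ holomorphic on $\mathbb D^2$ put $D^{(2)}_{\boldsymbol\mu,1}(f)=\lim_{r\to1^-}\frac1{2\pi}\int_{\mathbb D}\int_0^{2\pi}|\partial_1f(z_1,re^{it})|^2P_{\mu_1}(z_1)\,dt\,dA(z_1)$, $D^{(2)}_{\boldsymbol\mu,2}(f)=\lim_{r\to1^-}\frac1{2\pi}\int_{\mathbb D}\int_0^{2\pi}|\partial_2f(re^{it},z_2)|^2P_{\mu_2}(z_2)\,dt\,dA(z_2)$,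 $D^{(2)}_{\boldsymbol\mu,3}(f)=\int_{\mathbb D}\int_{\mathbb D}|\partial_1\partial_2f(z_1,z_2)|^2P_{\mu_1}(z_1)P_{\mu_2}(z_2)\,dA(z_1)dA(z_2)$, and $D^{(2)}_{\boldsymbol\mu}(f)=\sum_{j=1}^3D^{(2)}_{\boldsymbol\mu,j}(f)$. For non-zero $\boldsymbol\mu$, $\mathcal D^2(\boldsymbol\mu)$ is the set of holomorphic $f$ on $\mathbb D^2$ with $D^{(2)}_{\boldsymbol\mu}(f)<\infty$ (such $f$ lie in the Hardy space $H^2(\mathbb D^2)$); for $\boldsymbol\mu=0$, $\mathcal D^2(\boldsymbol\mu)=H^2(\mathbb D^2)$. The norm is given by $\|f\|_{\boldsymbol\mu}^2=\|f\|^2_{H^2(\mathbb D^2)}+D^{(2)}_{\boldsymbol\mu}(f)$. $M_{z_i}$ is multiplication by the coordinate function $z_i$ on $\mathcal D^2(\boldsymbol\mu)$. *)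

(* Defs.v *)
From mathcomp Require Import all_boot all_order all_algebra.
From mathcomp Require Import complex.
From mathcomp Require Import all_classical all_reals all_analysis.

Set Implicit Arguments.
Unset Strict Implicit.
Unset Printing Implicit Defensive.

Import Order.TTheory GRing.Theory Num.Theory.
Import numFieldNormedType.Exports.

Local Open Scope classical_set_scope.
Local Open Scope ring_scope.

(* R[i] as a [numFieldType]: through this coercion it carries the topology and
   the normed module structure over itself, so that [differentiable] and
   [derive1] below are complex differentiability and the complex derivative. *)
Definition CC (R : realType) : numFieldType := R[i].

(* A finite positive Borel measure on the unit circle, carried to the line by
   the parametrization t |-> e^{it}, t in [0, 2pi[. *)
Record circle_measure (R : realType) := CircleMeasure {
  circle_measure_val :> {finite_measure set (measurableTypeR R) -> \bar R} ;
  circle_measure_supp : circle_measure_val (~` `[0, 2 * pi[) = 0%E }.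

Section Dirichlet.
Context {R : realType}.

Definition disc : set (CC R) := [set z | `|z| < 1].

Definition bidisc : set (CC R * CC R) := [set z | disc z.1 /\ disc z.2].

Definition eq_bidisc (f g : CC R * CC R -> CC R) : Prop :=
  forall z, bidisc z -> f z = g z.

Definition holomorphic (f : CC R * CC R -> CC R) : Prop :=
  forall z, bidisc z -> differentiable f z.

Definition partial1 (f : CC R * CC R -> CC R) : CC R * CC R -> CC R :=
  fun z => derive1 (fun w => f (w, z.2)) z.1.

Definition partial2 (f : CC R * CC R -> CC R) : CC R * CC R -> CC R :=
  fun z => derive1 (fun w => f (z.1, w)) z.2.

Definition abs2 (z : CC R) : R := Normc.normc z ^+ 2.

(* r e^{it} *)
Definition polar (r t : R) : CC R := Complex (r * cos t) (r * sin t).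

Definition poisson (nu : circle_measure R) (z : CC R) : \bar R :=
  (((2 * pi)^-1)%R%:E *
   \int[nu]_(t in `[0%R, (2 * pi)%R[) ((1 - abs2 z) / abs2 (polar 1 t - z))%R%:E)%E.

Definition angle_int (F : R -> \bar R) : \bar R :=
  (\int[lebesgue_measure]_(t in `[0%R, (2 * pi)%R]) F t)%E.

(* integration over the disc against normalized area measure *)
Definition area_int (F : CC R -> \bar R) : \bar R :=
  ((pi^-1)%R%:E *
   \int[lebesgue_measure \x lebesgue_measure]_(p in
     [set p : measurableTypeR R * measurableTypeR R | disc (Complex p.1 p.2)])
     F (Complex p.1 p.2))%E.

Section Measures.
Variables mu1 mu2 : circle_measure R.

Definition dirichlet1 (f : CC R * CC R -> CC R) : \bar R :=
  lim ((fun r : R => ((2 * pi)^-1)%R%:E *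
    area_int (fun z1 => angle_int (fun t =>
      (abs2 (partial1 f (z1, polar r t)))%:E * poisson mu1 z1)))%E @ 1^'-).

Definition dirichlet2 (f : CC R * CC R -> CC R) : \bar R :=
  lim ((fun r : R => ((2 * pi)^-1)%R%:E *
    area_int (fun z2 => angle_int (fun t =>
      (abs2 (partial2 f (polar r t, z2)))%:E * poisson mu2 z2)))%E @ 1^'-).

Definition dirichlet3 (f : CC R * CC R -> CC R) : \bar R :=
  area_int (fun z2 => area_int (fun z1 =>
    (abs2 (partial1 (partial2 f) (z1, z2)))%:E
      * poisson mu1 z1 * poisson mu2 z2)%E).

Definition product_nonzero : Prop := (mu1 \x mu2)%E setT <> 0%E.

(* The formulas involve mu1 and mu2 separately, while the functional is attached
   to the product mu1 x mu2.  The zero product is factored as 0 x 0, whence the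
   value 0 even if just one of the two factors vanishes. *)
Definition dirichlet (f : CC R * CC R -> CC R) : \bar R :=
  if `[< product_nonzero >] then (dirichlet1 f + dirichlet2 f + dirichlet3 f)%E
  else 0%E.

(* the squared norm of the Hardy space of the bidisc *)
Definition hardy_sqnorm (f : CC R * CC R -> CC R) : \bar R :=
  ereal_sup [set ((2 * pi) ^- 2)%R%:E *
    angle_int (fun s => angle_int (fun t =>
      (abs2 (f (polar r s, polar r t)))%:E)) | r in `[0%R, 1%R[]%E.

Definition in_D2 (f : CC R * CC R -> CC R) : Prop :=
  holomorphic f /\
  if `[< product_nonzero >] then (dirichlet f < +oo)%E
  else (hardy_sqnorm f < +oo)%E.

Definition D2_sqnorm (f : CC R * CC R -> CC R) : \bar R :=
  (hardy_sqnorm f + dirichlet f)%E.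

(* Elements of the space are represented by functions on all of C^2, only the
   restrictions of which to the bidisc matter. *)
Definition bounded_operator
    (T : (CC R * CC R -> CC R) -> (CC R * CC R -> CC R)) : Prop :=
  [/\ forall f, in_D2 f -> in_D2 (T f),
      forall (a : CC R) f g, in_D2 f -> in_D2 g ->
        eq_bidisc (T (fun z => a * f z + g z)) (fun z => a * T f z + T g z) &
      exists M : R, forall f, in_D2 f ->
        (D2_sqnorm (T f) <= (M ^+ 2)%:E * D2_sqnorm f)%E].

End Measures.

Definition Mz1 (f : CC R * CC R -> CC R) : CC R * CC R -> CC R :=
  fun z => z.1 * f z.

Definition Mz2 (f : CC R * CC R -> CC R) : CC R * CC R -> CC R :=
  fun z => z.2 * f z.

(* The difference quotient extends holomorphically to z.1 = 0, with the partial
   derivative as value there; likewise for [L2]. *)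
Definition L1 (f : CC R * CC R -> CC R) : CC R * CC R -> CC R :=
  fun z => if z.1 == 0 then partial1 f z else (f z - f (0, z.2)) / z.1.

Definition L2 (f : CC R * CC R -> CC R) : CC R * CC R -> CC R :=
  fun z => if z.2 == 0 then partial2 f z else (f z - f (z.1, 0)) / z.2.

End Dirichlet.

(* Main.v *)
(** A holomorphic function on the bidisc is the sum of a double power series
    [sum a_(m,n) z1^m z2^n]: Goursat's lemma on a rectangle, applied after the
    substitution [z + lambda (rho e^(it) - z)], gives Cauchy's formula for a slice.
    Every functional is then computed from the coefficients.

    For one variable, the Poisson kernel at [e^(it)] times [|g(z)|^2] is
    [(1 - |z|^2) |h_t(z)|^2] with [h_t(z) = g(z) / (1 - e^(-it) z)], so that rotation
    invariance of the area and Parseval's identity give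
      [int_D |g|^2 P_nu dA = c int sum_j w_j |sum_(m <= j) c_m e^(imt)|^2 dnu(t)]
    for [g = sum c_m z^m], where [w_j] is proportional to [1 / ((j + 1) (j + 2))].
    For [g = u'] the inner sums are [N_j = sum_(m <= j) m u_m e^(imt)] up to a
    unimodular factor.

    Shifting [u] by one place changes [N_j] by a partial sum [S_j] of
    [sum u_m e^(imt)].  Summation by parts gives
      [S_j - u_0 = N_j / (j + 1) + sum_(m = 1..j) N_m / (m (m + 1))],
    and by Cauchy-Schwarz [|S_j - u_0|^2] is at most a constant times
    [sum_j w_j |N_(j+1)|^2].  Hence the weighted sums attached to the shifts of [u] are
    bounded by the one of [u] and [|u_0|^2], which yields the boundedness of
    multiplication and backward shift in the first variable.  The first row of
    coefficients, which enters here, is controlled by the Hardy norm for the bound, and by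
    the Dirichlet integral in the other variable for the finiteness.  Exchanging the two
    variables gives the other two operators. *)

Require Import Defs.
From HB Require Import structures.
From mathcomp Require Import all_boot all_order all_algebra.
From mathcomp Require Import complex.
From mathcomp Require Import all_classical all_reals all_analysis.
From mathcomp Require Import measurable_realfun ring lra.

Set Implicit Arguments.
Unset Strict Implicit.
Unset Printing Implicit Defensive.

Import Order.TTheory GRing.Theory Num.Theory.
Import numFieldNormedType.Exports.

Local Open Scope classical_set_scope.
Local Open Scope ring_scope.

(** * Series of complex numbers and power series *)

(** All estimates are inequalities in the extended reals between sums over the coefficients [a m n],
    so infinite values need no separate treatment. The asymmetry between the two operators comes
    from the constant coefficient. Multiplication turns [N_j] into [N_j + S_j], and [S_j] contains
    [u_0], which the Dirichlet sum of [u] does not see; the backward shift involves [S_j - u_0], so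
    its Dirichlet sum is controlled by that of [u] alone. In two variables [u_0] becomes the row
    [a 0 n], the coefficients of [f (0, z2)]. For non-zero measures [in_D2] supplies a finite
    Dirichlet integral and no Hardy norm, so the square summability of this row has to be extracted
    from the part attached to [mu2]; there the positive mass of [mu2] enters. In the mixed integral
    the second variable is frozen: after partial summation in it, a one-variable sequence in [m]
    remains, to which the one-variable estimates apply under the integral against [mu2]. The row
    term then reproduces the second Dirichlet part. Areas are computed from rotation and scaling
    invariance in place of polar coordinates. *)

Section ComplexBasics.
Context {R : realType}.
Implicit Types (z w : CC R) (x y : R).
Local Notation normc := (@Normc.normc R).

Lemma cReD z w : complex.Re (z + w) = complex.Re z + complex.Re w.
Proof. by case: z w => [? ?] [? ?]. Qed.
Lemma cImD z w : complex.Im (z + w) = complex.Im z + complex.Im w.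
Proof. by case: z w => [? ?] [? ?]. Qed.
Lemma cReN z : complex.Re (- z) = - complex.Re z.
Proof. by case: z. Qed.
Lemma cImN z : complex.Im (- z) = - complex.Im z.
Proof. by case: z. Qed.
Lemma cReM z w : complex.Re (z * w) =
  complex.Re z * complex.Re w - complex.Im z * complex.Im w.
Proof. by case: z w => [? ?] [? ?]. Qed.
Lemma cImM z w : complex.Im (z * w) =
  complex.Re z * complex.Im w + complex.Im z * complex.Re w.
Proof. by case: z w => [? ?] [? ?]. Qed.
Lemma cRe_sum (I : Type) (s : seq I) (P : pred I) (F : I -> CC R) :
  complex.Re (\sum_(i <- s | P i) F i) = \sum_(i <- s | P i) complex.Re (F i).
Proof. exact: (big_morph _ cReD). Qed.
Lemma cIm_sum (I : Type) (s : seq I) (P : pred I) (F : I -> CC R) :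
  complex.Im (\sum_(i <- s | P i) F i) = \sum_(i <- s | P i) complex.Im (F i).
Proof. exact: (big_morph _ cImD). Qed.
Lemma complexP z w :
  complex.Re z = complex.Re w -> complex.Im z = complex.Im w -> z = w.
Proof. by case: z w => [? ?] [? ?] /= -> ->. Qed.

Definition cconj z : CC R := Complex (complex.Re z) (- complex.Im z).

Lemma abs2E z : abs2 z = complex.Re z ^+ 2 + complex.Im z ^+ 2.
Proof. by case: z => a b; rewrite /abs2 /= sqr_sqrtr// addr_ge0// sqr_ge0. Qed.
Lemma abs2M z w : abs2 (z * w) = abs2 z * abs2 w.
Proof. by rewrite /abs2 Normc.normcM exprMn. Qed.
Lemma abs2_ge0 z : 0 <= abs2 z.
Proof. by rewrite /abs2 sqr_ge0. Qed.
Lemma abs2X z n : abs2 (z ^+ n) = abs2 z ^+ n.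
Proof.
elim: n => [|n IH]; last by rewrite !exprS abs2M IH.
by rewrite !expr0 abs2E /=; ring.
Qed.
Lemma abs2_0 : abs2 (0 : CC R) = 0.
Proof. by rewrite abs2E /=; ring. Qed.
Lemma abs2N z : abs2 (- z) = abs2 z.
Proof. by rewrite !abs2E cReN cImN; ring. Qed.
Lemma abs2D z w : abs2 (z + w) = abs2 z + abs2 w + 2 * complex.Re (z * cconj w).
Proof. by rewrite !abs2E; case: z w => [a b] [c d] /=; ring. Qed.
Lemma abs2_le2 z w : abs2 (z + w) <= 2 * abs2 z + 2 * abs2 w.
Proof.
rewrite !abs2E cReD cImD -subr_ge0.
set a := complex.Re z; set b := complex.Re w; set c := complex.Im z; set d := complex.Im w.
have -> : 2 * (a ^+ 2 + c ^+ 2) + 2 * (b ^+ 2 + d ^+ 2) - ((a + b) ^+ 2 + (c + d) ^+ 2)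
  = (a - b) ^+ 2 + (c - d) ^+ 2 by ring.
by rewrite addr_ge0// sqr_ge0.
Qed.
Lemma abs2_natr n : abs2 (n%:R : CC R) = n%:R ^+ 2.
Proof.
have H : (n%:R : CC R) = Complex (n%:R) 0.
  elim: n => [//|n IH]; rewrite -addn1 !natrD IH.
  by apply: complexP; rewrite ?cReD ?cImD /=; ring.
by rewrite abs2E H /=; ring.
Qed.

Lemma normc_ge0 z : 0 <= normc z.
Proof. by case: z => a b; rewrite /= sqrtr_ge0. Qed.
Lemma normcD z w : normc (z + w) <= normc z + normc w.
Proof. exact: le_normcD. Qed.
Lemma normc_N z : normc (- z) = normc z.
Proof. exact: normcN. Qed.
Lemma normcB z w : normc (z - w) <= normc z + normc w.
Proof. by apply: (le_trans (normcD _ _)); rewrite normc_N. Qed.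
Lemma normc_distC z w : normc (z - w) = normc (w - z).
Proof. by rewrite -normc_N opprB. Qed.
Lemma normc_dist z w : `|normc z - normc w| <= normc (z - w).
Proof.
have h1 := normcD (z - w) w; have h2 := normcD (w - z) z.
rewrite subrK in h1; rewrite subrK normc_distC in h2.
by rewrite ler_norml; apply/andP; split; lra.
Qed.
Lemma normc_X z n : normc (z ^+ n) = normc z ^+ n.
Proof.
elim: n => [|n IH]; first by rewrite !expr0 Normc.normc1.
by rewrite !exprS Normc.normcM IH.
Qed.
Lemma normc_sum (I : Type) (s : seq I) (P : pred I) (F : I -> CC R) :
  normc (\sum_(i <- s | P i) F i) <= \sum_(i <- s | P i) normc (F i).
Proof.
elim/big_rec2: _ => [|i y1 y2 _ H]; first by rewrite Normc.normc0.
by apply: (le_trans (normcD _ _)); rewrite lerD2l.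
Qed.
Lemma cRe_le z : `|complex.Re z| <= normc z.
Proof.
case: z => a b /=; rewrite -sqrtr_sqr ler_sqrt; first by rewrite lerDl sqr_ge0.
by rewrite addr_ge0// sqr_ge0.
Qed.
Lemma cIm_le z : `|complex.Im z| <= normc z.
Proof.
case: z => a b /=; rewrite -sqrtr_sqr ler_sqrt; first by rewrite lerDr sqr_ge0.
by rewrite addr_ge0// sqr_ge0.
Qed.
Lemma normc_le z : normc z <= `|complex.Re z| + `|complex.Im z|.
Proof.
rewrite -(@ler_pXn2r _ 2)// ?nnegrE ?normc_ge0 ?addr_ge0//.
rewrite -/(abs2 z) abs2E -(real_normK (num_real (complex.Re z))).
rewrite -(real_normK (num_real (complex.Im z))).
have := normr_ge0 (complex.Re z); have := normr_ge0 (complex.Im z); nra.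
Qed.
Lemma normc_normr z : `|z| = Complex (normc z) 0.
Proof. by case: z. Qed.
Lemma normc_real x : normc (Complex x 0) = `|x|.
Proof. by rewrite /= expr0n /= addr0 sqrtr_sqr. Qed.
Lemma normc_gt0 z : (0 < normc z) = (z != 0).
Proof.
rewrite lt_neqAle normc_ge0 andbT eq_sym; congr (~~ _).
apply/eqP/eqP => [/Normc.eq0_normc //|->]; exact: Normc.normc0.
Qed.
Lemma discE z : disc z <-> normc z < 1.
Proof.
rewrite /disc /= normc_normr -ltcR; split => H; exact: H.
Qed.
Lemma disc0 : disc (0 : CC R).
Proof. by apply/discE; rewrite Normc.normc0. Qed.

Definition cis (t : R) : CC R := Complex (cos t) (sin t).
Lemma polarE x t : polar x t = Complex x 0 * cis t.
Proof. by apply: complexP; rewrite ?cReM ?cImM /=; ring. Qed.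
Lemma polar1 t : polar 1 t = cis t.
Proof. by rewrite /polar !mul1r. Qed.
Lemma cisD x y : cis (x + y) = cis x * cis y.
Proof. by apply: complexP; rewrite ?cReM ?cImM /= ?cosD ?sinD; ring. Qed.
Lemma cis0 : cis 0 = 1.
Proof. by rewrite /cis cos0 sin0. Qed.
Lemma cisX t n : cis t ^+ n = cis (n%:R * t).
Proof.
elim: n => [|n IH]; first by rewrite expr0 mul0r cis0.
by rewrite exprS IH -cisD -[in RHS]addn1 natrD; congr cis; ring.
Qed.
Lemma abs2_cis t : abs2 (cis t) = 1.
Proof. by rewrite abs2E /= cos2Dsin2. Qed.
Lemma normc_cis t : normc (cis t) = 1.
Proof. by rewrite /= cos2Dsin2 sqrtr1. Qed.
Lemma cis_neq0 t : cis t != 0.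
Proof. by rewrite -normc_gt0 normc_cis. Qed.
Lemma cisN t : cis (- t) = (cis t)^-1.
Proof.
apply: (mulfI (cis_neq0 t)); rewrite mulfV ?cis_neq0//.
by rewrite -cisD subrr cis0.
Qed.
Lemma normc_polar x t : normc (polar x t) = `|x|.
Proof. by rewrite polarE Normc.normcM normc_cis mulr1 normc_real. Qed.

End ComplexBasics.

(** * Complex series dominated by a geometric one *)

Section Series.
Context {R : realType}.
Local Notation normc := (@Normc.normc R).
Implicit Types (u v : nat -> CC R) (M q : R).

Definition psums u (N : nat) : CC R := \sum_(n < N) u n.

(** A total function: the two limits are meaningful for convergent series only, so the rules of
    calculation below ask for geometric domination. *)
Definition csum u : CC R :=
  Complex (limn (fun N => complex.Re (psums u N))) (limn (fun N => complex.Im (psums u N))).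

(** Geometric domination serves as the notion of convergence: power series inside the disc satisfy
    it, and it gives the explicit tails [M * q ^+ N / (1 - q)]. *)
Definition gbound M q u := 0 <= M /\ 0 <= q < 1 /\ forall n, normc (u n) <= M * q ^+ n.

Lemma geo_le1 q n : 0 <= q < 1 -> q ^+ n <= 1.
Proof. by move=> /andP[q0 q1]; rewrite exprn_ile1// ltW. Qed.


Lemma geo_sum q n : (1 - q) * (\sum_(i < n) q ^+ i) = 1 - q ^+ n.
Proof.
elim: n => [|n IH]; first by rewrite big_ord0 expr0; ring.
by rewrite big_ord_recr /= mulrDr IH exprS; ring.
Qed.


Lemma geo_sum_le q n : 0 <= q < 1 -> \sum_(i < n) q ^+ i <= (1 - q)^-1.
Proof.
move=> /andP[q0 q1]; have q1' : 0 < 1 - q by rewrite subr_gt0.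
rewrite -[leRHS]mul1r ler_pdivlMr// mulrC geo_sum.
by rewrite lerBlDr lerDl exprn_ge0.
Qed.

Lemma geo_cvg0 M q : 0 <= q < 1 -> (fun n => M * q ^+ n) @ \oo --> (0 : R).
Proof.
move=> /andP[q0 q1]; rewrite -(mulr0 M); apply: cvgMr.
by apply: cvg_expr; rewrite ger0_norm.
Qed.

Lemma geo_small M q e : 0 <= q < 1 -> 0 < e -> exists N, M * q ^+ N < e.
Proof.
move=> q01 e0; have /cvgrPdist_lt/(_ _ e0)[N _ H] := @geo_cvg0 M q q01.
exists N; have := H N (leqnn N); rewrite /= sub0r normrN => H'.
exact: le_lt_trans (ler_norm _) H'.
Qed.

(** Each of the [n + 1] powers [q ^+ i] with [i <= n] is at least [q ^+ n], and their sum is at most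
    [1 / (1 - q)]. *)
Lemma mulSn_geo_le q n : 0 <= q < 1 -> n.+1%:R * q ^+ n <= (1 - q)^-1.
Proof.
move=> q01; apply: le_trans (geo_sum_le n.+1 q01).
rewrite -[n.+1 in leLHS]card_ord -sumr_const mulr_suml; apply: ler_sum => i _.
move/andP: q01 => [q0 q1].
by rewrite mul1r ler_wiXn2l// ?(ltW q1)// -ltnS.
Qed.

Lemma psums_tail M q u N k : gbound M q u ->
  normc (psums u (N + k) - psums u N) <= M * q ^+ N / (1 - q).
Proof.
move=> [M0 [q01 Hu]]; have [q0 q1] := andP q01.
have -> : psums u (N + k) - psums u N = \sum_(i < k) u (N + i)%N.
  by rewrite /psums big_split_ord /= addrAC subrr add0r.
apply: (le_trans (normc_sum _ _ _)).
apply: (@le_trans _ _ (\sum_(i < k) M * q ^+ N * q ^+ i)).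
  by apply: ler_sum => i _; rewrite -mulrA -exprD.
by rewrite -mulr_sumr ler_wpM2l ?mulr_ge0 ?exprn_ge0// geo_sum_le.
Qed.

Lemma gbound_cvg M q u : gbound M q u ->
  (fun N => normc (csum u - psums u N)) @ \oo --> (0 : R).
Proof.
move=> Hb; have [M0 [q01 Hu]] := Hb; have [q0 q1] := andP q01.
have cvF (f : CC R -> R) : (forall z, `|f z| <= normc z) ->
    (forall N, f (psums u N) = \sum_(n < N) f (u n)) ->
    (fun N => `|limn (fun N => f (psums u N)) - f (psums u N)|) @ \oo --> (0 : R).
  move=> fle fsum.
  have H : (fun N => f (psums u N)) @ \oo --> limn (fun N => f (psums u N)).
    have -> : (fun N => f (psums u N)) = series (fun n => f (u n)).
      by apply/funext => N; rewrite fsum /series /= big_mkord.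
    apply: normed_cvg; apply: (@series_le_cvg _ _ (geometric M q)).
    - by move=> n; rewrite normr_ge0.
    - by move=> n; rewrite /geometric/= mulr_ge0// exprn_ge0.
    - by move=> n; apply: le_trans (fle _) (Hu _).
    - by apply: is_cvg_geometric_series; rewrite ger0_norm.
  rewrite -(@normr0 _ R); apply: cvg_norm.
  rewrite -(subrr (limn (fun N => f (psums u N)))); apply: cvgB => //.
  exact: cvg_cst.
have cR := cvF (@complex.Re R) (@cRe_le R) (fun N => cRe_sum _ _ _).
have cI := cvF (@complex.Im R) (@cIm_le R) (fun N => cIm_sum _ _ _).
apply: squeeze_cvgr; last 2 first.
- exact: (@cvg_cst _ 0).
- by have := cvgD cR cI; rewrite addr0; apply.
- near=> N; rewrite normc_ge0 /=; apply: (le_trans (normc_le _)).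
  by rewrite cReD cReN cImD cImN.
Unshelve. all: by end_near. Qed.

Lemma csum_tail M q u N : gbound M q u ->
  normc (csum u - psums u N) <= M * q ^+ N / (1 - q).
Proof.
move=> Hb; apply/ler_addgt0Pr => e e0.
have /cvgrPdist_lt/(_ _ e0)[K _ HK] := gbound_cvg Hb.
have := HK (N + K)%N (leq_addl _ _); rewrite /= sub0r normrN ger0_norm ?normc_ge0// => H.
rewrite -(subrKA (psums u (N + K)%N)).
apply: (le_trans (normcD _ _)); rewrite addrC; apply: lerD; last exact: ltW.
exact: psums_tail.
Qed.

Lemma csum_le M q u : gbound M q u -> normc (csum u) <= M / (1 - q).
Proof.
by move=> Hb; have := csum_tail 0 Hb; rewrite expr0 mulr1 /psums big_ord0 subr0.
Qed.

(** The working tool for identities: a sum is identified by an explicit geometric bound on the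
    distance from a candidate [l] to the partial sums. *)
Lemma csum_unique M q K r u l : gbound M q u -> 0 <= r < 1 ->
  (forall N, normc (l - psums u N) <= K * r ^+ N) -> csum u = l.
Proof.
move=> Hb r01 H; apply/eqP; rewrite -subr_eq0; apply/eqP/Normc.eq0_normc/le_anti.
rewrite normc_ge0 andbT; apply/ler_addgt0Pr => e e0; rewrite add0r.
have [M0 [q01 _]] := Hb.
have e2 : 0 < e / 2 by rewrite divr_gt0.
have /cvgrPdist_lt/(_ _ e2)[A _ HA] := gbound_cvg Hb.
have /cvgrPdist_lt/(_ _ e2)[B _ HB] := @geo_cvg0 K r r01.
have := HA (maxn A B) (leq_maxl _ _); have := HB (maxn A B) (leq_maxr _ _).
rewrite /= !sub0r !normrN (ger0_norm (normc_ge0 _)) => h1 h2.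
rewrite -(subrKA (psums u (maxn A B))).
apply: (le_trans (normcD _ _)); rewrite (splitr e); apply: lerD; first exact: ltW.
rewrite normc_distC; apply: (le_trans (H _)); apply: le_trans (ltW h1).
exact: ler_norm.
Qed.

Lemma gbound_weak M q M' q' u : gbound M q u -> M <= M' -> q <= q' -> q' < 1 ->
  gbound M' q' u.
Proof.
move=> [M0 [/andP[q0 q1] Hu]] MM qq q1'; split; first exact: le_trans MM.
split; first by rewrite (le_trans q0).
move=> n; apply: (le_trans (Hu n)); rewrite ler_pM ?exprn_ge0//.
by rewrite lerXn2r// nnegrE (le_trans q0).
Qed.

Lemma gboundD M q u v : gbound M q u -> gbound M q v ->
  gbound (M + M) q (fun n => u n + v n).
Proof.
move=> [M0 [q01 Hu]] [_ [_ Hv]]; split; first exact: addr_ge0.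
split => // n; apply: (le_trans (normcD _ _)); rewrite mulrDl.
by apply: lerD.
Qed.

Lemma gboundZ M q u (a : CC R) : gbound M q u -> gbound (normc a * M) q (fun n => a * u n).
Proof.
move=> [M0 [q01 Hu]]; split; first by rewrite mulr_ge0 ?normc_ge0.
split => // n; rewrite Normc.normcM -mulrA ler_wpM2l ?normc_ge0//.
Qed.

Lemma gboundS M q u : gbound M q u -> gbound M q (fun n => u n.+1).
Proof.
move=> [M0 [q01 Hu]]; split => //; split => // n; apply: (le_trans (Hu _)).
have /andP[q0 q1] := q01.
by rewrite ler_wpM2l// exprS ler_piMl ?exprn_ge0// ltW.
Qed.

Lemma csum_common u v M q M' q' : gbound M q u -> gbound M' q' v ->
  exists M'' q'', gbound M'' q'' u /\ gbound M'' q'' v.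
Proof.
move=> Hu Hv; exists (Num.max M M'), (Num.max q q').
have [_ [/andP[_ q1] _]] := Hu; have [_ [/andP[_ q1'] _]] := Hv.
by split; [apply: (gbound_weak Hu)|apply: (gbound_weak Hv)];
  rewrite ?le_max ?lexx ?orbT// gt_max q1 q1'.
Qed.

Lemma psumsD u v N : psums (fun n => u n + v n) N = psums u N + psums v N.
Proof. by rewrite /psums big_split. Qed.
Lemma psumsZ u (a : CC R) N : psums (fun n => a * u n) N = a * psums u N.
Proof. by rewrite /psums mulr_sumr. Qed.

Lemma csumD M q M' q' u v : gbound M q u -> gbound M' q' v ->
  csum (fun n => u n + v n) = csum u + csum v.
Proof.
move=> Hu0 Hv0; have [M1 [q1 [Hu Hv]]] := csum_common Hu0 Hv0.
have [M0 [q01 _]] := Hu.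
apply: (@csum_unique _ _ ((M1 + M1) / (1 - q1)) q1 _ _ (gboundD Hu Hv)) => // N.
rewrite psumsD opprD addrACA; apply: (le_trans (normcD _ _)).
rewrite mulrAC mulrDl mulrDl; apply: lerD; exact: csum_tail.
Qed.

Lemma csumZ M q u (a : CC R) : gbound M q u -> csum (fun n => a * u n) = a * csum u.
Proof.
move=> Hu; have [M0 [q01 _]] := Hu.
apply: (@csum_unique _ _ ((normc a * M) / (1 - q)) q _ _ (gboundZ a Hu)) => // N.
rewrite psumsZ -mulrBr Normc.normcM mulrAC -!mulrA ler_wpM2l ?normc_ge0//.
rewrite [leRHS]mulrA; exact: csum_tail.
Qed.

Lemma csumS M q u : gbound M q u -> csum u = u 0%N + csum (fun n => u n.+1).
Proof.
move=> Hu; have [M0 [q01 _]] := Hu; have /andP[q0 q1] := q01.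
have -> : csum (fun n => u n.+1) = csum u - u 0%N; last by rewrite addrC subrK.
apply: (@csum_unique _ _ (M / (1 - q)) q _ _ (gboundS Hu)) => // N.
have -> : csum u - u 0%N - psums (fun n => u n.+1) N = csum u - psums u N.+1.
  by rewrite {2}/psums big_ord_recl /= opprD addrA.
apply: (le_trans (csum_tail N.+1 Hu)).
rewrite mulrAC ler_wpM2l// ?divr_ge0// ?subr_ge0 ?(ltW q1)//.
by rewrite exprS ler_piMl ?exprn_ge0// ltW.
Qed.

Lemma csum_ext u v : (forall n, u n = v n) -> csum u = csum v.
Proof. by move=> H; congr csum; apply/funext. Qed.

Lemma csum0 : csum (fun=> 0) = 0.
Proof.
apply: (@csum_unique 0 0 0 0); rewrite ?lexx ?ltr01//.
  by split => //; split; rewrite ?lexx ?ltr01// => n; rewrite Normc.normc0 mul0r.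
by move=> N; rewrite /psums big1// subrr Normc.normc0 mul0r.
Qed.

(** Both iterated sums are compared with the sum over the square [m, n < N]. The distance is at most
    [2 * M / (1 - q) ^+ 2 * q ^+ N], one half from the outer tail and one half from the inner
    tails. *)
Lemma csum_exchange M q (u : nat -> nat -> CC R) : 0 <= M -> 0 <= q < 1 ->
  (forall m n, normc (u m n) <= M * q ^+ m * q ^+ n) ->
  csum (fun m => csum (u m)) = csum (fun n => csum (u ^~ n)).
Proof.
move=> M0 q01 Hu; have /andP[q0 q1] := q01.
have q1' : 0 < 1 - q by rewrite subr_gt0.
have key (v : nat -> nat -> CC R) :
    (forall m n, normc (v m n) <= M * q ^+ m * q ^+ n) ->
    forall N, normc (csum (fun m => csum (v m)) - \sum_(m < N) \sum_(n < N) v m n)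
      <= (2 * M / (1 - q) ^+ 2) * q ^+ N.
  move=> Hv N.
  have Hvm m : gbound (M * q ^+ m) q (v m).
    by split; rewrite ?mulr_ge0 ?exprn_ge0.
  have Hs : gbound (M / (1 - q)) q (fun m => csum (v m)).
    split; first by rewrite divr_ge0// ltW.
    by split => // m; rewrite mulrAC; exact: csum_le (Hvm m).
  rewrite -(subrKA (psums (fun m => csum (v m)) N)).
  apply: (le_trans (normcD _ _)).
  have -> : 2 * M / (1 - q) ^+ 2 * q ^+ N =
      M / (1 - q) * q ^+ N / (1 - q) + M * q ^+ N / (1 - q) * (1 - q)^-1.
    by field; rewrite gt_eqF.
  apply: lerD; first exact: csum_tail.
  rewrite /psums -sumrB; apply: (le_trans (normc_sum _ _ _)).
  apply: (@le_trans _ _ (\sum_(m < N) M * q ^+ N / (1 - q) * q ^+ m)).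
    apply: ler_sum => m _; apply: (le_trans (csum_tail N (Hvm m))).
    by rewrite le_eqVlt; apply/orP; left; apply/eqP; ring.
  rewrite -mulr_sumr ler_wpM2l ?geo_sum_le//.
  by rewrite divr_ge0 ?mulr_ge0 ?exprn_ge0// ltW.
have k1 := key _ Hu.
have k2 := key (fun n m => u m n) (fun n m => le_trans (Hu m n)
   (eq_ind _ (fun x => M * q ^+ m * q ^+ n <= x) (lexx _) _ (mulrAC M (q ^+ m) (q ^+ n)))).
apply/eqP; rewrite -subr_eq0; apply/eqP/Normc.eq0_normc/le_anti.
rewrite normc_ge0 andbT; apply/ler_addgt0Pr => e e0; rewrite add0r.
have e2 : 0 < e / 2 by rewrite divr_gt0.
have [N HN] := @geo_small (2 * M / (1 - q) ^+ 2) q _ q01 e2.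
rewrite -(subrKA (\sum_(m < N) \sum_(n < N) u m n)).
apply: (le_trans (normcD _ _)); rewrite (splitr e); apply: lerD.
  exact: le_trans (k1 N) (ltW HN).
rewrite normc_distC exchange_big /=; exact: le_trans (k2 N) (ltW HN).
Qed.

End Series.

(* From here on sums are handled through their rules, and unification does not unfold them into two
   real limits. *)
#[global] Opaque csum.

Section SeriesB.
Context {R : realType}.
Implicit Types (u v : nat -> CC R) (M q : R).

Lemma gboundB M q M' q' u v : gbound M q u -> gbound M' q' v ->
  exists M'' q'', gbound M'' q'' (fun n => u n - v n).
Proof.
move=> Hu Hv; have [N [p [Hu' Hv']]] := csum_common Hu Hv.
exists (N + N), p; split; first by rewrite addr_ge0//; case: Hu'.
split; first by case: Hu' => _ [].
move=> n; apply: (le_trans (normcB _ _)); rewrite mulrDl.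
by apply: lerD; [case: Hu' => _ []|case: Hv' => _ []].
Qed.

Lemma csumB M q M' q' u v : gbound M q u -> gbound M' q' v ->
  csum (fun n => u n - v n) = csum u - csum v.
Proof.
move=> Hu Hv; rewrite -[- csum v]mulN1r -(csumZ (-1) Hv) -(csumD Hu (gboundZ (-1) Hv)).
by apply: csum_ext => n; rewrite mulN1r.
Qed.

End SeriesB.

(** * Power series on the unit disc *)

Section PowerSeries.
Context {R : realType}.
Local Notation normc := (@Normc.normc R).
Implicit Types (c : nat -> CC R) (z w : CC R) (r : R).

(** Cauchy's estimates for every radius below 1, that is, a radius of convergence of at least 1. *)
Definition tame c := forall r, 0 <= r < 1 ->
  exists M, 0 <= M /\ forall n, normc (c n) * r ^+ n <= M.

Definition pser c z : CC R := csum (fun n => c n * z ^+ n).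

Definition dcoef c n : CC R := n.+1%:R * c n.+1.

Definition scons (a : CC R) c n : CC R := if n is n'.+1 then c n' else a.

(** Chosen with [1 - midr r = (1 - r) / 4], so that [r <= midr r ^+ 4] as in Bernoulli's inequality:
    a radius [r] leaves room for four powers of one number below 1. *)
Definition midr r : R := (3 + r) / 4.

Lemma midr_itv r : 0 <= r < 1 -> 0 < midr r < 1.
Proof. by rewrite /midr => /andP[? ?]; apply/andP; split; lra. Qed.

Lemma midr_ge r : 0 <= r < 1 -> r <= midr r ^+ 4.
Proof.
move=> r01; have /andP[p0 p1] := midr_itv r01.
rewrite -subr_ge0 {2}(_ : r = 1 - 4 * (1 - midr r)); last by rewrite /midr; field.
set p := midr r.
have -> : p ^+ 4 - (1 - 4 * (1 - p)) = (1 - p) ^+ 2 * ((1 + p) ^+ 2 + 2) by ring.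
by rewrite mulr_ge0 ?sqr_ge0// addr_ge0 ?sqr_ge0.
Qed.

Lemma normc_natr n : normc (n%:R : CC R) = n%:R.
Proof.
have := abs2_natr (R := R) n; rewrite /abs2 => /eqP.
by rewrite eqrXn2 ?normc_ge0 ?ler0n// => /eqP.
Qed.

(** The index is meant for the other variable: [I] will be a closed disc, over which the Taylor
    remainder has to be uniform. *)
Definition utame (I : Type) (c : I -> nat -> CC R) := forall r, 0 <= r < 1 ->
  exists M, 0 <= M /\ forall i n, normc (c i n) * r ^+ n <= M.

(** With [p = midr r] and [r <= p ^+ 4], one power [p ^+ n] bounds the coefficient, two absorb the
    square of [n.+1] by [mulSn_geo_le], and the last one remains as geometric decay. *)
Lemma utame_gbound2 I (c : I -> nat -> CC R) r : utame c -> 0 <= r < 1 -> exists M q,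
  [/\ 0 <= M, 0 <= q < 1 &
    forall i n, normc (c i n) * r ^+ n * n.+1%:R ^+ 2 <= M * q ^+ n].
Proof.
move=> tc r01; have /andP[p0 p1] := midr_itv r01; have rp := midr_ge r01.
set p := midr r in p0 p1 rp *.
have p01 : 0 <= p < 1 by rewrite ltW.
have [M [M0 HM]] := tc p p01.
exists (M / (1 - p) ^+ 2), p; split => //.
  by rewrite divr_ge0 ?exprn_ge0// subr_ge0 ltW.
move=> i n; have /andP[r0 r1] := r01.
have p1n : 0 <= p ^+ n by rewrite exprn_ge0// ltW.
apply: (@le_trans _ _ (normc (c i n) * p ^+ n * (n.+1%:R * p ^+ n) ^+ 2 * p ^+ n)).
  have -> : normc (c i n) * p ^+ n * (n.+1%:R * p ^+ n) ^+ 2 * p ^+ n =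
            normc (c i n) * (p ^+ 4) ^+ n * n.+1%:R ^+ 2.
    by rewrite -exprM mulnC exprM; ring.
  rewrite ler_wpM2r ?sqr_ge0// ler_wpM2l ?normc_ge0//.
  by rewrite lerXn2r// nnegrE// exprn_ge0// ltW.
rewrite ler_wpM2r// ler_pM ?mulr_ge0 ?normc_ge0 ?sqr_ge0//.
rewrite -exprVn lerXn2r ?nnegrE ?invr_ge0 ?subr_ge0 ?(ltW p1) ?mulr_ge0//.
exact: mulSn_geo_le.
Qed.

Lemma utame_tame I (c : I -> nat -> CC R) i : utame c -> tame (c i).
Proof. by move=> H r r01; have [M [M0 HM]] := H r r01; exists M; split. Qed.

Lemma tame_utame c : tame c -> utame (fun _ : unit => c).
Proof. by move=> H r r01; have [M [M0 HM]] := H r r01; exists M; split. Qed.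

Lemma tame_gbound2 c r : tame c -> 0 <= r < 1 -> exists M q,
  [/\ 0 <= M, 0 <= q < 1 & forall n, normc (c n) * r ^+ n * n.+1%:R ^+ 2 <= M * q ^+ n].
Proof.
move=> /tame_utame tc r01; have [M [q [M0 q01 H]]] := utame_gbound2 tc r01.
by exists M, q; split => // n; exact: (H tt).
Qed.

Lemma tame_gbound c r : tame c -> 0 <= r < 1 -> exists M q,
  forall z, normc z <= r -> gbound M q (fun n => c n * z ^+ n).
Proof.
move=> tc r01; have [M [q [M0 q01 H]]] := tame_gbound2 tc r01.
exists M, q => z zr; split => //; split => // n; apply: le_trans (H n).
have /andP[r0 r1] := r01.
rewrite Normc.normcM normc_X -[leLHS]mulr1 ler_pM ?mulr_ge0 ?exprn_ge0 ?normc_ge0//.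
  by rewrite ler_wpM2l ?normc_ge0// lerXn2r// nnegrE normc_ge0.
by rewrite -natrX ler1n expn_gt0.
Qed.

Lemma tame_gboundz c z : tame c -> disc z -> exists M q, gbound M q (fun n => c n * z ^+ n).
Proof.
move=> tc /discE zd; have r01 : 0 <= normc z < 1 by rewrite normc_ge0.
by have [M [q H]] := tame_gbound tc r01; exists M, q; exact: H.
Qed.

Lemma tameD c d : tame c -> tame d -> tame (fun n => c n + d n).
Proof.
move=> tc td r r01; have [M [M0 HM]] := tc r r01; have [N [N0 HN]] := td r r01.
exists (M + N); split; first exact: addr_ge0.
move=> n; apply: le_trans (lerD (HM n) (HN n)); rewrite -mulrDl.
by rewrite ler_wpM2r ?normcD// exprn_ge0//; case/andP: r01.
Qed.

Lemma tameZ (a : CC R) c : tame c -> tame (fun n => a * c n).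
Proof.
move=> tc r r01; have [M [M0 HM]] := tc r r01.
exists (normc a * M); split; first by rewrite mulr_ge0 ?normc_ge0.
by move=> n; rewrite Normc.normcM -mulrA ler_wpM2l ?normc_ge0.
Qed.

Lemma tame_le c d : tame c -> (forall n, normc (d n) <= normc (c n)) -> tame d.
Proof.
move=> tc dc r r01; have [M [M0 HM]] := tc r r01; exists M; split => // n.
apply: le_trans (HM n); rewrite ler_wpM2r// exprn_ge0//; by case/andP: r01.
Qed.

Lemma tame_dcoef c : tame c -> tame (dcoef c).
Proof.
move=> tc r r01.
have s01 : 0 <= (1 + r) / 2 < 1 by move/andP: r01 => [? ?]; apply/andP; split; lra.
have [M [q [M0 /andP[q0 q1] H]]] := tame_gbound2 tc s01.
exists (2 * M); split; first by rewrite mulr_ge0.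
move=> n; set s := (1 + r) / 2 in s01 H.
have /andP[r0 r1] := r01; have rs : r <= s by rewrite /s; lra.
have s12 : 1 / 2 <= s by rewrite /s; lra.
have s0 : 0 < s by apply: lt_le_trans s12; lra.
have Hn : normc (c n.+1) * s ^+ n.+1 * n.+2%:R ^+ 2 <= M.
  by apply: (le_trans (H _)); rewrite ler_piMr// exprn_ile1// ltW.
rewrite /dcoef Normc.normcM normc_natr.
(* Since [s >= 1 / 2], the factor [2 * s >= 1] pays for the power of [s] lost by the shift of the
   index. *)
apply: (@le_trans _ _ (2 * (normc (c n.+1) * s ^+ n.+1 * n.+2%:R ^+ 2))); last first.
  by rewrite ler_wpM2l.
have e1 : r ^+ n <= s ^+ n by rewrite lerXn2r// nnegrE// ltW.
have e2 : n.+1%:R <= n.+2%:R ^+ 2 :> R by rewrite -natrX ler_nat; apply: (@leq_trans n.+2); rewrite // leq_pmulr.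
have c0 := normc_ge0 (c n.+1).
apply: (@le_trans _ _ (normc (c n.+1) * s ^+ n * n.+2%:R ^+ 2)).
  rewrite [n.+1%:R * _]mulrC -!mulrA ler_wpM2l// mulrC.
  by rewrite ler_pM ?exprn_ge0.
rewrite (exprS s).
have -> : 2 * (normc (c n.+1) * (s * s ^+ n) * n.+2%:R ^+ 2) =
  (2 * s) * (normc (c n.+1) * s ^+ n * n.+2%:R ^+ 2) by ring.
rewrite ler_peMl ?mulr_ge0 ?exprn_ge0 ?(ltW s0)//; lra.
Qed.

(** Dropping the factor [n.+1] can only decrease the coefficients of the derivative. *)
Lemma tameS c : tame c -> tame (fun n => c n.+1).
Proof.
move=> /tame_dcoef tc; apply: (tame_le tc) => n.
rewrite /dcoef Normc.normcM normc_natr ler_peMl ?normc_ge0//.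
by rewrite ler1n.
Qed.

Lemma tame_scons a c : tame c -> tame (scons a c).
Proof.
move=> tc r r01; have [M [M0 HM]] := tc r r01; have /andP[r0 r1] := r01.
exists (normc a + M); split; first by rewrite addr_ge0 ?normc_ge0.
case=> [|n]; first by rewrite expr0 mulr1 lerDl.
rewrite /= exprS mulrCA; apply: (@le_trans _ _ M); last by rewrite lerDr normc_ge0.
apply: le_trans (HM n); rewrite ler_piMl ?mulr_ge0 ?normc_ge0 ?exprn_ge0// ltW//.
Qed.

Lemma tame_bounded c B : (forall n, normc (c n) <= B) -> tame c.
Proof.
move=> H r r01; have B0 : 0 <= B by exact: le_trans (normc_ge0 _) (H 0%N).
exists B; split => // n; apply: le_trans (H n).
rewrite ler_piMr ?normc_ge0//; exact: geo_le1.
Qed.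

Lemma pserD c d z : tame c -> tame d -> disc z ->
  pser (fun n => c n + d n) z = pser c z + pser d z.
Proof.
move=> tc td zd; have [M [q Hc]] := tame_gboundz tc zd.
have [M' [q' Hd]] := tame_gboundz td zd.
by rewrite /pser -(csumD Hc Hd); apply: csum_ext => n; rewrite mulrDl.
Qed.

Lemma pserZ (a : CC R) c z : tame c -> disc z ->
  pser (fun n => a * c n) z = a * pser c z.
Proof.
move=> tc zd; have [M [q Hc]] := tame_gboundz tc zd.
by rewrite /pser -(csumZ a Hc); apply: csum_ext => n; rewrite mulrA.
Qed.

Lemma pserS c z : tame c -> disc z -> pser c z = c 0%N + z * pser (fun n => c n.+1) z.
Proof.
move=> tc zd; have [M [q Hc]] := tame_gboundz tc zd.
have [M' [q' Hd]] := tame_gboundz (tameS tc) zd.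
rewrite /pser (csumS Hc) expr0 mulr1 -(csumZ z Hd); congr (_ + _).
by apply: csum_ext => n; rewrite exprS mulrCA.
Qed.

Lemma pser_scons a c z : tame c -> disc z -> pser (scons a c) z = a + z * pser c z.
Proof. by move=> tc zd; rewrite pserS//; exact: tame_scons. Qed.

Lemma pser0 c : tame c -> pser c 0 = c 0%N.
Proof. by move=> tc; rewrite pserS ?mul0r ?addr0//; exact: disc0. Qed.

(* The Taylor remainder satisfies e_(n+1) = w e_n + n z^(n-1) (w - z)^2. *)
Lemma expr_taylor2 (s : R) z w n : 0 <= s -> normc z <= s -> normc w <= s ->
  normc (w ^+ n.+1 - z ^+ n.+1 - (w - z) * (n.+1%:R * z ^+ n)) * s
  <= n.+1%:R ^+ 2 * s ^+ n * normc (w - z) ^+ 2.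
Proof.
move=> s0 zs ws; elim: n => [|n IH].
  rewrite !expr1 expr0 !mulr1 subrr Normc.normc0 mul0r.
  by rewrite !mulr_ge0 ?normc_ge0 ?sqr_ge0.
set h := w - z in IH *.
set e := (X in normc X * s <= _) in IH.
have -> : w ^+ n.+2 - z ^+ n.+2 - h * (n.+2%:R * z ^+ n.+1) =
    w * e + n.+1%:R * z ^+ n * h ^+ 2.
  have -> : n.+2%:R = n.+1%:R + 1 :> CC R by rewrite -natr1.
  by rewrite /e /h !exprS; ring.
set N : R := n.+1%:R in IH *.
have hs : 0 <= normc h ^+ 2 by rewrite sqr_ge0.
apply: (@le_trans _ _ ((s * normc e + N * s ^+ n * normc h ^+ 2) * s)).
  apply: ler_wpM2r => //; apply: (le_trans (normcD _ _)); apply: lerD.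
    by rewrite Normc.normcM ler_wpM2r ?normc_ge0.
  rewrite !Normc.normcM !normc_X normc_natr ler_wpM2r// ler_wpM2l ?ler0n//.
  by rewrite lerXn2r// nnegrE normc_ge0.
rewrite mulrDl -mulrA.
apply: (@le_trans _ _ (s * (N ^+ 2 * s ^+ n * normc h ^+ 2) + N * s ^+ n * normc h ^+ 2 * s)).
  by rewrite lerD2r ler_wpM2l.
have -> : s * (N ^+ 2 * s ^+ n * normc h ^+ 2) + N * s ^+ n * normc h ^+ 2 * s =
  (N ^+ 2 + N) * (s ^+ n.+1 * normc h ^+ 2) by rewrite (exprS s); ring.
rewrite -mulrA ler_wpM2r ?mulr_ge0 ?exprn_ge0 ?normc_ge0//.
have -> : n.+2%:R = N + 1 :> R by rewrite /N natr1.
have N0 : 0 <= N by rewrite ler0n.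
nra.
Qed.

(** The remainder is estimated term by term: [expr_taylor2] costs a factor quadratic in the index,
    which [utame_gbound2] absorbs. The constant [K] precedes the index [i], and this uniformity is
    what differentiability in two variables requires. *)
Lemma pser_utaylor2 I (C : I -> nat -> CC R) r : utame C -> 0 <= r < 1 -> exists K,
  forall i z w, normc z <= r -> normc w <= r ->
  normc (pser (C i) w - pser (C i) z - (w - z) * pser (dcoef (C i)) z)
    <= K * normc (w - z) ^+ 2.
Proof.
move=> utC r01.
set s := (1 + r) / 2.
have /andP[r0 r1] := r01; have rs : r <= s by rewrite /s; lra.
have s01 : 0 <= s < 1 by rewrite /s; apply/andP; split; lra.
have s0 : 0 < s by rewrite /s; lra.
have [M [q [M0 q01 HC]]] := utame_gbound2 utC s01; have /andP[q0 q1] := q01.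
exists (M / s ^+ 2 / (1 - q)) => i z w zr wr.
have H := HC i; have tc := utame_tame i utC; set c := C i in H tc *.
have zd : disc z by apply/discE; exact: le_lt_trans zr r1.
have wd : disc w by apply/discE; exact: le_lt_trans wr r1.
have [Mz [qz Hz]] := tame_gboundz tc zd.
have [Mw [qw Hw]] := tame_gboundz tc wd.
have [Md [qd Hd]] := tame_gboundz (tame_dcoef tc) zd.
rewrite /pser (csumS Hw) (csumS Hz) !expr0 opprD addrACA subrr add0r.
rewrite -(csumZ (w - z) Hd).
have Hzw := gboundZ (w - z) Hd.
rewrite -(csumB (gboundS Hw) (gboundS Hz)).
have [M1 [q1' Hwz]] := gboundB (gboundS Hw) (gboundS Hz).
rewrite -(csumB Hwz Hzw); set t := (X in csum X).
suff Ht : gbound (M / s ^+ 2 * normc (w - z) ^+ 2) q t.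
  by rewrite mulrAC; exact: csum_le Ht.
split; first by rewrite mulr_ge0 ?sqr_ge0// divr_ge0// sqr_ge0.
split => // n; rewrite /t /dcoef.
have -> : c n.+1 * w ^+ n.+1 - c n.+1 * z ^+ n.+1 - (w - z) * (n.+1%:R * c n.+1 * z ^+ n)
  = c n.+1 * (w ^+ n.+1 - z ^+ n.+1 - (w - z) * (n.+1%:R * z ^+ n)) by ring.
rewrite Normc.normcM.
have := @expr_taylor2 s z w n (ltW s0) (le_trans zr rs) (le_trans wr rs).
set e := normc (_ - _ - _) => He.
rewrite -(ler_pM2r (exprn_gt0 2 s0)).
have -> : M / s ^+ 2 * normc (w - z) ^+ 2 * q ^+ n * s ^+ 2 =
  M * q ^+ n * normc (w - z) ^+ 2 by field; rewrite gt_eqF.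
apply: (@le_trans _ _ (normc (c n.+1) * s ^+ n.+1 * n.+2%:R ^+ 2 * normc (w - z) ^+ 2)); last first.
  rewrite ler_wpM2r ?sqr_ge0//; apply: (le_trans (H _)).
  by rewrite ler_wpM2l// exprS ler_piMl ?exprn_ge0// ltW.
rewrite -!mulrA ler_wpM2l ?normc_ge0//.
have -> : e * s ^+ 2 = s * (e * s) by ring.
apply: (le_trans (ler_wpM2l (ltW s0) He)).
have -> : s * (n.+1%:R ^+ 2 * s ^+ n * normc (w - z) ^+ 2) =
   s ^+ n.+1 * normc (w - z) ^+ 2 * n.+1%:R ^+ 2 by rewrite (exprS s); ring.
(* The coefficient has index [n.+1], so [utame_gbound2] offers the square of [n.+2], slightly more
   than the square of [n.+1] in the remainder. *)
apply: (@le_trans _ _ (s ^+ n.+1 * normc (w - z) ^+ 2 * n.+2%:R ^+ 2)); last first.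
  by rewrite le_eqVlt; apply/orP; left; apply/eqP; ring.
rewrite ler_wpM2l ?mulr_ge0 ?sqr_ge0 ?exprn_ge0 ?normc_ge0 ?(ltW s0)//.
by rewrite lerXn2r ?nnegrE ?ler0n// ler_nat.
Qed.

Lemma pser_taylor2 c r : tame c -> 0 <= r < 1 -> exists K,
  forall z w, normc z <= r -> normc w <= r ->
  normc (pser c w - pser c z - (w - z) * pser (dcoef c) z) <= K * normc (w - z) ^+ 2.
Proof.
move=> /tame_utame tc r01; have [K H] := pser_utaylor2 tc r01.
by exists K => z w; exact: (H tt).
Qed.

End PowerSeries.

(** * Neighbourhoods and complex derivatives in terms of real radii *)

Section ComplexCalculus.
Context {R : realType}.
Local Notation normc := (@Normc.normc R).
Implicit Types (z w : CC R).

Lemma lt_normc_C z (e : R) : (`|z| < Complex e 0 :> CC R) = (normc z < e).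
Proof. by rewrite normc_normr; exact: ltcR. Qed.
Lemma le_normc_C z (e : R) : (`|z| <= Complex e 0 :> CC R) = (normc z <= e).
Proof. by rewrite normc_normr; exact: lecR. Qed.
Lemma gt0_C (e : R) : (0 < (Complex e 0 : CC R)) = (0 < e).
Proof. exact: ltcR. Qed.
(** Comparable elements of [R[i]] have equal imaginary parts, so a positive radius is real. This
    converts statements about the complex-valued norm into real estimates. *)
Lemma gt0C_real (e : CC R) : 0 < e -> exists2 e' : R, 0 < e' & e = Complex e' 0.
Proof.
case: e => a b; rewrite (ltcE 0 (Complex a b)) /= => /andP[/eqP -> a0].
by exists a.
Qed.

Lemma nbhs_CCP z (P : set (CC R)) :
  nbhs z P <-> exists2 d : R, 0 < d & forall w, normc (w - z) < d -> P w.
Proof.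
split=> [/nbhs_normP[e /= e0 H]|[d d0 H]].
  have [d d0 E] := gt0C_real e0; exists d => // w wd; apply: H => /=.
  by rewrite E lt_normc_C normc_distC.
apply/nbhs_normP; exists (Complex d 0); first by rewrite /= gt0_C.
by move=> w /=; rewrite lt_normc_C normc_distC; exact: H.
Qed.

Lemma derive1_normc (f : CC R -> CC R) z d :
  (forall e : R, 0 < e -> exists2 del : R, 0 < del & forall w, normc (w - z) < del ->
     normc (f w - f z - (w - z) * d) <= e * normc (w - z)) ->
  derive1 f z = d.
Proof.
move=> H; apply: cvg_lim => //; apply/cvgrPdist_le => e' e0'.
have [e e0 ->] := gt0C_real e0'; have [del del0 Hd] := H e e0.
rewrite near_withinE; apply/nbhs_CCP; exists del => // h.
rewrite subr0 => hd hn0; rewrite le_normc_C normc_distC /=.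
have := Hd (h + z); rewrite addrK => /(_ hd) Hh.
have nh : 0 < normc h by rewrite normc_gt0.
rewrite -(ler_pM2r nh) -Normc.normcM; apply: le_trans Hh.
rewrite (_ : (_ - d) * h = f (h + z) - f z - h * d)//.
by rewrite mulrBl [h * d]mulrC /GRing.scale /= mulrAC mulVf// mul1r.
Qed.

Lemma derive1_pser c z : tame c -> disc z -> derive1 (pser c) z = pser (dcoef c) z.
Proof.
move=> tc /discE zd; apply: derive1_normc => e e0.
set r := (1 + normc z) / 2; have z0 := normc_ge0 z.
have r01 : 0 <= r < 1 by rewrite /r; apply/andP; split; lra.
have zr : normc z <= r by rewrite /r; lra.
have [K HK] := pser_taylor2 tc r01.
set K' := Num.max K 1; have K0 : 0 < K' by rewrite lt_max ltr01 orbT.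
(* The first bound keeps [w] in the disc of radius [r], where the Taylor constant holds; the second
   makes the quadratic remainder at most [e * normc (w - z)]. *)
exists (Num.min ((1 - normc z) / 2) (e / K')).
  by rewrite lt_min divr_gt0 ?subr_gt0//= divr_gt0.
move=> w; rewrite lt_min => /andP[wr we].
have wr' : normc w <= r.
  rewrite -(subrK z w); apply: (le_trans (normcD _ _)).
  by move: wr; rewrite /r; lra.
apply: (le_trans (HK _ _ zr wr')); rewrite expr2 mulrA ler_wpM2r ?normc_ge0//.
apply: (@le_trans _ _ (K' * normc (w - z))).
  by rewrite ler_wpM2r ?normc_ge0// le_max lexx.
by rewrite mulrC -ler_pdivlMr// ltW.
Qed.

Lemma derive1_near (f g : CC R -> CC R) z :
  (forall w, disc w -> f w = g w) -> disc z -> derive1 f z = derive1 g z.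
Proof.
move=> fg zd; rewrite !derive1E; apply: near_eq_derive.
apply/nbhs_CCP; exists (1 - normc z); first by rewrite subr_gt0; exact/discE.
move=> w wz; apply: fg; apply/discE; rewrite -(subrK z w).
by apply: (le_lt_trans (normcD _ _)); rewrite -ltrBrDr.
Qed.

End ComplexCalculus.

(** * Measurability of complex functions *)

Section ComplexMeasurable.
Context {R : realType} d (T : measurableType d).
Implicit Types (D : set T) (f g : T -> CC R).
Local Notation normc := (@Normc.normc R).

Definition cmeas D f := measurable_fun D (fun x => complex.Re (f x)) /\
  measurable_fun D (fun x => complex.Im (f x)).

Lemma cmeas_cst D (a : CC R) : cmeas D (fun=> a).
Proof. by split; exact: measurable_cst. Qed.

Lemma cmeas_eq D f g : (forall x, D x -> f x = g x) -> cmeas D g -> cmeas D f.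
Proof.
move=> H [mR mI]; split.
- by apply: eq_measurable_fun mR => x /set_mem Dx; rewrite H.
- by apply: eq_measurable_fun mI => x /set_mem Dx; rewrite H.
Qed.

Lemma cmeasD D f g : cmeas D f -> cmeas D g -> cmeas D (fun x => f x + g x).
Proof.
move=> [fR fI] [gR gI]; split.
- by under eq_fun do rewrite cReD; exact: measurable_funD.
- by under eq_fun do rewrite cImD; exact: measurable_funD.
Qed.

Lemma cmeasM D f g : cmeas D f -> cmeas D g -> cmeas D (fun x => f x * g x).
Proof.
move=> [fR fI] [gR gI]; split.
- under eq_fun do rewrite cReM; apply: measurable_funB; exact: measurable_funM.
- under eq_fun do rewrite cImM; apply: measurable_funD; exact: measurable_funM.
Qed.

Lemma cmeasX D f n : cmeas D f -> cmeas D (fun x => f x ^+ n).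
Proof.
move=> mf; elim: n => [|n IH].
  by apply: cmeas_eq (cmeas_cst D 1) => x _; rewrite expr0.
by apply: cmeas_eq (cmeasM mf IH) => x _; rewrite exprS.
Qed.

Lemma cmeas_sum D (F : nat -> T -> CC R) n : (forall i, cmeas D (F i)) ->
  cmeas D (fun x => \sum_(i < n) F i x).
Proof.
move=> mF; elim: n => [|n IH].
  by apply: cmeas_eq (cmeas_cst D 0) => x _; rewrite big_ord0.
by apply: cmeas_eq (cmeasD IH (mF n)) => x _; rewrite big_ord_recr.
Qed.

(** A pointwise limit of measurable partial sums. The auxiliary [h] stands for the real and the
    imaginary part at once: additive and dominated by the norm. *)
Lemma cmeas_csum D (F : nat -> T -> CC R) : (forall i, cmeas D (F i)) ->
  (forall x, D x -> exists M q, gbound M q (F ^~ x)) ->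
  cmeas D (fun x => csum (F ^~ x)).
Proof.
move=> mF gF.
have key (h : CC R -> R) : (forall z, `|h z| <= normc z) ->
    (forall z w, h (z - w) = h z - h w) ->
    forall x, D x -> (fun N => h (psums (F ^~ x) N)) @ \oo --> h (csum (F ^~ x)).
  move=> hle hB x Dx; have [M [q Hb]] := gF x Dx.
  apply/cvgrPdist_lt => e e0.
  have /cvgrPdist_lt/(_ _ e0)[K _ HK] := gbound_cvg Hb.
  exists K => // N KN; rewrite -hB; apply: (le_lt_trans (hle _)).
  have := HK N KN; rewrite /= sub0r normrN ger0_norm ?normc_ge0//.
split.
- apply: (@measurable_fun_cvg _ _ _ D (fun N x => complex.Re (psums (F ^~ x) N))).
  + by move=> N; have [] := @cmeas_sum D F N mF.
  + by apply: key => [|z w]; [exact: cRe_le|rewrite cReD cReN].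
- apply: (@measurable_fun_cvg _ _ _ D (fun N x => complex.Im (psums (F ^~ x) N))).
  + by move=> N; have [] := @cmeas_sum D F N mF.
  + by apply: key => [|z w]; [exact: cIm_le|rewrite cImD cImN].
Qed.

Lemma cmeas_pser D (c : nat -> T -> CC R) f : (forall n, cmeas D (c n)) ->
  (forall x, D x -> tame (c ^~ x)) -> cmeas D f -> (forall x, D x -> disc (f x)) ->
  cmeas D (fun x => pser (c ^~ x) (f x)).
Proof.
move=> mc tc mf df.
apply: (@cmeas_csum D (fun n x => c n x * f x ^+ n)).
  by move=> n; apply: cmeasM => //; exact: cmeasX.
by move=> x Dx; apply: tame_gboundz; [exact: tc|exact: df].
Qed.

Lemma measurable_abs2 D f : cmeas D f -> measurable_fun D (fun x => abs2 (f x)).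
Proof.
move=> [fR fI]; under eq_fun do rewrite abs2E.
by apply: measurable_funD; exact: measurable_funX.
Qed.

Lemma measurable_eabs2 D f : cmeas D f -> measurable_fun D (fun x => (abs2 (f x))%:E).
Proof. by move=> mf; apply/measurable_EFinP; exact: measurable_abs2. Qed.

Lemma cmeas_Complex D (a b : T -> R) : measurable_fun D a -> measurable_fun D b ->
  cmeas D (fun x => Complex (a x) (b x)).
Proof. by move=> ma mb; split. Qed.

Lemma cmeas_cis D (a : T -> R) : measurable_fun D a -> cmeas D (fun x => cis (a x)).
Proof.
move=> ma; apply: cmeas_Complex.
- by apply: (@measurableT_comp _ _ _ _ _ _ (@cos R)) => //; exact: continuous_measurable_fun (@continuous_cos R).
- by apply: (@measurableT_comp _ _ _ _ _ _ (@sin R)) => //; exact: continuous_measurable_fun (@continuous_sin R).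
Qed.

End ComplexMeasurable.

(** * Parseval's identity *)

Section CircleIntegral.
Context {R : realType}.
Local Notation normc := (@Normc.normc R).
Local Notation leb := (@lebesgue_measure R).
Implicit Types (f g : R -> R).

Lemma cont_integrable f a b : continuous f ->
  leb.-integrable `[a, b] (EFin \o f).
Proof.
move=> cf; apply: continuous_compact_integrable; first exact: segment_compact.
exact: continuous_subspaceT.
Qed.

Definition cint f : R := \int[leb]_(t in `[0, 2 * pi]) f t.

Lemma twopi_gt0 : 0 < 2 * pi :> R.
Proof. by rewrite mulr_gt0// pi_gt0. Qed.

Lemma cint_FTC f (F : R -> R) : continuous f ->
  (forall x, is_derive x (1 : R) F (f x)) -> cint f = F (2 * pi) - F 0.
Proof.
move=> cf dF; rewrite /cint /Rintegral (@continuous_FTC2 _ f F)//.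
- exact: twopi_gt0.
- exact: continuous_subspaceT.
- have cF x : {for x, continuous F}.
    by apply: differentiable_continuous; apply/derivable1_diffP; case: (dF x).
  split.
  + by move=> x _; case: (dF x).
  + exact: cvg_at_right_filter (cF _).
  + exact: cvg_at_left_filter (cF _).
- by move=> x _; rewrite derive1E; exact: derive_val.
Qed.

Lemma cintD f g : continuous f -> continuous g ->
  cint (fun t => f t + g t) = cint f + cint g.
Proof. by move=> cf cg; rewrite /cint RintegralD//; exact: cont_integrable. Qed.

Lemma cintZ (k : R) f : continuous f -> cint (fun t => k * f t) = k * cint f.
Proof. by move=> cf; rewrite /cint RintegralZl//; exact: cont_integrable. Qed.

Lemma cint_cst (k : R) : cint (fun=> k) = 2 * pi * k.
Proof.
rewrite /cint Rintegral_cst//= lebesgue_measure_itv/= lte_fin twopi_gt0.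
by rewrite -EFinB /= subr0 mulrC.
Qed.

Lemma cos_npi (k : nat) : cos (k%:R * (2 * pi)) = 1 :> R.
Proof.
have : cis (k%:R * (2 * pi)) = (1 : CC R).
  by rewrite -cisX /cis mulr_natl cos2pi sin2pi expr1n.
by case.
Qed.

Lemma sin_npi (k : nat) : sin (k%:R * (2 * pi)) = 0 :> R.
Proof.
have : cis (k%:R * (2 * pi)) = (1 : CC R).
  by rewrite -cisX /cis mulr_natl cos2pi sin2pi expr1n.
by case.
Qed.

Lemma continuous_cosM (k : R) : continuous (fun t => cos (k * t)).
Proof.
move=> t; apply: (@continuous_comp _ _ _ (fun t => k * t) cos).
  exact: mulrl_continuous.
exact: continuous_cos.
Qed.
Lemma continuous_sinM (k : R) : continuous (fun t => sin (k * t)).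
Proof.
move=> t; apply: (@continuous_comp _ _ _ (fun t => k * t) sin).
  exact: mulrl_continuous.
exact: continuous_sin.
Qed.

Lemma cint_cos (k : nat) : (0 < k)%N -> cint (fun t => cos (k%:R * t)) = 0.
Proof.
move=> k0; have kn0 : k%:R != 0 :> R by rewrite pnatr_eq0 -lt0n.
have dF (x : R) : is_derive x (1 : R) (fun t => k%:R^-1 * sin (k%:R * t)) (cos (k%:R * x)).
  by apply: is_derive_eq; rewrite /GRing.scale /=; field.
rewrite (cint_FTC (@continuous_cosM k%:R) dF).
by rewrite sin_npi !mulr0 sin0 mulr0 subrr.
Qed.

Lemma cint_sin (k : nat) : (0 < k)%N -> cint (fun t => sin (k%:R * t)) = 0.
Proof.
move=> k0; have kn0 : k%:R != 0 :> R by rewrite pnatr_eq0 -lt0n.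
have dF (x : R) : is_derive x (1 : R) (fun t => - k%:R^-1 * cos (k%:R * t)) (sin (k%:R * x)).
  by apply: is_derive_eq; rewrite /GRing.scale /=; field.
rewrite (cint_FTC (@continuous_sinM k%:R) dF).
by rewrite cos_npi mulr0 cos0 subrr.
Qed.

Definition ccont (f : R -> CC R) := continuous (fun t => complex.Re (f t)) /\
  continuous (fun t => complex.Im (f t)).

Lemma ccont_cst a : ccont (fun=> a).
Proof. by split => t; exact: cvg_cst. Qed.
Lemma ccontD F G : ccont F -> ccont G -> ccont (fun t => F t + G t).
Proof.
move=> [FR FI] [GR GI]; split.
- by under eq_fun do rewrite cReD; move=> t; apply: cvgD; [exact: FR|exact: GR].
- by under eq_fun do rewrite cImD; move=> t; apply: cvgD; [exact: FI|exact: GI].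
Qed.
Lemma ccontM F G : ccont F -> ccont G -> ccont (fun t => F t * G t).
Proof.
move=> [FR FI] [GR GI]; split.
- under eq_fun do rewrite cReM; move=> t; apply: cvgB; apply: cvgM;
    by [exact: FR|exact: GR|exact: FI|exact: GI].
- under eq_fun do rewrite cImM; move=> t; apply: cvgD; apply: cvgM;
    by [exact: FR|exact: GR|exact: FI|exact: GI].
Qed.
Lemma ccont_cisM (k : R) : ccont (fun t => cis (k * t)).
Proof. by split; [exact: continuous_cosM|exact: continuous_sinM]. Qed.
Lemma ccont_sum (F : nat -> R -> CC R) n : (forall i, ccont (F i)) ->
  ccont (fun t => \sum_(i < n) F i t).
Proof.
move=> cF; elim: n => [|n IH].
  by under eq_fun do rewrite big_ord0; exact: ccont_cst.
by under eq_fun do rewrite big_ord_recr /=; exact: ccontD.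
Qed.
Lemma ccont_abs2 F : ccont F -> continuous (fun t => abs2 (F t)).
Proof.
move=> [FR FI]; under eq_fun do rewrite abs2E.
by move=> t; apply: cvgD; rewrite !expr2; apply: cvgM; by [exact: FR|exact: FI].
Qed.

Lemma cint_sum (F : nat -> R -> R) n : (forall i, continuous (F i)) ->
  cint (fun t => \sum_(i < n) F i t) = \sum_(i < n) cint (F i).
Proof.
move=> cF.
suff [_ //] : continuous (fun t => \sum_(i < n) F i t) /\
  cint (fun t => \sum_(i < n) F i t) = \sum_(i < n) cint (F i).
elim: n => [|n [IH1 IH2]].
  under eq_fun do rewrite big_ord0; rewrite big_ord0 cint_cst mulr0; split => // t.
  exact: cvg_cst.
under eq_fun do rewrite big_ord_recr /=; rewrite big_ord_recr /= cintD// IH2; split => //.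
by move=> t; apply: cvgD; [exact: IH1|exact: cF].
Qed.

Lemma cint_trig (a b : R) (k : nat) : (0 < k)%N ->
  cint (fun t => a * cos (k%:R * t) + b * sin (k%:R * t)) = 0.
Proof.
move=> k0; rewrite cintD; last 2 first.
- by move=> t; apply: cvgMr; exact: continuous_cosM.
- by move=> t; apply: cvgMr; exact: continuous_sinM.
rewrite !cintZ ?cint_cos ?cint_sin ?mulr0 ?addr0//.
- exact: continuous_sinM.
- exact: continuous_cosM.
Qed.

(** Induction on [N]: the new term contributes [abs2 (b N)] and the cross terms [x j], which are
    trigonometric of frequency [N - j > 0] and integrate to 0 over a period. *)
Lemma parseval_finite (b : nat -> CC R) N :
  cint (fun t => abs2 (\sum_(j < N) b j * cis (j%:R * t))) =
  2 * pi * \sum_(j < N) abs2 (b j).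
Proof.
elim: N => [|N IH].
  under eq_fun do rewrite big_ord0 abs2_0.
  by rewrite cint_cst big_ord0.
pose x j t := complex.Re (b j * cconj (b N) * cis (- ((N - j)%:R * t))).
have step t : abs2 (\sum_(j < N.+1) b j * cis (j%:R * t)) =
    abs2 (\sum_(j < N) b j * cis (j%:R * t)) + abs2 (b N) + 2 * \sum_(j < N) x j t.
  rewrite big_ord_recr /=; set s := \sum_(j < N) _.
  rewrite abs2D.
  rewrite abs2M abs2_cis mulr1; congr (_ + 2 * _).
  rewrite /s mulr_suml cRe_sum; apply: eq_bigr => j _; rewrite /x.
  congr (complex.Re _).
  have -> : cis (- ((N - j)%:R * t)) = cis (j%:R * t) * cconj (cis (N%:R * t)).
    rewrite (natrB _ (ltnW (ltn_ord j))).
    have -> : - ((N%:R - j%:R) * t) = j%:R * t + (- (N%:R * t)) by ring.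
    by rewrite cisD; congr (_ * _); rewrite /cis /cconj /= cosN sinN.
  by apply: complexP; rewrite /cconj !(cReM,cImM) /= ?(cReM,cImM) /=; ring.
have xE j t : x j t = complex.Re (b j * cconj (b N)) * cos ((N - j)%:R * t) +
     complex.Im (b j * cconj (b N)) * sin ((N - j)%:R * t).
  by rewrite /x cReM /= cosN sinN; ring.
have cx j : continuous (x j).
  rewrite (_ : x j = (fun t => complex.Re (b j * cconj (b N)) * cos ((N - j)%:R * t) +
     complex.Im (b j * cconj (b N)) * sin ((N - j)%:R * t))); last exact/funext.
  by move=> t; apply: cvgD; apply: cvgMr; [exact: continuous_cosM|exact: continuous_sinM].
under eq_fun do rewrite step.
rewrite cintD; last 2 first.
- move=> t; apply: cvgD; last exact: cvg_cst.
  apply: (@ccont_abs2 (fun t => \sum_(j < N) b j * cis (j%:R * t))).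
  apply: (@ccont_sum (fun j t => b j * cis (j%:R * t))) => j.
  by apply: ccontM; [exact: ccont_cst|exact: ccont_cisM].
- move=> t; apply: cvgMr.
  have [/(_ t)] : ccont (fun t => \sum_(j < N) Complex (x j t) 0).
    apply: (@ccont_sum (fun j t => Complex (x j t) 0)) => j; split; first exact: cx.
    by move=> ?; exact: cvg_cst.
  by under eq_fun do rewrite cRe_sum.
rewrite cintD; last 2 first.
- apply: (@ccont_abs2 (fun t => \sum_(j < N) b j * cis (j%:R * t))).
  apply: (@ccont_sum (fun j t => b j * cis (j%:R * t))) => j.
  by apply: ccontM; [exact: ccont_cst|exact: ccont_cisM].
- by move=> t; exact: cvg_cst.
rewrite IH cint_cst cintZ.
  rewrite cint_sum//.
  have -> : \sum_(j < N) cint (x j) = 0.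
    apply: big1 => j _.
    rewrite (_ : x j = (fun t => complex.Re (b j * cconj (b N)) * cos ((N - j)%:R * t) +
     complex.Im (b j * cconj (b N)) * sin ((N - j)%:R * t))); last exact/funext.
    by rewrite cint_trig// subn_gt0.
  by rewrite mulr0 addr0 -mulrDr; congr (_ * _); rewrite big_ord_recr.
have [cc _] : ccont (fun t => \sum_(j < N) Complex (x j t) 0).
  apply: (@ccont_sum (fun j t => Complex (x j t) 0)) => j; split; first exact: cx.
  by move=> ?; exact: cvg_cst.
by move=> t; have := cc t; under eq_fun do rewrite cRe_sum.
Qed.

Lemma csum_cis_cmeas d (T : measurableType d) (D : set T) (a : T -> R) (b : nat -> CC R) M q :
  gbound M q b -> measurable_fun D a -> cmeas D (fun x => csum (fun j => b j * cis (j%:R * a x))).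
Proof.
move=> [M0 [q01 Hb]] ma.
apply: (@cmeas_csum _ _ _ D (fun j x => b j * cis (j%:R * a x))).
  move=> j; apply: cmeasM; first exact: cmeas_cst.
  by apply: cmeas_cis; apply: measurable_funM => //; exact: measurable_cst.
move=> x _; exists M, q; split => //; split => // n.
by rewrite Normc.normcM normc_cis mulr1.
Qed.

(** Passage to the limit by dominated convergence; the geometric domination provides the constant
    majorant [(M / (1 - q)) ^+ 2]. *)
Lemma parseval (b : nat -> CC R) M q : gbound M q b ->
  (\int[leb]_(t in `[0%R, (2 * pi)%R]) (abs2 (csum (fun j => b j * cis (j%:R * t))))%:E =
   (2 * pi)%:E * \sum_(j <oo) (abs2 (b j))%:E)%E.
Proof.
move=> Hb; have [M0 [q01 Hn]] := Hb; have /andP[q0 q1] := q01.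
have q1' : 0 < 1 - q by rewrite subr_gt0.
pose F N t := abs2 (psums (fun j => b j * cis (j%:R * t)) N).
have Hbt t : gbound M q (fun j => b j * cis (j%:R * t)).
  by split => //; split => // n; rewrite Normc.normcM normc_cis mulr1.
have FN N : (\int[leb]_(t in `[0%R, (2 * pi)%R]) (F N t)%:E)%E =
    (2 * pi * \sum_(j < N) abs2 (b j))%:E.
  rewrite -parseval_finite /cint /Rintegral fineK//.
  apply: integrable_fin_num => //.
  apply: cont_integrable; apply: (@ccont_abs2 (fun t => \sum_(j < N) b j * cis (j%:R * t))).
  apply: (@ccont_sum (fun j t => b j * cis (j%:R * t))) => j.
  by apply: ccontM; [exact: ccont_cst|exact: ccont_cisM].
have cF t : (fun N => (F N t)%:E) @ \oo --> (abs2 (csum (fun j => b j * cis (j%:R * t))))%:E.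
  apply: cvg_EFin; first by apply: nearW.
  rewrite /F /abs2; set l := csum _.
  have H : (fun N => normc (psums (fun j => b j * cis (j%:R * t)) N)) @ \oo --> normc l.
    apply/cvgrPdist_lt => e e0.
    have /cvgrPdist_lt/(_ _ e0)[K _ HK] := gbound_cvg (Hbt t).
    exists K => // N KN; have := HK N KN; rewrite /= sub0r normrN ger0_norm ?normc_ge0//.
    exact: le_lt_trans (normc_dist l _).
  by rewrite expr2; under eq_fun do rewrite expr2; exact: cvgM.
have FB N t : `|F N t| <= (M / (1 - q)) ^+ 2.
  rewrite ger0_norm ?abs2_ge0// /F /abs2 lerXn2r ?nnegrE ?normc_ge0 ?divr_ge0 ?(ltW q1')//.
  have := psums_tail 0 N (Hbt t); rewrite add0n expr0 mulr1 /psums big_ord0 subr0; exact.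
have mF N : measurable_fun `[0, (2 * pi)%R] (fun t => (F N t)%:E).
  apply: measurable_eabs2.
  apply: (@cmeas_sum _ _ (measurableTypeR R) _ (fun j t => b j * cis (j%:R * t))) => j.
  apply: cmeasM; first exact: cmeas_cst.
  by apply: cmeas_cis; apply: measurable_funM => //; exact: measurable_cst.
have aeF : {ae leb, forall t, `[0, 2 * pi]%classic t -> (fun N => (F N t)%:E) @ \oo -->
    (abs2 (csum (fun j => b j * cis (j%:R * t))))%:E}.
  by apply: aeW => t _; exact: cF.
have aeB : {ae leb, forall t (N : nat), `[0, 2 * pi]%classic t ->
    (`|(F N t)%:E| <= ((M / (1 - q)) ^+ 2)%:E)%E}.
  by apply: aeW => t N _; rewrite lee_fin; exact: FB.
have intB : leb.-integrable `[0, 2 * pi] (EFin \o (fun=> (M / (1 - q)) ^+ 2)).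
  by apply: cont_integrable => ?; exact: cvg_cst.
have mG : measurable_fun `[0, 2 * pi]
    (fun t => (abs2 (csum (fun j => b j * cis (j%:R * t))))%:E).
  apply: (@measurable_eabs2 _ _ (measurableTypeR R)).
  exact: (csum_cis_cmeas (T := measurableTypeR R) Hb).
have [_ _ L] := @dominated_convergence _ _ _ leb _ (measurable_itv _) _ _ _ mF mG aeF intB aeB.
apply: (cvg_unique _ L) => //.
rewrite /= (_ : (fun n => _) = (fun N => (2 * pi)%:E * (\sum_(j < N) abs2 (b j))%:E)%E); last first.
  by apply/funext => N; rewrite FN EFinM.
apply: cvgeZl => //.
have -> : (fun N => (\sum_(j < N) abs2 (b j))%:E) = (fun N => \sum_(0 <= j < N) (abs2 (b j))%:E)%E.
  by apply/funext => N; rewrite big_mkord -sumEFin.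
by apply: is_cvg_nneseries => n _ _; rewrite lee_fin abs2_ge0.
Qed.

End CircleIntegral.

(** * Goursat's lemma and Cauchy's formula *)

Section Bisection.
Context {R : realType}.

Record rect := Rect { lft : R; rgt : R; bot : R; top : R }.

Definition wf r := lft r <= rgt r /\ bot r <= top r.
Definition subrect r r' :=
  [/\ lft r' <= lft r, rgt r <= rgt r', bot r' <= bot r & top r <= top r'].
Definition span r := (rgt r - lft r) + (top r - bot r).
Definition midx r := (lft r + rgt r) / 2.
Definition midt r := (bot r + top r) / 2.
Definition q1 r := Rect (lft r) (midx r) (bot r) (midt r).
Definition q2 r := Rect (midx r) (rgt r) (bot r) (midt r).
Definition q3 r := Rect (lft r) (midx r) (midt r) (top r).
Definition q4 r := Rect (midx r) (rgt r) (midt r) (top r).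

Variable F : rect -> R.

(** The fourth quarter is the default: when the first three fail the test, additivity of [F] forces
    it to pass. *)
Definition quarter r : rect :=
  if `|F r| <= 4 * `|F (q1 r)| then q1 r else
  if `|F r| <= 4 * `|F (q2 r)| then q2 r else
  if `|F r| <= 4 * `|F (q3 r)| then q3 r else q4 r.

Lemma quarterP r (P : rect -> Prop) : P (q1 r) -> P (q2 r) -> P (q3 r) -> P (q4 r) ->
  P (quarter r).
Proof. by rewrite /quarter; do 3 case: ifP => _ //. Qed.

Lemma quarter_wf r : wf r -> wf (quarter r).
Proof.
move=> [h1 h2]; have : lft r <= midx r <= rgt r /\ bot r <= midt r <= top r.
  by rewrite /midx /midt; split; apply/andP; split; lra.
by move=> [/andP[? ?] /andP[? ?]]; apply: (@quarterP r wf).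
Qed.

Lemma quarter_sub r : wf r -> subrect (quarter r) r.
Proof.
move=> [h1 h2]; have : lft r <= midx r <= rgt r /\ bot r <= midt r <= top r.
  by rewrite /midx /midt; split; apply/andP; split; lra.
by move=> [/andP[? ?] /andP[? ?]]; apply: (@quarterP r (fun q => subrect q r)); split => /=.
Qed.

Lemma quarter_span r : span (quarter r) = span r / 2.
Proof. by apply: (@quarterP r (fun q => span q = span r / 2)); rewrite /q1 /q2 /q3 /q4 /span /midx /midt /=; field. Qed.

Variable r0 : rect.
Hypothesis wf0 : wf r0.
Hypothesis Fadd : forall r, wf r -> subrect r r0 ->
  F r = F (q1 r) + F (q2 r) + F (q3 r) + F (q4 r).

Lemma quarter_ge r : wf r -> subrect r r0 -> `|F r| <= 4 * `|F (quarter r)|.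
Proof.
move=> wr sr; rewrite /quarter; case: ifP => [//|/negbT]; rewrite -ltNge => H1.
case: ifP => [//|/negbT]; rewrite -ltNge => H2.
case: ifP => [//|/negbT]; rewrite -ltNge => H3.
have : `|F r| <= `|F (q1 r)| + `|F (q2 r)| + `|F (q3 r)| + `|F (q4 r)|.
  rewrite {1}(Fadd wr sr); apply: (le_trans (ler_normD _ _)); rewrite lerD2r.
  by apply: (le_trans (ler_normD _ _)); rewrite lerD2r ler_normD.
lra.
Qed.

Let rn n := iter n quarter r0.

Lemma subrect_trans r1 r2 r3 : subrect r1 r2 -> subrect r2 r3 -> subrect r1 r3.
Proof. by move=> [? ? ? ?] [? ? ? ?]; split; apply: le_trans; eassumption. Qed.
Lemma subrect_refl r : subrect r r.
Proof. by split. Qed.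

Lemma rn_wf n : wf (rn n).
Proof. by elim: n => [//|n IH]; exact: quarter_wf. Qed.
Lemma rn_mono n k : subrect (rn (n + k)) (rn n).
Proof.
elim: k => [|k IH]; first by rewrite addn0; exact: subrect_refl.
by rewrite addnS; apply: subrect_trans IH; exact: quarter_sub (rn_wf _).
Qed.
Lemma rn_sub n : subrect (rn n) r0.
Proof. by have := rn_mono 0 n; rewrite add0n. Qed.
Lemma rn_span n : span (rn n) = span r0 / 2 ^+ n.
Proof.
elim: n => [|n IH]; first by rewrite expr0 divr1.
by rewrite /rn iterS quarter_span -/(rn n) IH exprS; field; rewrite expf_neq0.
Qed.
Lemma rn_F n : `|F r0| <= 4 ^+ n * `|F (rn n)|.
Proof.
elim: n => [|n IH]; first by rewrite expr0 mul1r.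
apply: (le_trans IH); rewrite exprSr -mulrA ler_wpM2l ?exprn_ge0//.
exact: quarter_ge (rn_wf _) (rn_sub _).
Qed.

(** Nested intervals in each coordinate: every left end is below every right end, so the supremum of
    the left ends lies in all of them. *)
Lemma rn_point : exists x t, forall n, lft (rn n) <= x <= rgt (rn n) /\
  bot (rn n) <= t <= top (rn n).
Proof.
have lr n m : lft (rn n) <= rgt (rn m).
  have [h1 _ _ _] := rn_mono n m; have := rn_mono m n; rewrite addnC => -[_ h2 _ _].
  by apply: (le_trans h1); apply: le_trans h2; have [] := rn_wf (n + m).
have bt n m : bot (rn n) <= top (rn m).
  have [_ _ h1 _] := rn_mono n m; have := rn_mono m n; rewrite addnC => -[_ _ _ h2].
  by apply: (le_trans h1); apply: le_trans h2; have [] := rn_wf (n + m).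
have key (a b : nat -> R) : (forall n m, a n <= b m) ->
    exists x, forall n, a n <= x <= b n.
  move=> ab; exists (sup (range a)) => n; apply/andP; split.
    apply: ub_le_sup; last by exists n.
    by exists (b 0%N) => _ [m _ <-].
  apply: ge_sup; first by exists (a 0%N), 0%N.
  by move=> _ [m _ <-].
have [x Hx] := key _ _ lr; have [t Ht] := key _ _ bt.
by exists x, t.
Qed.

Hypothesis Floc : forall x t, lft r0 <= x <= rgt r0 -> bot r0 <= t <= top r0 ->
  forall e, 0 < e -> exists2 del : R, 0 < del & forall r, wf r -> subrect r r0 ->
    lft r <= x <= rgt r -> bot r <= t <= top r -> span r < del ->
    `|F r| <= e * span r ^+ 2.

(** Goursat's argument: [F] loses at most a factor 4 per bisection while [span ^+ 2] loses exactly
    4, so smallness of second order near the limit point passes back to [r0]. *)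
Lemma bisection_zero : F r0 = 0.
Proof.
apply/eqP; rewrite -normr_eq0; apply/eqP/le_anti; rewrite normr_ge0 andbT.
apply/ler_addgt0Pr => e e0; rewrite add0r.
have [x [t Hp]] := rn_point; have [hx ht] := Hp 0%N.
have s0 : 0 <= span r0 by case: wf0 => ? ?; rewrite /span addr_ge0// subr_ge0.
(* The summand 1 keeps the quotient meaningful for a degenerate rectangle. *)
pose e' := e / (1 + span r0 ^+ 2).
have d0 : 0 < 1 + span r0 ^+ 2 by rewrite ltr_pwDl// sqr_ge0.
have e'0 : 0 < e' by rewrite divr_gt0.
have [del del0 Hd] := Floc hx ht e'0.
have h01 : 0 <= (1 / 2 : R) < 1 by apply/andP; split; lra.
have [n Hn] := @geo_small R (span r0) (1 / 2) del h01 del0.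
have [hxn htn] := Hp n.
have sn : span (rn n) < del by rewrite rn_span; rewrite -exprVn -div1r.
have := Hd _ (rn_wf n) (rn_sub n) hxn htn sn => H.
apply: (le_trans (rn_F n)).
apply: (le_trans (ler_wpM2l (exprn_ge0 n (ler0n R 4)) H)).
rewrite rn_span.
have -> : 4 ^+ n * (e' * (span r0 / 2 ^+ n) ^+ 2) = e' * span r0 ^+ 2.
  rewrite exprMn exprVn -exprM mulnC exprM.
  have -> : 2 ^+ 2 = 4 :> R by ring.
  by field; rewrite expf_neq0.
rewrite /e' mulrAC ler_pdivrMr// ler_wpM2l ?(ltW e0)//.
by rewrite lerDr.
Qed.

End Bisection.

(** * Goursat's lemma for closed forms in the plane *)

Section RealGoursat.
Context {R : realType}.
Local Notation leb := (@lebesgue_measure R).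

Definition ig (f : R -> R) a b : R := \int[leb]_(t in `[a, b]) f t.

Lemma ig_split f a b m : a <= m <= b -> {within `[a, b], continuous f} ->
  ig f a b = ig f a m + ig f m b.
Proof.
move=> /andP[am mb] cf.
have intf : leb.-integrable `[a, b] (EFin \o f).
  by apply: continuous_compact_integrable => //; exact: segment_compact.
rewrite /ig; have := @Rintegral_itvB R f (BLeft a) (BRight b) m intf.
rewrite !bnd_simp => /(_ am mb) H.
rewrite -[in X in _ = _ + X]Rintegral_itv_obnd_cbnd.
  by rewrite -H addrC subrK.
apply: (integrableS _ _ _ intf) => //.
by apply: subset_itvr; rewrite bnd_simp.
Qed.

Lemma ig_near f a b k e : a <= b -> {within `[a, b], continuous f} ->
  (forall x, a <= x <= b -> `|f x - k| <= e) -> `|ig f a b - k * (b - a)| <= e * (b - a).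
Proof.
move=> ab cf H.
have intf : leb.-integrable `[a, b] (EFin \o f).
  by apply: continuous_compact_integrable => //; exact: segment_compact.
have intc (c : R) : leb.-integrable `[a, b] (EFin \o (fun=> c)).
  by apply: cont_integrable => ?; exact: cvg_cst.
have igc (c : R) : ig (fun=> c) a b = c * (b - a).
  rewrite /ig Rintegral_cst//= lebesgue_measure_itv/= lte_fin.
  case: ltP => [_|ba]; first by rewrite -EFinB.
  have -> : a = b by apply/le_anti; rewrite ab.
  by rewrite subrr.
have intfk : leb.-integrable `[a, b] (EFin \o (fun x : R => f x - k)).
  rewrite (_ : EFin \o _ = ((EFin \o f) \- (EFin \o (fun=> k)))%E)//.
  by apply: integrableB.
rewrite -igc /ig -RintegralB//.
apply: (le_trans (le_normr_Rintegral _ _)) => //.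
rewrite -igc /ig; apply: le_Rintegral => //.
  exact: (integrable_abse intfk).
Qed.

(** Frechet differentiability at the single point [(x, t)], with partial derivatives [A] in [x] and
    [B] in [t]. *)
Definition lin (F : R -> R -> R) (x t A B : R) :=
  forall e, 0 < e -> exists2 del : R, 0 < del & forall x' t', `|x' - x| < del -> `|t' - t| < del ->
    `|F x' t' - F x t - (x' - x) * A - (t' - t) * B| <= e * (`|x' - x| + `|t' - t|).

Lemma lin_cont F x t A B : lin F x t A B ->
  {for x, continuous (F ^~ t)} /\ {for t, continuous (F x)}.
Proof.
move=> /(_ _ ltr01)[del del0 H]; split.
- apply/cvgrPdist_le => e e0 /=.
  have K0 : 0 < 1 + `|A| by rewrite ltr_pwDl.
  exists (Num.min del (e / (1 + `|A|))); first by rewrite /= lt_min del0 divr_gt0.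
  move=> x'; rewrite /ball_ /= distrC lt_min => /andP[d1 d2].
  have := H x' t d1; rewrite subrr normr0 mul0r subr0 addr0 => /(_ del0) H'.
  rewrite distrC -(subrK ((x' - x) * A) (F x' t - F x t)).
  apply: (le_trans (ler_normD _ _)); rewrite normrM.
  move: d2; rewrite ltr_pdivlMr// => d2; nra.
- apply/cvgrPdist_le => e e0 /=.
  have K0 : 0 < 1 + `|B| by rewrite ltr_pwDl.
  exists (Num.min del (e / (1 + `|B|))); first by rewrite /= lt_min del0 divr_gt0.
  move=> x'; rewrite /ball_ /= distrC lt_min => /andP[d1 d2].
  have := H x x'; rewrite subrr normr0 mul0r subr0 add0r => /(_ del0 d1) H'.
  rewrite distrC -(subrK ((x' - t) * B) (F x x' - F x t)).
  apply: (le_trans (ler_normD _ _)); rewrite normrM.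
  move: d2; rewrite ltr_pdivlMr// => d2; nra.
Qed.

Variables (P Q : R -> R -> R) (lo hi : R).
(** The shared number [B] is the [t]-derivative of [P] and the [x]-derivative of [Q]: the form
    [P dx + Q dt] is closed, in the pointwise sense. *)
Hypothesis PQ : forall x t, lo < x < hi ->
  exists A B C, lin P x t A B /\ lin Q x t B C.

(** The integral of [P dx + Q dt] around the rectangle, counter-clockwise: bottom, right, top,
    left. *)
Definition boundary (r : rect) : R :=
  ig (P ^~ (bot r)) (lft r) (rgt r) + ig (Q (rgt r)) (bot r) (top r)
  - ig (P ^~ (top r)) (lft r) (rgt r) - ig (Q (lft r)) (bot r) (top r).

Lemma contP a b t : lo < a -> b < hi -> {within `[a, b], continuous (P ^~ t)}.
Proof.
move=> la bh; apply: continuous_in_subspaceT => x; rewrite inE /= in_itv /= => /andP[ax xb].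
have [|A [B [C [HP _]]]] := @PQ x t.
  by rewrite (lt_le_trans la ax) (le_lt_trans xb bh).
by have [] := lin_cont HP.
Qed.

Lemma contQ c d x : lo < x < hi -> {within `[c, d], continuous (Q x)}.
Proof.
move=> xlh; apply: continuous_subspaceT => t.
have [A [B [C [_ HQ]]]] := PQ t xlh.
by have [] := lin_cont HQ.
Qed.

(** The affine part of the form contributes [(c - d) * B * (b - a) + (b - a) * B * (d - c) = 0];
    what remains is of second order in the span, and bisection concludes. *)
Lemma goursat_rect (r0 : rect) : wf r0 -> lo < lft r0 -> rgt r0 < hi -> boundary r0 = 0.
Proof.
move=> wf0 lo0 hi0; have [w1 w2] := wf0.
apply: bisection_zero => //.
- move=> [a b c d] [/= ab cd] [/= s1 s2 s3 s4].
  have la : lo < a by exact: lt_le_trans s1.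
  have bh : b < hi by exact: le_lt_trans hi0.
  set m := midx (Rect a b c d); set n := midt (Rect a b c d).
  have am : a <= m <= b by rewrite /m /midx /=; apply/andP; split; lra.
  have cn : c <= n <= d by rewrite /n /midt /=; apply/andP; split; lra.
  have la' : lo < a < hi by rewrite la (le_lt_trans ab).
  have lb' : lo < b < hi by rewrite bh (lt_le_trans la).
  (* Once the outer sides are split at their midpoints, the inner segments occur twice with opposite
     signs and cancel. *)
  rewrite /boundary /= (ig_split am (contP (t := c) la bh)) (ig_split am (contP (t := d) la bh)).
  rewrite (ig_split cn (contQ (c := c) (d := d) la')) (ig_split cn (contQ (c := c) (d := d) lb')) -/m -/n.
  ring.
- move=> x t xr tr e e0.
  have xlh : lo < x < hi.
    by move/andP: xr => [h1 h2]; rewrite (lt_le_trans lo0 h1) (le_lt_trans h2 hi0).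
  have [A [B [C [HP HQ]]]] := PQ t xlh.
  have e2 : 0 < e / 2 by rewrite divr_gt0.
  have [dP dP0 HP'] := HP _ e2; have [dQ dQ0 HQ'] := HQ _ e2.
  exists (Num.min dP dQ); first by rewrite lt_min dP0.
  move=> [a b c d] [/= ab cd] [/= s1 s2 s3 s4] /andP[ax xb] /andP[ct td].
  rewrite lt_min => /andP[sP sQ].
  have la : lo < a by exact: lt_le_trans s1.
  have bh : b < hi by exact: le_lt_trans hi0.
  have la' : lo < a < hi by rewrite la (le_lt_trans ab).
  have lb' : lo < b < hi by rewrite bh (lt_le_trans la).
  rewrite /span /= in sP sQ *; set S := b - a + (d - c) in sP sQ *.
  have bdx y : a <= y <= b -> `|y - x| <= b - a.
    by move=> /andP[? ?]; rewrite ler_norml; apply/andP; split; lra.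
  have bdt y : c <= y <= d -> `|y - t| <= d - c.
    by move=> /andP[? ?]; rewrite ler_norml; apply/andP; split; lra.
  have cc : c <= c <= d by rewrite lexx.
  have dd : c <= d <= d by rewrite cd lexx.
  have aa : a <= a <= b by rewrite lexx.
  have bb : a <= b <= b by rewrite ab lexx.
  have ba0 : 0 <= b - a by rewrite subr_ge0.
  have dc0 : 0 <= d - c by rewrite subr_ge0.
  have estP y s : a <= y <= b -> c <= s <= d ->
      `|P y s - P x t - (y - x) * A - (s - t) * B| <= e / 2 * S.
    move=> hy hs; have h1 := bdx _ hy; have h2 := bdt _ hs.
    apply: (le_trans (HP' _ _ _ _)); [by rewrite /S in sP; lra|by rewrite /S in sP; lra|].
    by rewrite ler_wpM2l ?(ltW e2)// lerD.
  have estQ y s : a <= y <= b -> c <= s <= d ->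
      `|Q y s - Q x t - (y - x) * B - (s - t) * C| <= e / 2 * S.
    move=> hy hs; have h1 := bdx _ hy; have h2 := bdt _ hs.
    apply: (le_trans (HQ' _ _ _ _)); [by rewrite /S in sQ; lra|by rewrite /S in sQ; lra|].
    by rewrite ler_wpM2l ?(ltW e2)// lerD.
  have igB f g u v : {within `[u, v], continuous f} -> {within `[u, v], continuous g} ->
      ig f u v - ig g u v = ig (fun y => f y - g y) u v.
    move=> cf cg; rewrite /ig RintegralB//;
      apply: continuous_compact_integrable => //; exact: segment_compact.
  have IP : `|ig (P ^~ c) a b - ig (P ^~ d) a b - (c - d) * B * (b - a)| <= e * S * (b - a).
    rewrite igB; [|exact: contP|exact: contP]; apply: ig_near => //.
      by move=> y; apply: continuousB; exact: contP.
    move=> y hy; have h1 := estP y c hy cc; have h2 := estP y d hy dd.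
    have -> : P y c - P y d - (c - d) * B = (P y c - P x t - (y - x) * A - (c - t) * B)
      - (P y d - P x t - (y - x) * A - (d - t) * B) by ring.
    apply: (le_trans (ler_normB _ _)); lra.
  have IQ : `|ig (Q b) c d - ig (Q a) c d - (b - a) * B * (d - c)| <= e * S * (d - c).
    rewrite igB; [|exact: contQ|exact: contQ]; apply: ig_near => //.
      by move=> y; apply: continuousB; exact: contQ.
    move=> y hy; have h1 := estQ a y aa hy; have h2 := estQ b y bb hy.
    have -> : Q b y - Q a y - (b - a) * B = (Q b y - Q x t - (b - x) * B - (y - t) * C)
      - (Q a y - Q x t - (a - x) * B - (y - t) * C) by ring.
    apply: (le_trans (ler_normB _ _)); lra.
  rewrite /boundary /=.
  have -> : ig (P^~ c) a b + ig (Q b) c d - ig (P^~ d) a b - ig (Q a) c d =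
    (ig (P ^~ c) a b - ig (P ^~ d) a b - (c - d) * B * (b - a)) +
    (ig (Q b) c d - ig (Q a) c d - (b - a) * B * (d - c)) by ring.
  apply: (le_trans (ler_normD _ _)).
  have -> : e * S ^+ 2 = e * S * (b - a) + e * S * (d - c) by rewrite /S; ring.
  exact: lerD.
Qed.

End RealGoursat.

(** * Complex-valued differentiable maps of two real variables *)

Section ComplexLin.
Context {R : realType}.
Local Notation normc := (@Normc.normc R).

Definition cdiff (g : CC R -> CC R) (z d : CC R) :=
  forall e : R, 0 < e -> exists2 del : R, 0 < del & forall w, normc (w - z) < del ->
    normc (g w - g z - (w - z) * d) <= e * normc (w - z).

Definition clin (F : R -> R -> CC R) (x t : R) (A B : CC R) :=
  forall e : R, 0 < e -> exists2 del : R, 0 < del &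
    forall x' t', `|x' - x| < del -> `|t' - t| < del ->
    normc (F x' t' - F x t - Complex (x' - x) 0 * A - Complex (t' - t) 0 * B)
      <= e * (`|x' - x| + `|t' - t|).

Lemma clin_Re F x t A B : clin F x t A B ->
  lin (fun x t => complex.Re (F x t)) x t (complex.Re A) (complex.Re B).
Proof.
move=> H e e0; have [del del0 Hd] := H e e0; exists del => // x' t' hx ht.
apply: le_trans (Hd x' t' hx ht); apply: le_trans (cRe_le _).
by rewrite le_eqVlt; apply/orP; left; apply/eqP; congr `|_|;
  rewrite !(cReD, cReN, cReM) /=; ring.
Qed.

Lemma clin_Im F x t A B : clin F x t A B ->
  lin (fun x t => complex.Im (F x t)) x t (complex.Im A) (complex.Im B).
Proof.
move=> H e e0; have [del del0 Hd] := H e e0; exists del => // x' t' hx ht.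
apply: le_trans (Hd x' t' hx ht); apply: le_trans (cIm_le _).
by rewrite le_eqVlt; apply/orP; left; apply/eqP; congr `|_|;
  rewrite !(cImD, cImN, cImM) /=; ring.
Qed.

Lemma clin_bound F x t A B : clin F x t A B -> exists2 del : R, 0 < del &
  forall x' t', `|x' - x| < del -> `|t' - t| < del ->
    normc (F x' t' - F x t) <= (1 + normc A + normc B) * (`|x' - x| + `|t' - t|).
Proof.
move=> /(_ _ ltr01) [del del0 H]; exists del => // x' t' hx ht.
have := H x' t' hx ht; rewrite mul1r => H'.
set D := F x' t' - F x t in H' *.
have -> : D = (D - Complex (x' - x) 0 * A - Complex (t' - t) 0 * B) +
  (Complex (x' - x) 0 * A + Complex (t' - t) 0 * B) by ring.
apply: (le_trans (normcD _ _)).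
have := normcD (Complex (x' - x) 0 * A) (Complex (t' - t) 0 * B).
rewrite !Normc.normcM !normc_real => H2.
have := normc_ge0 A; have := normc_ge0 B.
have := normr_ge0 (x' - x); have := normr_ge0 (t' - t); nra.
Qed.

Lemma clin_mul F G x t A B A' B' : clin F x t A B -> clin G x t A' B' ->
  clin (fun x t => F x t * G x t) x t
    (A * G x t + F x t * A') (B * G x t + F x t * B').
Proof.
move=> HF HG e e0.
have [d3 d30 H3] := clin_bound HF; have [d4 d40 H4] := clin_bound HG.
set KF := 1 + normc A + normc B in H3; set KG := 1 + normc A' + normc B' in H4.
have KF0 : 0 < KF by rewrite /KF -addrA ltr_pwDl// addr_ge0// normc_ge0.
have KG0 : 0 < KG by rewrite /KG -addrA ltr_pwDl// addr_ge0// normc_ge0.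
set f0 := F x t in H3 *; set g0 := G x t in H4 *.
have nf := normc_ge0 f0; have ng := normc_ge0 g0.
pose e' := e / (2 * (1 + normc f0 + normc g0)).
have e'0 : 0 < e' by rewrite divr_gt0// mulr_gt0// -addrA ltr_pwDl// addr_ge0.
have [d1 d10 H1] := HF e' e'0; have [d2 d20 H2] := HG e' e'0.
(* With [S <= 2 * d5] the product of the two increments, at most [KF * KG * S ^+ 2], stays below
   [e / 2 * S]. *)
pose d5 := e / (4 * KF * KG).
have d50 : 0 < d5 by rewrite divr_gt0// !mulr_gt0.
exists (Num.min (Num.min d1 d2) (Num.min (Num.min d3 d4) d5)).
  by rewrite !lt_min d10 d20 d30 d40 d50.
move=> x' t'; rewrite !lt_min => /andP[/andP[a1 a2] /andP[/andP[a3 a4] a5]].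
move=> /andP[/andP[b1 b2] /andP[/andP[b3 b4] b5]].
have := H1 _ _ a1 b1; have := H2 _ _ a2 b2; have := H3 _ _ a3 b3; have := H4 _ _ a4 b4.
rewrite -/f0 -/g0.
set S := `|x' - x| + `|t' - t|.
have S0 : 0 <= S by rewrite addr_ge0.
have S5 : S <= 2 * d5 by rewrite /S; lra.
set X := Complex (x' - x) 0; set T := Complex (t' - t) 0.
set f1 := F x' t'; set g1 := G x' t' => h4 h3 h2 h1.
have -> : f1 * g1 - f0 * g0 - X * (A * g0 + f0 * A') - T * (B * g0 + f0 * B') =
  (f1 - f0) * (g1 - g0) + (f1 - f0 - X * A - T * B) * g0 +
  f0 * (g1 - g0 - X * A' - T * B') by ring.
apply: (le_trans (normcD _ _)).
apply: (le_trans (lerD (normcD _ _) (lexx _))).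
rewrite !Normc.normcM.
have p1 : normc (f1 - f0) * normc (g1 - g0) <= e / 2 * S.
  apply: (le_trans (ler_pM (normc_ge0 _) (normc_ge0 _) h3 h4)).
  apply: (@le_trans _ _ (KF * KG * S * (2 * d5))).
    have -> : KF * S * (KG * S) = KF * KG * S * S by ring.
    by rewrite ler_wpM2l// !mulr_ge0 ?(ltW KF0) ?(ltW KG0).
  by rewrite le_eqVlt; apply/orP; left; apply/eqP; rewrite /d5; field; rewrite !gt_eqF.
have p2 : normc (f1 - f0 - X * A - T * B) * normc g0 +
    normc f0 * normc (g1 - g0 - X * A' - T * B') <= e / 2 * S.
  apply: (@le_trans _ _ (e' * S * normc g0 + normc f0 * (e' * S))).
    by apply: lerD; [rewrite ler_wpM2r|rewrite ler_wpM2l].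
  have -> : e' * S * normc g0 + normc f0 * (e' * S) = e' * (normc f0 + normc g0) * S by ring.
  rewrite ler_wpM2r// /e' mulrAC ler_pdivrMr; last first.
    by rewrite mulr_gt0// -addrA ltr_pwDl// addr_ge0.
  have -> : e / 2 * (2 * (1 + normc f0 + normc g0)) = e * (1 + normc f0 + normc g0) by field.
  by rewrite ler_wpM2l ?(ltW e0)// -addrA lerDr.
by rewrite (splitr e) mulrDl -addrA; apply: lerD.
Qed.

Lemma clin_comp g F x t A B d : clin F x t A B -> cdiff g (F x t) d ->
  clin (fun x t => g (F x t)) x t (A * d) (B * d).
Proof.
move=> HF Hg e e0.
have [d3 d30 H3] := clin_bound HF; set KF := 1 + normc A + normc B in H3.
have KF0 : 0 < KF by rewrite /KF -addrA ltr_pwDl// addr_ge0// normc_ge0.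
have e2 : 0 < e / (2 * KF) by rewrite divr_gt0// mulr_gt0.
have [d1 d10 H1] := Hg _ e2.
have K0 : 0 < 2 * (1 + normc d) by rewrite mulr_gt0// ltr_pwDl// normc_ge0.
have e1 : 0 < e / (2 * (1 + normc d)) by rewrite divr_gt0.
have [d2 d20 H2] := HF _ e1.
have d40 : 0 < d1 / (2 * KF) by rewrite divr_gt0// mulr_gt0.
exists (Num.min (Num.min d2 d3) (d1 / (2 * KF))); first by rewrite !lt_min d20 d30.
move=> x' t'; rewrite !lt_min => /andP[/andP[a2 a3] a4] /andP[/andP[b2 b3] b4].
have h2 := H2 _ _ a2 b2; have h3 := H3 _ _ a3 b3.
set S := `|x' - x| + `|t' - t| in h2 h3 *.
have S0 : 0 <= S by rewrite addr_ge0.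
set f1 := F x' t' in h2 h3 *; set f0 := F x t in h2 h3 H1 *.
have h1 : normc (g f1 - g f0 - (f1 - f0) * d) <= e / (2 * KF) * normc (f1 - f0).
  apply: H1; apply: (le_lt_trans h3); rewrite mulrC -ltr_pdivlMr//.
  have -> : d1 / KF = d1 / (2 * KF) + d1 / (2 * KF) by field; rewrite gt_eqF.
  exact: ltrD.
set X := Complex (x' - x) 0 in h2 *; set T := Complex (t' - t) 0 in h2 *.
have -> : g f1 - g f0 - X * (A * d) - T * (B * d) =
  (g f1 - g f0 - (f1 - f0) * d) + (f1 - f0 - X * A - T * B) * d by ring.
apply: (le_trans (normcD _ _)); rewrite Normc.normcM.
have -> : e * S = e / 2 * S + e / 2 * S by field.
apply: lerD.
  apply: (le_trans h1); apply: (le_trans (ler_wpM2l (ltW e2) h3)).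
  by rewrite le_eqVlt; apply/orP; left; apply/eqP; field; rewrite gt_eqF.
apply: (le_trans (ler_wpM2r (normc_ge0 _) h2)).
rewrite mulrAC ler_wpM2r// mulrAC ler_pdivrMr// mulrAC -mulrA ler_wpM2l ?(ltW e0)//.
by have := normc_ge0 d; lra.
Qed.

(** The remainder is exactly [(w - z) ^+ 2 / (w * z ^+ 2)], and nearby [w] have modulus above
    [normc z / 2]. *)
Lemma cdiff_inv (z : CC R) : z != 0 -> cdiff (fun w => w^-1) z (- z^-1 ^+ 2).
Proof.
move=> z0 e e0; have nz : 0 < normc z by rewrite normc_gt0.
exists (Num.min (normc z / 2) (e * normc z ^+ 3 / 2)).
  by rewrite lt_min !divr_gt0// mulr_gt0// exprn_gt0.
move=> w; rewrite lt_min => /andP[w1 w2].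
have wz : normc z / 2 < normc w.
  have := normcD (z - w) w; rewrite subrK normc_distC; lra.
have w0 : w != 0 by rewrite -normc_gt0; lra.
have nw : 0 < normc w by rewrite normc_gt0.
have -> : w^-1 - z^-1 - (w - z) * - z^-1 ^+ 2 = (w - z) ^+ 2 * (w^-1 * z^-1 ^+ 2).
  by field; rewrite z0 w0.
rewrite !Normc.normcM !Normc.normcV.
set a := normc (w - z) in w1 w2 *; set m := normc w in wz nw *; set n := normc z in nz w1 w2 wz *.
have -> : a * a * (m^-1 * (n^-1 * n^-1)) = a / (m * n ^+ 2) * a.
  by field; rewrite !gt_eqF.
rewrite ler_wpM2r ?normc_ge0// ler_pdivrMr ?mulr_gt0 ?exprn_gt0//.
apply: (le_trans (ltW w2)).
have -> : e * n ^+ 3 / 2 = e * (n / 2 * n ^+ 2) by field.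
by rewrite ler_wpM2l ?(ltW e0)// ler_wpM2r ?sqr_ge0// ltW.
Qed.

Lemma clin_cst a x t : clin (fun _ _ => a) x t 0 0.
Proof.
move=> e e0; exists 1 => // x' t' _ _.
by rewrite !mulr0 !subr0 subrr Normc.normc0 mulr_ge0 ?addr_ge0 ?(ltW e0).
Qed.

Lemma clin_add F G x t A B A' B' : clin F x t A B -> clin G x t A' B' ->
  clin (fun x t => F x t + G x t) x t (A + A') (B + B').
Proof.
move=> HF HG e e0; have e2 : 0 < e / 2 by rewrite divr_gt0.
have [d1 d10 H1] := HF _ e2; have [d2 d20 H2] := HG _ e2.
exists (Num.min d1 d2); first by rewrite lt_min d10.
move=> x' t'; rewrite !lt_min => /andP[a1 a2] /andP[b1 b2].
have -> : F x' t' + G x' t' - (F x t + G x t) - Complex (x' - x) 0 * (A + A') -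
   Complex (t' - t) 0 * (B + B') =
   (F x' t' - F x t - Complex (x' - x) 0 * A - Complex (t' - t) 0 * B) +
   (G x' t' - G x t - Complex (x' - x) 0 * A' - Complex (t' - t) 0 * B') by ring.
apply: (le_trans (normcD _ _)); rewrite (splitr e) mulrDl.
by apply: lerD; [exact: H1|exact: H2].
Qed.

Lemma clin_fst x t : clin (fun x _ => Complex x 0) x t 1 0.
Proof.
move=> e e0; exists 1 => // x' t' _ _; rewrite mulr1 mulr0 subr0.
have -> : Complex x' 0 - Complex x 0 - Complex (x' - x) 0 = 0 :> CC R.
  by apply: complexP; rewrite !(cReD, cReN, cImD, cImN) /=; ring.
by rewrite Normc.normc0 mulr_ge0 ?addr_ge0 ?(ltW e0).
Qed.

Lemma derive_eps (f : R -> R) x d : is_derive x (1 : R) f d ->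
  forall e, 0 < e -> exists2 del : R, 0 < del & forall y, `|y - x| < del ->
    `|f y - f x - (y - x) * d| <= e * `|y - x|.
Proof.
move=> [df dd] e e0; move: df; rewrite /derivable => /cvgrPdist_le/(_ _ e0).
have -> : lim ((fun h => h^-1 *: ((f \o shift x) (h *: 1) - f x)) @ 0^') = d.
  exact: dd.
rewrite near_withinE => -[del /= del0 H]; exists del => // y yx.
have [->|ynx] := eqVneq y x; first by rewrite !subrr mul0r subrr normr0 mulr0.
have yx0 : y - x != 0 by rewrite subr_eq0.
have := H (y - x); rewrite /ball_ /= sub0r normrN => /(_ yx yx0).
rewrite /GRing.scale /= mulr1 subrK => H'.
have np : 0 < `|y - x| by rewrite normr_gt0.
rewrite -(ler_pM2r np) -normrM in H'; apply: le_trans H'.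
rewrite le_eqVlt; apply/orP; left; apply/eqP; rewrite -normrN; congr `|_|.
by field.
Qed.

Lemma clin_cis x t : clin (fun _ t => cis t) x t 0 (Complex 0 1 * cis t).
Proof.
move=> e e0; have e2 : 0 < e / 2 by rewrite divr_gt0.
have [d1 d10 H1] := derive_eps (is_derive_cos t) e2.
have [d2 d20 H2] := derive_eps (is_derive_sin t) e2.
exists (Num.min d1 d2); first by rewrite lt_min d10.
move=> x' t' _; rewrite lt_min => /andP[a1 a2]; rewrite mulr0 subr0.
apply: (le_trans (normc_le _)).
have := H1 _ a1; have := H2 _ a2; rewrite !(cReD, cReN, cReM, cImD, cImN, cImM) /=.
have -> : cos t' - cos t - ((t' - t) * (0 * cos t - 1 * sin t) -
  0 * (0 * sin t + 1 * cos t)) = cos t' - cos t - (t' - t) * - sin t by ring.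
have -> : sin t' - sin t - ((t' - t) * (0 * sin t + 1 * cos t) +
  0 * (0 * cos t - 1 * sin t)) = sin t' - sin t - (t' - t) * cos t by ring.
move=> h1 h2; apply: (le_trans (lerD h2 h1)); rewrite -mulrDl -splitr.
by rewrite ler_wpM2l ?(ltW e0)// lerDr.
Qed.

End ComplexLin.

(** * Cauchy's formula by shrinking a circle to a point *)

Section Cauchy.
Context {R : realType}.
Local Notation normc := (@Normc.normc R).

Definition cI (F : R -> CC R) : CC R :=
  Complex (cint (fun t => complex.Re (F t))) (cint (fun t => complex.Im (F t))).

Lemma cID F G : ccont F -> ccont G -> cI (fun t => F t + G t) = cI F + cI G.
Proof.
move=> [FR FI] [GR GI]; apply: complexP; rewrite ?cReD ?cImD /cI /=.
  by under eq_fun do rewrite cReD; rewrite cintD.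
by under eq_fun do rewrite cImD; rewrite cintD.
Qed.

Lemma cint_ext f g : (forall t : R, 0 <= t <= 2 * pi -> f t = g t) -> cint f = cint g.
Proof.
move=> H; apply: eq_Rintegral => t; rewrite inE /= in_itv /= => tt; exact: H.
Qed.

Lemma cI_ext F G : (forall t : R, 0 <= t <= 2 * pi -> F t = G t) -> cI F = cI G.
Proof. by move=> H; rewrite /cI; congr Complex; apply: cint_ext => t tt; rewrite H. Qed.

Lemma cIZ (a : CC R) F : ccont F -> cI (fun t => a * F t) = a * cI F.
Proof.
move=> [FR FI]; apply: complexP; rewrite ?cReM ?cImM /cI /=.
  rewrite -!cintZ// -mulN1r -cintZ -?cintD.
  - by apply: cint_ext => t _; rewrite cReM; ring.
  - by move=> t; apply: cvgMr; exact: FR.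
  - by move=> t; apply: cvgMr; apply: cvgMr; exact: FI.
  - by move=> t; apply: cvgMr; exact: FI.
rewrite -!cintZ// -?cintD.
- by apply: cint_ext => t _; rewrite cImM; ring.
- by move=> t; apply: cvgMr; exact: FI.
- by move=> t; apply: cvgMr; exact: FR.
Qed.

Lemma cI_sum (F : nat -> R -> CC R) n : (forall i, ccont (F i)) ->
  cI (fun t => \sum_(i < n) F i t) = \sum_(i < n) cI (F i).
Proof.
move=> cF; elim: n => [|n IH].
  rewrite big_ord0 (@cI_ext _ (fun=> 0)) => [|t _]; last by rewrite big_ord0.
  by apply: complexP; rewrite /cI /= cint_cst mulr0.
rewrite big_ord_recr /= -IH -cID//; last exact: ccont_sum.
by apply: cI_ext => t _; rewrite big_ord_recr.
Qed.

Lemma cint_le f K : continuous f -> (forall t : R, 0 <= t <= 2 * pi -> `|f t| <= K) ->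
  `|cint f| <= K * (2 * pi).
Proof.
move=> cf H; have := @ig_near R f 0 (2 * pi) 0 K (ltW (twopi_gt0)).
rewrite mul0r !subr0; apply; first exact: continuous_subspaceT.
by move=> t tt; rewrite subr0; exact: H.
Qed.

Lemma cI_le F K : ccont F -> (forall t : R, 0 <= t <= 2 * pi -> normc (F t) <= K) ->
  normc (cI F) <= 2 * K * (2 * pi).
Proof.
move=> [FR FI] H; apply: (le_trans (normc_le _)).
have -> : 2 * K * (2 * pi) = K * (2 * pi) + K * (2 * pi) by ring.
by apply: lerD; apply: cint_le => // t tt; apply: le_trans (H t tt); [exact: cRe_le|exact: cIm_le].
Qed.

Lemma cI_cst a : cI (fun=> a) = Complex (2 * pi) 0 * a.
Proof. by apply: complexP; rewrite ?cReM ?cImM /cI /= cint_cst; ring. Qed.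

Lemma cI_cis (n : nat) : (0 < n)%N -> cI (fun t => cis (- (n%:R * t))) = 0.
Proof.
move=> n0; apply: complexP; rewrite /cI /=.
  by under eq_fun do rewrite cosN; rewrite cint_cos.
under eq_fun do rewrite sinN -mulN1r; rewrite cintZ; last exact: continuous_sinM.
by rewrite cint_sin// mulr0.
Qed.

Lemma clin_ccont (F : R -> R -> CC R) x : (forall t, exists A B, clin F x t A B) -> ccont (F x).
Proof.
move=> H; split=> t; have [A [B HAB]] := H t.
  by have [] := lin_cont (clin_Re HAB).
by have [] := lin_cont (clin_Im HAB).
Qed.

(** The sides [t = 0] and [t = 2 * pi] cancel because [P] takes equal values there; the other two
    sides are the integrals of [Q a] and [Q b] over a period. *)
Lemma goursat_periodic (P Q : R -> R -> CC R) lo hi :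
  (forall x t, lo < x < hi -> exists A B C, clin P x t A B /\ clin Q x t B C) ->
  (forall x, P x 0 = P x (2 * pi)) ->
  forall a b, lo < a -> a <= b -> b < hi -> cI (Q a) = cI (Q b).
Proof.
move=> H per a b la ab bh.
have wfr : wf (Rect a b 0 (2 * pi)) by split => //=; rewrite ltW// twopi_gt0.
apply: complexP; rewrite /cI /=.
  have HH x t : lo < x < hi -> exists A B C, lin (fun x t => complex.Re (P x t)) x t A B /\
      lin (fun x t => complex.Re (Q x t)) x t B C.
    move=> xx; have [A [B [C [HP HQ]]]] := H x t xx.
    by exists (complex.Re A), (complex.Re B), (complex.Re C); split; exact: clin_Re.
  have := goursat_rect HH wfr la bh; rewrite /boundary /=.
  rewrite (_ : (fun x => complex.Re (P x 0)) = (fun x => complex.Re (P x (2 * pi)))); last first.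
    by apply/funext => x; rewrite per.
  by rewrite /cint -/(ig _ _ _) -/(ig _ _ _) => HH2; lra.
have HH x t : lo < x < hi -> exists A B C, lin (fun x t => complex.Im (P x t)) x t A B /\
    lin (fun x t => complex.Im (Q x t)) x t B C.
  move=> xx; have [A [B [C [HP HQ]]]] := H x t xx.
  by exists (complex.Im A), (complex.Im B), (complex.Im C); split; exact: clin_Im.
have := goursat_rect HH wfr la bh; rewrite /boundary /=.
rewrite (_ : (fun x => complex.Im (P x 0)) = (fun x => complex.Im (P x (2 * pi)))); last first.
  by apply/funext => x; rewrite per.
by rewrite /cint -/(ig _ _ _) -/(ig _ _ _) => HH2; lra.
Qed.

Variables (g : CC R -> CC R).
Hypothesis gdiff : forall z, disc z -> exists d, cdiff g z d.
Variables (r : R) (z : CC R).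
Hypotheses (r01 : 0 < r < 1) (zr : normc z < r).

(** At [x = 1] this is the circle of radius [r] about 0; as [x] tends to 0 it shrinks to [z]. *)
Let Psi (x t : R) : CC R := z + Complex x 0 * (Complex r 0 * cis t - z).
Let K (t : R) : CC R := Complex r 0 * cis t / (Complex r 0 * cis t - z).

Let r0 : 0 < r. Proof. by case/andP: r01. Qed.

Lemma circ_neq t : Complex r 0 * cis t - z != 0.
Proof.
rewrite -normc_gt0; have := normcD (Complex r 0 * cis t - z) z; rewrite subrK.
rewrite Normc.normcM normc_cis normc_real mulr1 gtr0_norm//; have := zr; lra.
Qed.

(** The pair is the pullback by [Psi] of [g(w) dw / (i (w - z))]: since
    [Psi - z = x (r e^(it) - z)], the logarithmic differential splits into [dx / (i x)] and
    [K t dt]. The upper end of the range exceeds 1, so that [x = 1] is interior; it is where the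
    bound [x r + (x - 1) normc z] for [Psi] reaches 1. *)
Lemma cauchy_clin x t : 0 < x < (1 + normc z) / (r + normc z) -> exists A B C,
  clin (fun x t => - Complex 0 1 * (g (Psi x t) * (Complex x 0)^-1)) x t A B /\
  clin (fun x t => g (Psi x t) * K t) x t B C.
Proof.
move=> /andP[x0 x1].
have nz := normc_ge0 z.
have xn0 : Complex x 0 != 0 :> CC R by rewrite -normc_gt0 normc_real normr_gt0 gt_eqF.
have [d Hd] : exists d, cdiff g (Psi x t) d.
  apply: gdiff; apply/discE; rewrite /Psi.
  have -> : z + Complex x 0 * (Complex r 0 * cis t - z) =
    Complex (1 - x) 0 * z + Complex (x * r) 0 * cis t.
    by apply: complexP; rewrite !(cReD, cReN, cReM, cImD, cImN, cImM) /=; ring.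
  apply: (le_lt_trans (normcD _ _)); rewrite !Normc.normcM !normc_real normc_cis mulr1.
  rewrite (gtr0_norm (mulr_gt0 x0 r0)).
  move: x1; rewrite ltr_pdivlMr => [x1|]; last by rewrite ltr_pwDl.
  case: (leP x 1) => x1'.
    rewrite ger0_norm ?subr_ge0//; have /andP[_ r1] := r01.
    have h1 : 0 <= 1 - x by rewrite subr_ge0.
    have h2 : 0 <= r - normc z by rewrite subr_ge0 ltW.
    have := mulr_ge0 h1 h2; nra.
  rewrite ltr0_norm ?subr_lt0//; nra.
have cm := circ_neq t.
have L1 := clin_mul (clin_cst (Complex r 0) x t) (clin_cis x t).
have L2 := clin_add L1 (clin_cst (- z) x t).
have L3 := clin_mul (clin_fst x t) L2.
have L4 := clin_add (clin_cst z x t) L3.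
have L5 := clin_comp L4 Hd.
have L6 := clin_comp (clin_fst x t) (cdiff_inv xn0).
have L7 := clin_mul L5 L6.
have L8 := clin_mul (clin_cst (- Complex 0 1) x t) L7.
have L9 := clin_comp L2 (cdiff_inv cm).
have L10 := clin_mul L1 L9.
have L11 := clin_mul L5 L10.
move: L8 L11; cbv beta; rewrite -/(Psi x t).
set A := (X in clin _ _ _ X _ -> _); set B := (X in clin _ _ _ _ X -> _).
set B' := (X in _ -> clin _ _ _ X _ -> _); set C := (X in _ -> clin _ _ _ _ X -> _).
move=> L8 L11; exists A, B, C; split => //.
(* Closedness: both cross derivatives equal [r e^(it) * d], where [d] is the derivative of [g] at
   [Psi x t]. *)
have -> : B = B' => //.
rewrite /B /B'.
have ii : Complex 0 1 * Complex 0 1 = -1 :> CC R.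
  by apply: complexP; rewrite ?cReM ?cImM /=; ring.
set w := Complex r 0 * cis t in cm *.
rewrite !(mul0r, mulr0, add0r, addr0, mul1r).
transitivity (- (Complex 0 1 * Complex 0 1) * w * d).
  by rewrite /w; field.
by rewrite ii; field.
Qed.

Lemma K_ccont : ccont K.
Proof.
apply: (@clin_ccont (fun _ => K) 0) => t.
have L1 := clin_mul (clin_cst (Complex r 0) 0 t) (clin_cis 0 t).
have L2 := clin_add L1 (clin_cst (- z) 0 t).
have := clin_mul L1 (clin_comp L2 (cdiff_inv (circ_neq t))).
by move=> L3; eexists; eexists; exact: L3.
Qed.

Let q := normc z / r.

Lemma q01 : 0 <= q < 1.
Proof.
by rewrite /q divr_ge0 ?normc_ge0 ?(ltW r0)//= ltr_pdivrMr// mul1r.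
Qed.

Lemma K_le t : normc (K t) <= r / (r - normc z).
Proof.
have rz : 0 < r - normc z by rewrite subr_gt0.
rewrite /K Normc.normcM Normc.normcV Normc.normcM normc_real normc_cis mulr1 gtr0_norm//.
rewrite ler_wpM2l ?(ltW r0)// lef_pV2 ?posrE// ?normc_gt0 ?circ_neq//.
have := normcD (Complex r 0 * cis t - z) z.
by rewrite subrK Normc.normcM normc_real normc_cis mulr1 gtr0_norm// -lerBlDr.
Qed.

(** [K t] is [1 / (1 - (z / r) e^(-it))]; the identity [K = 1 + (z / r) e^(-it) K] is iterated,
    which keeps the remainder exact. *)
Lemma K_expand t N : K t = \sum_(n < N) (Complex r^-1 0 * z) ^+ n * cis (- (n%:R * t)) +
  (Complex r^-1 0 * z) ^+ N * cis (- (N%:R * t)) * K t.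
Proof.
elim: N => [|N IH].
  by rewrite big_ord0 expr0 mul0r oppr0 cis0 !mul1r add0r.
rewrite big_ord_recr /= {1}IH -addrA; congr (_ + _).
set b := Complex r^-1 0 * z.
have KE : K t = 1 + b * cis (- t) * K t.
  rewrite /K /b cisN; have cm := circ_neq t; have cn := cis_neq0 t.
  have rn : Complex r 0 != 0 :> CC R by rewrite -normc_gt0 normc_real normr_gt0 gt_eqF.
  have rr : Complex r^-1 0 = (Complex r 0)^-1 :> CC R.
    apply: (mulIf rn); rewrite mulVf//.
    by apply: complexP; rewrite ?cReM ?cImM /=; field; rewrite gt_eqF.
  by rewrite rr; field; rewrite cm cn rn.
rewrite {1}KE mulrDr mulr1; congr (_ + _).
have -> : cis (- (N.+1%:R * t)) = cis (- (N%:R * t)) * cis (- t).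
  by rewrite -cisD -natr1; congr cis; ring.
by rewrite exprSr; ring.
Qed.

Lemma ccont_cisN (n : nat) : ccont (fun t : R => cis (- (n%:R * t))).
Proof. by under eq_fun do rewrite -mulNr; exact: ccont_cisM. Qed.

(** Serves twice: with [G = 1] it evaluates the integral of [K], and with boundary values of a
    function it turns Cauchy's formula into an expansion whose coefficients are Fourier
    coefficients. *)
Lemma K_series (G : R -> CC R) B : ccont G ->
    (forall t : R, 0 <= t <= 2 * pi -> normc (G t) <= B) -> forall N,
  normc (cI (fun t => G t * K t) -
    \sum_(n < N) cI (fun t => G t * cis (- (n%:R * t))) * (Complex r^-1 0 * z) ^+ n)
  <= 2 * (B * (r / (r - normc z))) * (2 * pi) * q ^+ N.
Proof.
move=> cG HG N; set b := Complex r^-1 0 * z.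
have nb : normc b = q.
  by rewrite /b Normc.normcM normc_real gtr0_norm ?invr_gt0// mulrC.
pose T n t := b ^+ n * (G t * cis (- (n%:R * t))).
have cT n : ccont (T n).
  by apply: ccontM; [exact: ccont_cst|apply: ccontM => //; exact: ccont_cisN].
have cRm : ccont (fun t => b ^+ N * (G t * cis (- (N%:R * t)) * K t)).
  apply: ccontM; [exact: ccont_cst|apply: ccontM; last exact: K_ccont].
  by apply: ccontM => //; exact: ccont_cisN.
have -> : cI (fun t => G t * K t) = \sum_(n < N) cI (T n) +
    cI (fun t => b ^+ N * (G t * cis (- (N%:R * t)) * K t)).
  rewrite -cI_sum// -cID//; last exact: ccont_sum.
  apply: cI_ext => t _; rewrite {1}(K_expand t N) mulrDr mulr_sumr; congr (_ + _).
    by apply: eq_bigr => n _; rewrite /T /b; ring.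
  by rewrite -/b; ring.
rewrite addrAC -sumrB big1 ?add0r => [|n _]; last first.
  rewrite /T cIZ; last by apply: ccontM => //; exact: ccont_cisN.
  by rewrite mulrC subrr.
rewrite cIZ; last by apply: ccontM; [apply: ccontM => //; exact: ccont_cisN|exact: K_ccont].
rewrite Normc.normcM normc_X nb mulrC ler_wpM2r ?exprn_ge0//; first by have /andP[] := q01.
apply: cI_le.
  by apply: ccontM; [apply: ccontM => //; exact: ccont_cisN|exact: K_ccont].
move=> t tt; rewrite (Normc.normcM _ (K t)) (Normc.normcM (G t)) normc_cis mulr1.
by apply: ler_pM; rewrite ?normc_ge0// ?HG ?K_le.
Qed.

Lemma cauchy_K : cI K = Complex (2 * pi) 0.
Proof.
have H N : normc (Complex (2 * pi) 0 - cI K) <= 2 * (1 * (r / (r - normc z))) * (2 * pi) * q ^+ N.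
  (* [N.+1] terms ensure that the constant term is present; all the others integrate to 0. *)
  have := @K_series (fun=> 1) 1 (ccont_cst 1) (fun _ _ => ltac:(by rewrite Normc.normc1)) N.+1.
  rewrite big_ord_recl /= big1 ?addr0 => [|n _]; last first.
    under cI_ext do rewrite mul1r.
    by rewrite cI_cis ?mul0r.
  rewrite expr0 mulr1 normc_distC.
  have -> : cI (fun t => 1 * cis (- (0%:R * t))) = Complex (2 * pi) 0.
    rewrite -[RHS]mulr1 -cI_cst; apply: cI_ext => t _.
    by rewrite mul0r oppr0 cis0 mul1r.
  have -> : cI (fun t => 1 * K t) = cI K by apply: cI_ext => t _; rewrite mul1r.
  move=> h; apply: (le_trans h); rewrite ler_wpM2l//.
    have rz : 0 < r - normc z by rewrite subr_gt0.
    by rewrite !mulr_ge0 ?invr_ge0 ?(ltW r0) ?(ltW rz) ?pi_ge0.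
  have /andP[p0 p1] := q01; rewrite exprS ler_piMl ?exprn_ge0// ltW//.
apply/esym/eqP; rewrite -subr_eq0; apply/eqP/Normc.eq0_normc/le_anti.
rewrite normc_ge0 andbT; apply/ler_addgt0Pr => e e0; rewrite add0r.
have [N HN] := @geo_small R (2 * (1 * (r / (r - normc z))) * (2 * pi)) q e q01 e0.
exact: le_trans (H N) (ltW HN).
Qed.

(** By [J1] the integral is the same for all [0 < x <= 1]. For small [x] the values [g (Psi x t)]
    are uniformly close to [g z], so it equals [g z] times the integral of [K]. *)
Lemma cauchy_formula : cI (fun t => g (Complex r 0 * cis t) * K t) = Complex (2 * pi) 0 * g z.
Proof.
have nz := normc_ge0 z; have /andP[_ r1] := r01.
have hi1 : 1 < (1 + normc z) / (r + normc z).
  by rewrite ltr_pdivlMr ?mul1r ?ltrD2r// ltr_pwDl.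
have J1 x : 0 < x <= 1 -> cI (fun t => g (Psi x t) * K t) = cI (fun t => g (Complex r 0 * cis t) * K t).
  move=> /andP[x0 x1].
  rewrite (@goursat_periodic _ (fun x t => g (Psi x t) * K t) _ _ cauchy_clin _ x 1)//.
    apply: cI_ext => t _; rewrite /Psi; congr (g _ * _).
    have -> : Complex 1 0 = 1 :> CC R by [].
    by rewrite mul1r addrC subrK.
  move=> y; rewrite /Psi; congr (- _ * (g (_ + _ * (_ * _ - _)) * _)).
  by rewrite /cis cos0 sin0 mulr_natl cos2pi sin2pi.
set I := cI (fun t => g (Complex r 0 * cis t) * K t) in J1 *.
rewrite -cauchy_K mulrC -cIZ; last exact: K_ccont.
apply/eqP; rewrite -subr_eq0; apply/eqP/Normc.eq0_normc/le_anti.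
rewrite normc_ge0 andbT; apply/ler_addgt0Pr => e e0; rewrite add0r.
have rz : 0 < r - normc z by rewrite subr_gt0.
pose e' := e / (2 * (r / (r - normc z)) * (2 * pi)).
have D0 : 0 < 2 * (r / (r - normc z)) * (2 * pi) by rewrite !mulr_gt0 ?invr_gt0 ?pi_gt0.
have e'0 : 0 < e' by rewrite divr_gt0.
have [d Hd] : exists d, cdiff g z d by apply: gdiff; apply/discE; exact: lt_trans r1.
have [del del0 Hdel] := Hd _ ltr01.
have L0 : 0 < 1 + normc d by rewrite ltr_pwDl// normc_ge0.
pose eta := Num.min del (e' / (1 + normc d)).
have eta0 : 0 < eta by rewrite lt_min del0 divr_gt0.
have gz w : normc (w - z) < eta -> normc (g w - g z) <= e'.
  rewrite lt_min => /andP[w1 w2].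
  rewrite -(subrK ((w - z) * d) (g w - g z)); apply: (le_trans (normcD _ _)).
  have := Hdel w w1; rewrite Normc.normcM mul1r.
  move: w2; rewrite ltr_pdivlMr// => w2; have := normc_ge0 d; lra.
(* The modulus of [r e^(it) - z] is at most 2, so [eta / 3] keeps [Psi x t] strictly within [eta] of
   [z]. *)
pose x := Num.min 1 (eta / 3).
have x0 : 0 < x by rewrite lt_min ltr01 divr_gt0.
have x1 : x <= 1 by rewrite ge_min lexx.
have cg : ccont (fun t => g (Psi x t) * K t).
  apply: (@clin_ccont (fun x t => g (Psi x t) * K t)) => t.
  have [|_ [B [C [_ HQ]]]] := @cauchy_clin x t; last by exists B, C.
  by rewrite x0 (le_lt_trans x1 hi1).
rewrite -(J1 x) ?x0 ?x1// -mulN1r -cIZ; last first.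
  by apply: ccontM; [exact: ccont_cst|exact: K_ccont].
rewrite -cID//; last first.
  by apply: ccontM; [exact: ccont_cst|apply: ccontM; [exact: ccont_cst|exact: K_ccont]].
apply: (le_trans (@cI_le _ (e' * (r / (r - normc z))) _ _)).
- apply: ccontD => //.
  by apply: ccontM; [exact: ccont_cst|apply: ccontM; [exact: ccont_cst|exact: K_ccont]].
- move=> t _.
  have -> : g (Psi x t) * K t + -1 * (g z * K t) = (g (Psi x t) - g z) * K t by ring.
  rewrite Normc.normcM ler_pM ?normc_ge0 ?K_le// gz//.
  rewrite /Psi addrC addKr Normc.normcM normc_real gtr0_norm//.
  have h : normc (Complex r 0 * cis t - z) <= 2.
    apply: (le_trans (normcB _ _)).
    rewrite Normc.normcM normc_real normc_cis mulr1 gtr0_norm//; have := zr; lra.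
  have x3 : x <= eta / 3 by rewrite ge_min lexx orbT.
  apply: (@le_lt_trans _ _ (eta / 3 * 2)); last lra.
  by rewrite ler_pM ?normc_ge0 ?(ltW x0).
- have -> : 2 * (e' * (r / (r - normc z))) * (2 * pi) =
    e' * (2 * (r / (r - normc z)) * (2 * pi)) by ring.
  by rewrite /e' divfK// gt_eqF.
Qed.

End Cauchy.

(** * Slices of a differentiable function of two variables *)

Section Slices.
Context {R : realType}.
Local Notation normc := (@Normc.normc R).
Implicit Types (f : CC R * CC R -> CC R) (z : CC R * CC R).

Lemma cvg_cdiff (g : CC R -> CC R) (x d : CC R) :
  (fun h => h^-1 *: (g (h + x) - g x)) @ (0 : CC R)^' --> d -> cdiff g x d.
Proof.
move=> /cvgrPdist_le H e e0.
have e0' : 0 < (Complex e 0 : CC R) by rewrite gt0_C.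
have := H _ e0'; rewrite near_withinE => /nbhs_CCP[del del0 Hd].
exists del => // w wx.
have [->|wnx] := eqVneq w x; first by rewrite !subrr mul0r subrr Normc.normc0 mulr0.
have wx0 : w - x != 0 by rewrite subr_eq0.
have := Hd (w - x); rewrite subr0 => /(_ wx wx0); rewrite le_normc_C subrK => H'.
have np : 0 < normc (w - x) by rewrite normc_gt0.
rewrite -(ler_pM2r np) -Normc.normcM in H'; apply: le_trans H'.
rewrite -normc_N le_eqVlt; apply/orP; left; apply/eqP; congr normc.
by rewrite /GRing.scale /=; field.
Qed.

Lemma slice1 f z : differentiable f z -> cdiff (fun w => f (w, z.2)) z.1 (partial1 f z).
Proof.
move=> df; have := @diff_derivable _ _ _ f z (1, 0) df; rewrite /derivable => H.
apply: cvg_cdiff; rewrite /partial1 /derive1; move: H.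
suff -> : (fun h => h^-1 *: ((f \o shift z) (h *: (1, 0)) - f z)) =
  (fun h : CC R => h^-1 *: (f (h + z.1, z.2) - f (z.1, z.2))) by [].
apply/funext => h; congr (_ *: (f _ - f _)); last by case: z {df}.
case: z {df} => z1 z2; transitivity (h * 1 + z1, h * 0 + z2) => //=.
by rewrite mulr1 mulr0 add0r.
Qed.

Lemma slice2 f z : differentiable f z -> cdiff (fun w => f (z.1, w)) z.2 (partial2 f z).
Proof.
move=> df; have := @diff_derivable _ _ _ f z (0, 1) df; rewrite /derivable => H.
apply: cvg_cdiff; rewrite /partial2 /derive1; move: H.
suff -> : (fun h => h^-1 *: ((f \o shift z) (h *: (0, 1)) - f z)) =
  (fun h : CC R => h^-1 *: (f (z.1, h + z.2) - f (z.1, z.2))) by [].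
apply/funext => h; congr (_ *: (f _ - f _)); last by case: z {df}.
case: z {df} => z1 z2; transitivity (h * 0 + z1, h * 1 + z2) => //=.
by rewrite mulr1 mulr0 add0r.
Qed.

Lemma diff_cont_eps f z : differentiable f z -> forall e : R, 0 < e ->
  exists2 del : R, 0 < del & forall w, normc (w.1 - z.1) < del -> normc (w.2 - z.2) < del ->
    normc (f w - f z) < e.
Proof.
move=> /differentiable_continuous/cvgrPdist_lt H e e0.
have e0' : 0 < (Complex e 0 : CC R) by rewrite gt0_C.
have [[A B] [/= /nbhs_CCP[d1 d10 H1] /nbhs_CCP[d2 d20 H2]] AB] := H _ e0'.
exists (Num.min d1 d2); first by rewrite lt_min d10.
move=> w; rewrite !lt_min => /andP[a1 _] /andP[_ b2].
have := AB w; rewrite /= lt_normc_C normc_distC; apply.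
by split; [exact: H1|exact: H2].
Qed.

Lemma circ_cont (r s0 : R) : forall e : R, 0 < e -> exists2 del : R, 0 < del & forall s,
  `|s - s0| < del -> normc (Complex r 0 * cis s - Complex r 0 * cis s0) < e.
Proof.
move=> e e0.
have [del del0 H] := clin_bound (clin_mul (clin_cst (Complex r 0) 0 s0) (clin_cis 0 s0)).
move: H; set L := 1 + normc _ + normc _ => H.
have L0 : 0 < L by rewrite /L -addrA ltr_pwDl// addr_ge0// normc_ge0.
exists (Num.min del (e / L)); first by rewrite lt_min del0 divr_gt0.
move=> s; rewrite lt_min => /andP[h1 h2].
have := H 0 s; rewrite subrr normr0 add0r => /(_ del0 h1) H'.
by apply: (le_lt_trans H'); rewrite mulrC -ltr_pdivlMr.
Qed.

End Slices.

(** * Double power series *)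

Section Torus.
Context {R : realType}.
Local Notation normc := (@Normc.normc R).
Variables (f : CC R * CC R -> CC R).
Hypothesis hf : holomorphic f.
Variable r : R.
Hypothesis r01 : 0 < r < 1.

Let r0 : 0 < r. Proof. by case/andP: r01. Qed.

Definition torus (s t : R) : CC R := f (Complex r 0 * cis s, Complex r 0 * cis t).

Lemma circ_disc (t : R) : disc (Complex r 0 * cis t : CC R).
Proof.
apply/discE; rewrite Normc.normcM normc_real normc_cis mulr1 gtr0_norm//.
by case/andP: r01.
Qed.

Lemma torus_eps s0 t0 : forall e : R, 0 < e -> exists2 del : R, 0 < del & forall s t,
  `|s - s0| < del -> `|t - t0| < del -> normc (torus s t - torus s0 t0) < e.
Proof.
move=> e e0; have df : differentiable f ((Complex r 0 * cis s0 : CC R), (Complex r 0 * cis t0 : CC R)).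
  by apply: hf; split; exact: circ_disc.
have [d d0 H] := diff_cont_eps df e0.
have [d1 d10 H1] := circ_cont r s0 d0; have [d2 d20 H2] := circ_cont r t0 d0.
exists (Num.min d1 d2); first by rewrite lt_min d10.
move=> s t; rewrite !lt_min => /andP[a1 _] /andP[_ b2].
by apply: H; [exact: H1|exact: H2].
Qed.

Lemma torus_cont (p : CC R -> R) : (forall w, `|p w| <= normc w) ->
  (forall w w', p (w - w') = p w - p w') ->
  continuous (fun x : R * R => p (torus x.1 x.2)).
Proof.
move=> ple pB [s0 t0]; apply/cvgrPdist_lt => e e0.
have [d d0 H] := torus_eps s0 t0 e0.
exists (ball s0 d, ball t0 d); first by split; exact: nbhsx_ballx.
move=> [s t] [/= hs ht]; rewrite -pB; apply: (le_lt_trans (ple _)).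
rewrite normc_distC; apply: H; rewrite distrC; [exact: hs|exact: ht].
Qed.

Lemma torus_contR : continuous (fun x : R * R => complex.Re (torus x.1 x.2)).
Proof. by apply: torus_cont => [|w w']; [exact: cRe_le|rewrite cReD cReN]. Qed.
Lemma torus_contI : continuous (fun x : R * R => complex.Im (torus x.1 x.2)).
Proof. by apply: torus_cont => [|w w']; [exact: cIm_le|rewrite cImD cImN]. Qed.

Lemma torus_ccont2 s : ccont (torus s).
Proof.
split=> t; apply/cvgrPdist_lt => e e0; have [d d0 H] := torus_eps s t e0;
  exists d => // t'; rewrite /ball_ /= distrC => tt;
  (have := H s t'; rewrite subrr normr0 => /(_ d0 tt); apply: le_lt_trans); rewrite distrC.
  by rewrite -cReN -cReD; exact: cRe_le.
by rewrite -cImN -cImD; exact: cIm_le.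
Qed.

Lemma torus_ccont1 t : ccont (torus ^~ t).
Proof.
split=> s; apply/cvgrPdist_lt => e e0; have [d d0 H] := torus_eps s t e0;
  exists d => // t'; rewrite /ball_ /= distrC => tt;
  (have := H t' t; rewrite subrr normr0 => /(_ tt d0); apply: le_lt_trans); rewrite distrC.
  by rewrite -cReN -cReD; exact: cRe_le.
by rewrite -cImN -cImD; exact: cIm_le.
Qed.

Lemma torus_bounded a b : exists2 B : R, 0 <= B & forall s t, a <= s <= b -> 0 <= t <= 2 * pi ->
  normc (torus s t) <= B.
Proof.
have key (p : CC R -> R) : continuous (fun x : R * R => p (torus x.1 x.2)) ->
    exists2 B : R, 0 <= B & forall s t, a <= s <= b -> 0 <= t <= 2 * pi -> `|p (torus s t)| <= B.
  move=> cp; have cK : compact (`[a, b] `*` `[0, 2 * pi] : set (R * R)).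
    by apply: compact_setX; exact: segment_compact.
  have := continuous_compact (continuous_subspaceT cp) cK.
  move=> /compact_bounded[M [Mr HM]].
  exists (`|M| + 1); first by rewrite addr_ge0.
  move=> s t ss tt; apply: (HM (`|M| + 1)).
    by rewrite (le_lt_trans (ler_norm _))// ltrDl.
  by exists (s, t) => //=; rewrite !in_itv.
have [B1 B10 H1] := key _ torus_contR; have [B2 B20 H2] := key _ torus_contI.
exists (B1 + B2); first exact: addr_ge0.
move=> s t ss tt; apply: (le_trans (normc_le _)).
by apply: lerD; [exact: H1|exact: H2].
Qed.

(** Continuity under the integral sign, with a bound of [torus] on a compact rectangle as majorant;
    it makes the outer integral in [tcoef] accessible to the rules for continuous integrands. *)
Lemma ccont_cI_torus (n : nat) : ccont (fun s => cI (fun t => torus s t * cis (- (n%:R * t)))).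
Proof.
pose G s t := torus s t * cis (- (n%:R * t)).
have cG2 s : ccont (G s) by apply: ccontM; [exact: torus_ccont2|exact: ccont_cisN].
have cG1 t : ccont (G ^~ t) by apply: ccontM; [exact: torus_ccont1|exact: ccont_cst].
have GB a b : exists2 B : R, 0 <= B & forall s t, a <= s <= b -> 0 <= t <= 2 * pi ->
    normc (G s t) <= B.
  have [B B0 H] := torus_bounded a b; exists B => // s t ss tt.
  by rewrite Normc.normcM normc_cis mulr1; exact: H.
have key (p : CC R -> R) : (forall w, `|p w| <= normc w) ->
    (forall s, continuous (fun t => p (G s t))) ->
    (forall t, continuous (fun s => p (G s t))) ->
    continuous (fun s => cint (fun t => p (G s t))).
  move=> ple c2 c1 s.
  have [B B0 HB] := GB (s - 1) (s + 1).
  apply: (@continuity_under_integral R _ _ (@lebesgue_measure R) (fun s t => p (G s t))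
    `[0, 2 * pi] _ (s - 1) (s + 1) _ _ (fun=> B)).
  - exact: measurable_itv.
  - by move=> x _; apply: cont_integrable; exact: c2.
  - by apply: aeW => t _ x _; exact: c1.
  - by apply: cont_integrable => ?; exact: cvg_cst.
  - move=> x; rewrite /= in_itv /= => /andP[x1 x2]; apply: aeW => t.
    rewrite /= in_itv /= => tt; apply: (le_trans (ple _)); apply: HB => //.
    by rewrite !ltW.
  - by rewrite inE /= in_itv /=; apply/andP; split; lra.
split.
- apply: (key (@complex.Re R)); first exact: cRe_le.
  + by move=> s; have [] := cG2 s.
  + by move=> t; have [] := cG1 t.
- apply: (key (@complex.Im R)); first exact: cIm_le.
  + by move=> s; have [] := cG2 s.
  + by move=> t; have [] := cG1 t.
Qed.

Let ip : CC R := Complex (2 * pi)^-1 0.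

(** Fourier coefficients of [f] on the torus of radius [r]. They carry the factor [r ^ (m + n)] over
    the Taylor coefficients, hence the arguments divided by [r] in [torus_taylor]. *)
Definition tcoef (m n : nat) : CC R :=
  ip * cI (fun s => ip * cI (fun t => torus s t * cis (- (n%:R * t))) * cis (- (m%:R * s))).

Lemma ipE : ip * Complex (2 * pi) 0 = 1.
Proof.
apply: complexP; rewrite ?cReM ?cImM /ip /=; last by ring.
by rewrite mulVf ?mul0r ?subr0 ?mulr0// gt_eqF// twopi_gt0.
Qed.

Lemma normc_ip : normc ip = (2 * pi)^-1.
Proof. by rewrite /ip normc_real gtr0_norm// invr_gt0 twopi_gt0. Qed.

Lemma tcoef_bounded : exists B, forall m n, normc (tcoef m n) <= B.
Proof.
have [B B0 HB] := torus_bounded 0 (2 * pi).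
have pn0 : 2 * pi != 0 :> R by rewrite gt_eqF// twopi_gt0.
exists (2 * (2 * B)) => m n; rewrite /tcoef Normc.normcM normc_ip mulrC ler_pdivrMr ?twopi_gt0//.
apply: cI_le.
  apply: ccontM; last exact: ccont_cisN.
  by apply: ccontM; [exact: ccont_cst|exact: ccont_cI_torus].
move=> s ss; rewrite !Normc.normcM normc_cis mulr1 normc_ip mulrC ler_pdivrMr ?twopi_gt0//.
apply: cI_le; first by apply: ccontM; [exact: torus_ccont2|exact: ccont_cisN].
by move=> t tt; rewrite Normc.normcM normc_cis mulr1; exact: HB.
Qed.

(** Cauchy's formula is applied in the second variable for each point of the first circle, then in
    the first variable. Both kernels are expanded by [K_series]; its remainder is uniform in [s],
    which allows integrating the inner expansion term by term. *)
Lemma torus_taylor (z1 z2 : CC R) : normc z1 < r -> normc z2 < r ->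
  f (z1, z2) = csum (fun m => csum (fun n => tcoef m n * (Complex r^-1 0 * z2) ^+ n) *
                   (Complex r^-1 0 * z1) ^+ m).
Proof.
move=> h1 h2; have /andP[_ r1] := r01.
have z1d : disc z1 by apply/discE; exact: lt_trans r1.
have z2d : disc z2 by apply/discE; exact: lt_trans r1.
have [B B0 HB] := torus_bounded 0 (2 * pi); have [B' HB'] := tcoef_bounded.
set b1 := Complex r^-1 0 * z1; set b2 := Complex r^-1 0 * z2.
have nb1 : normc b1 = normc z1 / r.
  by rewrite /b1 Normc.normcM normc_real gtr0_norm ?invr_gt0// mulrC.
have nb2 : normc b2 = normc z2 / r.
  by rewrite /b2 Normc.normcM normc_real gtr0_norm ?invr_gt0// mulrC.
have Q1 := q01 r01 h1; have Q2 := q01 r01 h2.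
have pn0 : 2 * pi != 0 :> R by rewrite gt_eqF// twopi_gt0.
have B'0 : 0 <= B' by exact: le_trans (normc_ge0 _) (HB' 0%N 0%N).
have gb2 m : gbound B' (normc z2 / r) (fun n => tcoef m n * b2 ^+ n).
  split => //; split => // n; rewrite Normc.normcM normc_X nb2.
  by rewrite ler_wpM2r// exprn_ge0//; case/andP: Q2.
have gb1 : gbound (B' / (1 - normc z2 / r)) (normc z1 / r)
    (fun m => csum (fun n => tcoef m n * b2 ^+ n) * b1 ^+ m).
  have /andP[q20 q21] := Q2; have /andP[q10 q11] := Q1.
  split; first by rewrite divr_ge0// subr_ge0 ltW.
  split => // m; rewrite Normc.normcM normc_X nb1 ler_wpM2r ?exprn_ge0//.
  exact: csum_le (gb2 m).
have gd2 s w : disc w -> exists d, cdiff (fun w => f (Complex r 0 * cis s, w)) w d.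
  move=> wd; exists (partial2 f (Complex r 0 * cis s, w)).
  have := @slice2 R f (Complex r 0 * cis s, w); apply.
  by apply: hf; split => //; exact: circ_disc.
have gd1 w : disc w -> exists d, cdiff (fun w => f (w, z2)) w d.
  move=> wd; exists (partial1 f (w, z2)).
  by have := @slice1 R f (w, z2); apply; apply: hf; split.
pose g1 s := f (Complex r 0 * cis s, z2).
have cf2 s : Complex (2 * pi) 0 * g1 s = cI (fun t => torus s t *
    (Complex r 0 * cis t / (Complex r 0 * cis t - z2))).
  by rewrite -(cauchy_formula (gd2 s) r01 h2).
have cf1 : Complex (2 * pi) 0 * f (z1, z2) = cI (fun s => g1 s *
    (Complex r 0 * cis s / (Complex r 0 * cis s - z1))).
  by rewrite -(cauchy_formula gd1 r01 h1).
pose T n s := cI (fun t => torus s t * cis (- (n%:R * t))).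
have cT n : ccont (T n) := ccont_cI_torus n.
have est2 s N : 0 <= s <= 2 * pi ->
    normc (Complex (2 * pi) 0 * g1 s - \sum_(n < N) T n s * b2 ^+ n) <=
    2 * (B * (r / (r - normc z2))) * (2 * pi) * (normc z2 / r) ^+ N.
  move=> ss; rewrite cf2; apply: (K_series r01 h2 (torus_ccont2 s)) => t tt.
  exact: HB.
have cg1 : ccont g1.
  have df s : differentiable f ((Complex r 0 * cis s : CC R), z2).
    by apply: hf; split => //; exact: circ_disc.
  have H s0 e : 0 < e -> exists2 del : R, 0 < del & forall s, `|s - s0| < del ->
      normc (g1 s - g1 s0) < e.
    move=> e0; have [d d0 Hd] := diff_cont_eps (df s0) e0.
    have [d' d'0 Hd'] := circ_cont r s0 d0.
    by exists d' => // s ss; apply: Hd; [exact: Hd'|rewrite /= subrr Normc.normc0].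
  split=> s0; apply/cvgrPdist_lt => e e0; have [d d0 Hd] := H s0 e e0.
    exists d => // s; rewrite /ball_ /= distrC => /Hd; apply: le_lt_trans.
    by rewrite distrC -cReN -cReD; exact: cRe_le.
  exists d => // s; rewrite /ball_ /= distrC => /Hd; apply: le_lt_trans.
  by rewrite distrC -cImN -cImD; exact: cIm_le.
have [G G0 HG] : exists2 G : R, 0 <= G & forall s, 0 <= s <= 2 * pi -> normc (g1 s) <= G.
  (* The bound on [g1] is the remainder estimate [est2] for the empty partial sum. *)
  exists ((2 * (B * (r / (r - normc z2))) * (2 * pi)) / (2 * pi)).
    have rz : 0 < r - normc z2 by rewrite subr_gt0.
    by rewrite divr_ge0 ?mulr_ge0 ?invr_ge0 ?(ltW r0) ?(ltW rz) ?pi_ge0.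
  move=> s ss; rewrite ler_pdivlMr ?twopi_gt0// mulrC.
  have := est2 s 0%N ss; rewrite big_ord0 subr0 expr0 mulr1 Normc.normcM normc_real.
  by rewrite (gtr0_norm twopi_gt0).
have cm m : ip * cI (fun s => g1 s * cis (- (m%:R * s))) = csum (fun n => tcoef m n * b2 ^+ n).
  apply/esym.
  apply: (@csum_unique _ _ _ (2 * ((2 * pi)^-1 * (2 * (B * (r / (r - normc z2))) * (2 * pi))))
     (normc z2 / r) _ _ (gb2 m)) => // N.
  have cS : ccont (fun s => \sum_(n < N) (ip * T n s * cis (- (m%:R * s)) * b2 ^+ n)).
    apply: (@ccont_sum _ (fun n s => ip * T n s * cis (- (m%:R * s)) * b2 ^+ n)) => n.
    apply: ccontM; last exact: ccont_cst.
    apply: ccontM; last exact: ccont_cisN.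
    by apply: ccontM; [exact: ccont_cst|exact: cT].
  have cm1 : ccont (fun s => g1 s * cis (- (m%:R * s))).
    by apply: ccontM => //; exact: ccont_cisN.
  have -> : psums (fun n => tcoef m n * b2 ^+ n) N =
      ip * cI (fun s => \sum_(n < N) (ip * T n s * cis (- (m%:R * s)) * b2 ^+ n)).
    rewrite /psums (@cI_sum R (fun n s => ip * T n s * cis (- (m%:R * s)) * b2 ^+ n)) ?mulr_sumr => [|n].
      apply: eq_bigr => n _; rewrite /tcoef -mulrA; congr (_ * _).
      have cW : ccont (fun s => ip * T n s * cis (- (m%:R * s))).
        apply: ccontM; last exact: ccont_cisN.
        by apply: ccontM; [exact: ccont_cst|exact: cT].
      rewrite -/(T n) mulrC -(cIZ (b2 ^+ n) cW).
      by apply: cI_ext => s _; rewrite mulrC.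
    apply: ccontM; last exact: ccont_cst.
    apply: ccontM; last exact: ccont_cisN.
    by apply: ccontM; [exact: ccont_cst|exact: cT].
  rewrite -mulrBr -mulN1r -cIZ// -cID//; last first.
    by apply: ccontM => //; exact: ccont_cst.
  rewrite Normc.normcM normc_ip mulrC ler_pdivrMr ?twopi_gt0//.
  have -> : 2 * ((2 * pi)^-1 * (2 * (B * (r / (r - normc z2))) * (2 * pi))) * (normc z2 / r) ^+ N
     * (2 * pi) = 2 * ((2 * pi)^-1 * (2 * (B * (r / (r - normc z2))) * (2 * pi) *
    (normc z2 / r) ^+ N)) * (2 * pi) by rewrite -!mulrA.
  apply: cI_le.
    by apply: ccontD => //; apply: ccontM => //; exact: ccont_cst.
  move=> s ss; rewrite mulN1r.
  have -> : g1 s * cis (- (m%:R * s)) - \sum_(n < N) ip * T n s * cis (- (m%:R * s)) * b2 ^+ n =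
    ip * (Complex (2 * pi) 0 * g1 s - \sum_(n < N) T n s * b2 ^+ n) * cis (- (m%:R * s)).
    rewrite mulrBr mulrA ipE mul1r mulrBl mulr_sumr mulr_suml; congr (_ - _).
    by apply: eq_bigr => n _; ring.
  rewrite !Normc.normcM normc_cis mulr1 normc_ip ler_wpM2l ?invr_ge0 ?(ltW twopi_gt0)//.
  exact: est2.
apply/esym.
apply: (@csum_unique _ _ _ ((2 * pi)^-1 * (2 * (G * (r / (r - normc z1))) * (2 * pi)))
   (normc z1 / r) _ _ gb1) => // N.
have := K_series r01 h1 cg1 HG N; rewrite -cf1 -/b1 => E1.
have -> : f (z1, z2) - psums (fun m => csum (fun n => tcoef m n * b2 ^+ n) * b1 ^+ m) N =
  ip * (Complex (2 * pi) 0 * f (z1, z2) -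
     \sum_(m < N) cI (fun s => g1 s * cis (- (m%:R * s))) * b1 ^+ m).
  rewrite mulrBr mulrA ipE mul1r /psums mulr_sumr; congr (_ - _).
  by apply: eq_bigr => m _; rewrite -cm mulrA.
by rewrite Normc.normcM normc_ip -[leRHS]mulrA ler_wpM2l ?invr_ge0 ?(ltW twopi_gt0).
Qed.

End Torus.

(** * A criterion for differentiability in two complex variables *)

Section Differentiable.
Context {R : realType}.
Local Notation normc := (@Normc.normc R).

Lemma prod_norm_ge (h : CC R * CC R) : `|h.1| <= `|h| /\ `|h.2| <= `|h|.
Proof.
rewrite prod_normE; have c : (`|h.1| >=< `|h.2|)%O.
  by apply: real_comparable; exact: normr_real.
by rewrite !comparable_le_max// !lexx orbT.
Qed.

Lemma eps_differentiable0 (k : CC R * CC R -> CC R) (z : CC R * CC R) :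
  (forall e : R, 0 < e -> exists2 del : R, 0 < del & forall w,
     normc (w.1 - z.1) < del -> normc (w.2 - z.2) < del ->
     normc (k w - k z) <= e * (normc (w.1 - z.1) + normc (w.2 - z.2))) ->
  differentiable k z.
Proof.
move=> H.
pose Z : {linear (CC R * CC R)%type -> CC R} := \0.
have cZ : continuous Z by move=> x; exact: cvg_cst.
have eZ : k \o shift z = cst (k z) + Z +o_ (0 : CC R * CC R) id.
  apply/eqaddoP => e' e0'; have [e e0 ->] := gt0C_real e0'.
  have e2 : 0 < e / 2 by rewrite divr_gt0.
  have [del del0 Hd] := H _ e2.
  exists (ball 0 (Complex del 0), ball 0 (Complex del 0)).
    by split; apply: nbhsx_ballx; rewrite gt0_C.
  move=> h [] ; rewrite -!ball_normE /ball_ /= !sub0r !normrN !lt_normc_C => h1 h2.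
  have E1 : (h + z).1 - z.1 = h.1 by rewrite /= addrK.
  have E2 : (h + z).2 - z.2 = h.2 by rewrite /= addrK.
  have := Hd (h + z); rewrite E1 E2 => /(_ h1 h2) Hk.
  have [n1 n2] := prod_norm_ge h.
  have -> : ((k \o shift z - (cst (k z) + Z)) h) = k (h + z) - k z.
    by rewrite /Z !fctE /= addr0.
  apply: (@le_trans _ _ (Complex (e / 2 * (normc h.1 + normc h.2)) 0)).
    by rewrite le_normc_C.
  have -> : Complex (e / 2 * (normc h.1 + normc h.2)) 0 =
    Complex (e / 2) 0 * (`|h.1| + `|h.2|) :> CC R.
    by rewrite !normc_normr; apply: complexP; rewrite ?cReM ?cImM /=; ring.
  have -> : Complex e 0 * `|h| = Complex (e / 2) 0 * (`|h| + `|h|).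
    have -> : Complex e 0 = Complex (e / 2) 0 + Complex (e / 2) 0 :> CC R.
      by apply: complexP; rewrite /=; field.
    by ring.
  by rewrite ler_wpM2l ?lerD// ltW// gt0_C.
apply/diff_locallyP; rewrite (diff_unique cZ eZ); split => //.
Qed.

(** Subtracting the linear form [l] reduces to the criterion with zero differential. *)
Lemma eps_differentiable (f : CC R * CC R -> CC R) (z : CC R * CC R) (A B : CC R) :
  (forall e : R, 0 < e -> exists2 del : R, 0 < del & forall w,
     normc (w.1 - z.1) < del -> normc (w.2 - z.2) < del ->
     normc (f w - f z - (w.1 - z.1) * A - (w.2 - z.2) * B)
       <= e * (normc (w.1 - z.1) + normc (w.2 - z.2))) ->
  differentiable f z.
Proof.
move=> H; pose l w : CC R := A *: w.1 + B *: w.2.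
have dl : differentiable l z.
  have df1 : differentiable (fst : CC R * CC R -> CC R) z.
    by apply: linear_differentiable => x; exact: cvg_fst.
  have df2 : differentiable (snd : CC R * CC R -> CC R) z.
    by apply: linear_differentiable => x; exact: cvg_snd.
  by apply: (@differentiableD _ _ _ (A *: (fst : CC R * CC R -> CC R)) (B *: (snd : CC R * CC R -> CC R)));
    apply: differentiableZ.
have -> : f = (f - l) + l by rewrite subrK.
apply: differentiableD; last exact: dl.
apply: eps_differentiable0 => e e0.
have [del del0 Hd] := H e e0; exists del => // w w1 w2.
apply: le_trans (Hd w w1 w2); rewrite le_eqVlt; apply/orP; left; apply/eqP; congr normc.
by rewrite !fctE /l /GRing.scale /=; ring.
Qed.

End Differentiable.

(** * Double power series and holomorphic functions of two variables *)

Section PowerSeries2.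
Context {R : realType}.
Local Notation normc := (@Normc.normc R).
Implicit Types (a : nat -> nat -> CC R) (z : CC R * CC R).

Definition tame2 a := forall r : R, 0 <= r < 1 -> exists M, 0 <= M /\
  forall m n, normc (a m n) * r ^+ m * r ^+ n <= M.

(** An iterated sum, innermost in the second variable, so that it is a one-variable series in [z.1]
    with coefficients depending on [z.2]. *)
Definition pser2 a z : CC R := pser (fun m => pser (a m) z.2) z.1.

Definition tr a m n : CC R := a n m.
Definition d1 a m n : CC R := m.+1%:R * a m.+1 n.
Definition d2 a m n : CC R := n.+1%:R * a m n.+1.
Definition sh1 a m n : CC R := a m.+1 n.
Definition sc1 a m n : CC R := if m is m'.+1 then a m' n else 0.

Lemma tame2_tr a : tame2 a -> tame2 (tr a).
Proof.
move=> ta r r01; have [M [M0 H]] := ta r r01; exists M; split => // m n.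
by rewrite mulrAC; exact: H.
Qed.

Lemma tame2_row a m : tame2 a -> tame (a m).
Proof.
move=> ta r r01; have /andP[r0 r1] := r01.
have s01 : 0 <= (1 + r) / 2 < 1 by apply/andP; split; lra.
have [M [M0 H]] := ta _ s01; set s := (1 + r) / 2 in s01 H.
have s0 : 0 < s by rewrite /s; lra.
exists (M / s ^+ m); split; first by rewrite divr_ge0// exprn_ge0// ltW.
move=> n; rewrite ler_pdivlMr ?exprn_gt0// mulrAC; apply: le_trans (H m n).
rewrite ler_wpM2l ?mulr_ge0 ?normc_ge0 ?exprn_ge0 ?(ltW s0)//.
by rewrite lerXn2r ?nnegrE ?(ltW s0)// /s; lra.
Qed.

(** The radius [p] must exceed [r], for the inner series to be geometrically dominated on the whole
    disc of radius [r], and must be at least [s], for the outer weight. *)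
Lemma tame2_urows a r : tame2 a -> 0 <= r < 1 ->
  utame (fun (w : {w : CC R | normc w <= r}) m => pser (a m) (sval w)).
Proof.
move=> ta r01 s s01; have /andP[r0 r1] := r01; have /andP[s0 s1] := s01.
set p := Num.max s ((1 + r) / 2).
have p01 : 0 <= p < 1 by rewrite /p le_max s0 gt_max s1 /=; lra.
have p0 : 0 < p by rewrite /p lt_max; apply/orP; right; lra.
have rp : r / p < 1.
  by rewrite ltr_pdivrMr// mul1r /p lt_max; apply/orP; right; lra.
have q01 : 0 <= r / p < 1 by rewrite divr_ge0 ?(ltW p0).
have [M [M0 H]] := ta p p01.
exists (M / (1 - r / p)); split; first by rewrite divr_ge0// subr_ge0 ltW.
move=> [w wr] m /=.
have pm : 0 < p ^+ m by rewrite exprn_gt0.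
have gb : gbound (M / p ^+ m) (r / p) (fun n => a m n * w ^+ n).
  split; first by rewrite divr_ge0// ltW.
  split => // n; rewrite Normc.normcM normc_X expr_div_n mulrACA -invfM.
  rewrite ler_pdivlMr ?mulr_gt0 ?exprn_gt0//.
  have := H m n; have nw : normc w ^+ n <= r ^+ n by rewrite lerXn2r// nnegrE normc_ge0.
  move=> h; have h' := ler_pM (exprn_ge0 n (normc_ge0 w)) _ nw h.
  have -> : normc (a m n) * normc w ^+ n * (p ^+ m * p ^+ n) =
     normc w ^+ n * (normc (a m n) * p ^+ m * p ^+ n) by ring.
  by rewrite [leRHS]mulrC; apply: h'; rewrite !mulr_ge0 ?normc_ge0 ?exprn_ge0 ?(ltW p0).
have := csum_le gb; rewrite -/(pser (a m) w) => hb.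
apply: (@le_trans _ _ (M / p ^+ m / (1 - r / p) * p ^+ m)).
  rewrite ler_pM ?normc_ge0 ?exprn_ge0// lerXn2r ?nnegrE ?(ltW p0)//.
  by rewrite /p le_max lexx.
by rewrite mulrAC divfK ?gt_eqF.
Qed.

Lemma tame2_rows a w : tame2 a -> disc w -> tame (fun m => pser (a m) w).
Proof.
move=> ta /discE wd; have r01 : 0 <= normc w < 1 by rewrite normc_ge0.
exact: (utame_tame (exist _ w (lexx _)) (tame2_urows ta r01)).
Qed.

Lemma pser2_tr a z : tame2 a -> bidisc z -> pser2 a z = pser2 (tr a) (z.2, z.1).
Proof.
move=> ta [/discE z1 /discE z2].
set r := Num.max (normc z.1) (normc z.2).
have r1 : r < 1 by rewrite gt_max z1.
have r0 : 0 <= r by rewrite le_max normc_ge0.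
set p := (1 + r) / 2; have p01 : 0 <= p < 1 by apply/andP; split; rewrite /p; lra.
have p0 : 0 < p by rewrite /p; lra.
have [M [M0 H]] := ta p p01.
have q01 : 0 <= r / p < 1.
  by rewrite divr_ge0 ?(ltW p0)//= ltr_pdivrMr// mul1r /p; lra.
clearbody p.
have key m n : normc (a m n * z.2 ^+ n * z.1 ^+ m) <= M * (r / p) ^+ m * (r / p) ^+ n.
  rewrite !Normc.normcM !normc_X !expr_div_n.
  have -> : M * (r ^+ m / p ^+ m) * (r ^+ n / p ^+ n) = M * (r ^+ n * r ^+ m) / (p ^+ m * p ^+ n).
    by field; rewrite !expf_neq0// gt_eqF.
  rewrite ler_pdivlMr ?mulr_gt0 ?exprn_gt0//.
  have h1 : normc z.1 ^+ m <= r ^+ m by rewrite lerXn2r// ?nnegrE ?normc_ge0// le_max lexx.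
  have h2 : normc z.2 ^+ n <= r ^+ n by rewrite lerXn2r// ?nnegrE ?normc_ge0// le_max lexx orbT.
  have h3 := ler_pM (exprn_ge0 n (normc_ge0 _)) (exprn_ge0 m (normc_ge0 _)) h2 h1.
  have -> : normc (a m n) * normc z.2 ^+ n * normc z.1 ^+ m * (p ^+ m * p ^+ n) =
    (normc (a m n) * p ^+ m * p ^+ n) * (normc z.2 ^+ n * normc z.1 ^+ m) by ring.
  by rewrite ler_pM ?mulr_ge0 ?normc_ge0 ?exprn_ge0 ?(ltW p0) ?normc_ge0.
have E m : pser (a m) z.2 * z.1 ^+ m = csum (fun n => a m n * z.2 ^+ n * z.1 ^+ m).
  have [|M' [q Hb]] := @tame_gboundz _ (a m) z.2 (tame2_row m ta); first exact/discE.
  rewrite /pser mulrC -(csumZ _ Hb); apply: csum_ext => n; ring.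
have E' n : pser (tr a n) z.1 * z.2 ^+ n = csum (fun m => a m n * z.2 ^+ n * z.1 ^+ m).
  have [|M' [q Hb]] := @tame_gboundz _ (tr a n) z.1 (tame2_row n (tame2_tr ta)); first exact/discE.
  by rewrite /pser mulrC -(csumZ _ Hb); apply: csum_ext => m; rewrite /tr; ring.
rewrite /pser2 /= {1}/pser (csum_ext E) (csum_exchange M0 q01 key).
by rewrite /pser; apply: csum_ext => n; rewrite -E'.
Qed.

Lemma tame2_d1 a : tame2 a -> tame2 (d1 a).
Proof.
move=> ta r r01; have /andP[r0 r1] := r01.
have s01 : 0 <= (1 + r) / 2 < 1 by apply/andP; split; lra.
have [M [M0 H]] := ta _ s01; set s := (1 + r) / 2 in s01 H.
have s0 : 0 < s by rewrite /s; lra.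
have q01 : 0 <= r / s < 1.
  by rewrite divr_ge0 ?(ltW s0)//= ltr_pdivrMr// mul1r /s; lra.
exists (M / s / (1 - r / s)); split.
  by rewrite !mulr_ge0 ?invr_ge0 ?(ltW s0)// subr_ge0 ltW//; case/andP: q01.
move=> m n; rewrite /d1 Normc.normcM normc_natr.
have h1 := mulSn_geo_le m q01; have h2 := H m.+1 n.
have rsn : r ^+ n <= s ^+ n by rewrite lerXn2r ?nnegrE ?(ltW s0)// /s; lra.
clearbody s.
have -> : m.+1%:R * normc (a m.+1 n) * r ^+ m * r ^+ n =
  (normc (a m.+1 n) * s ^+ m * r ^+ n) * (m.+1%:R * (r / s) ^+ m).
  by rewrite expr_div_n; field; rewrite expf_neq0// gt_eqF.
rewrite ler_pM ?mulr_ge0 ?normc_ge0 ?exprn_ge0 ?(ltW s0) ?ler0n//.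
  by case/andP: q01.
rewrite ler_pdivlMr//; apply: le_trans h2.
have -> : normc (a m.+1 n) * s ^+ m * r ^+ n * s = normc (a m.+1 n) * s ^+ m.+1 * r ^+ n.
  by rewrite exprS; ring.
by rewrite ler_wpM2l// mulr_ge0 ?normc_ge0 ?exprn_ge0 ?(ltW s0).
Qed.

Lemma tame2_le a b : tame2 a -> (forall m n, normc (b m n) <= normc (a m n)) -> tame2 b.
Proof.
move=> ta ba r r01; have [M [M0 H]] := ta r r01; exists M; split => // m n.
have /andP[r0 r1] := r01.
by apply: le_trans (H m n); rewrite !ler_wpM2r ?exprn_ge0.
Qed.

Lemma tame2_d2 a : tame2 a -> tame2 (d2 a).
Proof. by move=> ta; exact: (tame2_tr (tame2_d1 (tame2_tr ta))). Qed.

Lemma tame2_sh1 a : tame2 a -> tame2 (sh1 a).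
Proof.
move=> /tame2_d1 ta; apply: (tame2_le ta) => m n; rewrite /d1 /sh1 Normc.normcM normc_natr.
by rewrite ler_peMl ?normc_ge0// ler1n.
Qed.

Lemma tame2_sc1 a : tame2 a -> tame2 (sc1 a).
Proof.
move=> ta r r01; have [M [M0 H]] := ta r r01; have /andP[r0 r1] := r01.
exists M; split => // m n; case: m => [|m]; first by rewrite /sc1 Normc.normc0 !mul0r.
rewrite /sc1; apply: le_trans (H m n); rewrite exprS.
have -> : normc (a m n) * (r * r ^+ m) * r ^+ n = r * (normc (a m n) * r ^+ m * r ^+ n) by ring.
by rewrite ler_piMl ?mulr_ge0 ?normc_ge0 ?exprn_ge0// ltW.
Qed.

Lemma pser_ext (c c' : nat -> CC R) w : (forall n, c n = c' n) -> pser c w = pser c' w.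
Proof. by move=> H; congr (pser _ w); apply/funext. Qed.

Lemma pser2_d1 a z : tame2 a -> bidisc z -> pser (dcoef (fun m => pser (a m) z.2)) z.1 = pser2 (d1 a) z.
Proof.
move=> ta [z1 z2]; rewrite /pser2; apply: pser_ext => m.
by rewrite /dcoef -pserZ//; exact: tame2_row.
Qed.

Lemma eq_partial1 f a z : tame2 a -> (forall w, bidisc w -> f w = pser2 a w) ->
  bidisc z -> partial1 f z = pser2 (d1 a) z.
Proof.
move=> ta fa zd; have [z1 z2] := zd; rewrite /partial1.
rewrite (@derive1_near _ _ (pser (fun m => pser (a m) z.2)))//.
  rewrite derive1_pser//; last exact: tame2_rows.
  exact: pser2_d1.
by move=> w wd; rewrite fa.
Qed.

Lemma eq_partial2 f a z : tame2 a -> (forall w, bidisc w -> f w = pser2 a w) ->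
  bidisc z -> partial2 f z = pser2 (d2 a) z.
Proof.
move=> ta fa zd; have [z1 z2] := zd.
have -> : partial2 f z = partial1 (fun w => f (w.2, w.1)) (z.2, z.1) by [].
have zd' : bidisc (z.2, z.1) by split.
transitivity (pser2 (d1 (tr a)) (z.2, z.1)); last by rewrite [RHS]pser2_tr//; exact: tame2_d2.
apply: eq_partial1 => //; first exact: tame2_tr.
move=> w [w1 w2]; have wd : bidisc (w.2, w.1) by split.
have -> : w = ((w.2, w.1).2, (w.2, w.1).1) by case: (w).
by rewrite -(pser2_tr ta wd) -(fa _ wd).
Qed.

Lemma pser_cont c w : tame c -> disc w -> forall e : R, 0 < e -> exists2 del : R, 0 < del &
  forall w', normc (w' - w) < del -> normc (pser c w' - pser c w) < e.
Proof.
move=> tc /discE wd e e0.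
set r := (1 + normc w) / 2; have w0 := normc_ge0 w.
have r01 : 0 <= r < 1 by apply/andP; split; rewrite /r; lra.
have [K HK] := pser_taylor2 tc r01.
set D := normc (pser (dcoef c) w); have D0 : 0 <= D := normc_ge0 _.
have L0 : 0 < 1 + `|K| + D by rewrite -addrA ltr_pwDl// addr_ge0.
exists (Num.min (Num.min 1 ((1 - normc w) / 2)) (e / (1 + `|K| + D))).
  by rewrite !lt_min ltr01 !divr_gt0// subr_gt0.
move=> w'; rewrite !lt_min => /andP[/andP[h0 h1] h2].
have wr : normc w <= r by rewrite /r; lra.
have wr' : normc w' <= r.
  by rewrite -(subrK w w'); apply: (le_trans (normcD _ _)); rewrite /r; lra.
have := HK w w' wr wr'; set u := normc (w' - w) in h0 h1 h2 * => H.
have u0 : 0 <= u := normc_ge0 _.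
rewrite -(subrK ((w' - w) * pser (dcoef c) w) (pser c w' - pser c w)).
apply: (le_lt_trans (normcD _ _)); rewrite Normc.normcM -/u -/D.
move: h2; rewrite ltr_pdivlMr// => h2.
apply: le_lt_trans h2.
have k1 : K * u ^+ 2 <= `|K| * u.
  rewrite expr2 mulrA ler_wpM2r//; apply: (@le_trans _ _ (`|K| * u)).
    by rewrite ler_wpM2r// ler_norm.
  by rewrite ler_piMr// ltW.
nra.
Qed.

(** The increment from [Z] to [W] passes through the intermediate value [M]: by [v] in the second
    variable, then by [u] in the first. The derivative [A'] belongs to the intermediate point and is
    close to [A] by continuity. *)
Lemma two_step_taylor (W M Z u v A A' B : CC R) (K1 K2 K e : R) : 0 < e -> 0 < K ->
  normc (W - M - u * A') <= K1 * normc u ^+ 2 ->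
  normc (M - Z - v * B) <= K2 * normc v ^+ 2 ->
  normc (A' - A) < e / 4 -> normc u < e / (4 * K) -> normc v < e / (4 * K) ->
  `|K1| <= K -> `|K2| <= K ->
  normc (W - Z - u * A - v * B) <= e * (normc u + normc v).
Proof.
move=> e0 K0 h1 h2 h3 a3 b3 k1K k2K.
have -> : W - Z - u * A - v * B = (W - M - u * A') + u * (A' - A) + (M - Z - v * B) by ring.
have nu := normc_ge0 u; have nv := normc_ge0 v.
apply: (le_trans (normcD _ _)).
apply: (le_trans (lerD (normcD _ _) (lexx _))).
rewrite (Normc.normcM u).
have est (k t : R) : `|k| <= K -> 0 <= t -> t < e / (4 * K) -> k * t ^+ 2 <= e / 4 * t.
  move=> kK t0 tK; rewrite expr2 mulrA ler_wpM2r//.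
  apply: (@le_trans _ _ (K * t)).
    by rewrite ler_wpM2r// (le_trans (ler_norm _) kK).
  move: tK; rewrite ltr_pdivlMr ?mulr_gt0// => tK; lra.
have e1 := est K1 _ k1K nu a3; have e2 := est K2 _ k2K nv b3.
have e3 : normc u * normc (A' - A) <= normc u * (e / 4) by rewrite ler_wpM2l// ltW.
have : 0 <= e * normc u by rewrite mulr_ge0// ltW.
have : 0 <= e * normc v by rewrite mulr_ge0// ltW.
lra.
Qed.

(** The Taylor constant [K1] is uniform over the second variable, hence available at the moving
    point [(z.1, w.2)]. Together with continuity of the first derivative along the second variable
    this gives joint differentiability. *)
Lemma pser2_holomorphic f a : tame2 a -> (forall w, bidisc w -> f w = pser2 a w) ->
  holomorphic f.
Proof.
move=> ta fa z zd; have [z1 z2] := zd.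
move/discE: (z1) => n1; move/discE: (z2) => n2.
set r := (1 + Num.max (normc z.1) (normc z.2)) / 2.
set x := Num.max _ _ in r; have x1 : x < 1 by rewrite gt_max n1.
have x0 : 0 <= x by rewrite le_max normc_ge0.
have m1 : normc z.1 <= x by rewrite le_max lexx.
have m2 : normc z.2 <= x by rewrite le_max lexx orbT.
have r01 : 0 <= r < 1 by apply/andP; split; rewrite /r; lra.
have [K1 H1] := pser_utaylor2 (tame2_urows ta r01) r01.
have [K2 H2] := pser_utaylor2 (tame2_urows (tame2_tr ta) r01) r01.
(* The second partial derivative is written with exchanged variables, the form in which the
   remainder for [tr a] produces it. *)
apply: (@eps_differentiable _ f z (pser2 (d1 a) z) (pser2 (tr (d2 a)) (z.2, z.1))).
move=> e e0.
have e4 : 0 < e / 4 by rewrite divr_gt0.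
have tD := tame2_rows (tame2_tr (tame2_d1 ta)) z1.
have [dl dl0 Hdl] := pser_cont tD z2 e4.
set K := 1 + `|K1| + `|K2|.
have K0 : 0 < K by rewrite /K -addrA ltr_pwDl// addr_ge0.
have k1K : `|K1| <= K by rewrite /K addrAC lerDr addr_ge0.
have k2K : `|K2| <= K by rewrite /K lerDr addr_ge0.
clearbody K.
exists (Num.min (Num.min ((1 - x) / 2) dl) (e / (4 * K))).
  by rewrite !lt_min dl0 !divr_gt0// ?subr_gt0// mulr_gt0.
move=> w; rewrite !lt_min => /andP[/andP[a1 a2] a3] /andP[/andP[b1 b2] b3].
have w1 : normc w.1 <= r.
  by rewrite -(subrK z.1 w.1); apply: (le_trans (normcD _ _)); rewrite /r; lra.
have w2 : normc w.2 <= r.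
  by rewrite -(subrK z.2 w.2); apply: (le_trans (normcD _ _)); rewrite /r; lra.
have /andP[_ r1] := r01.
have wd : bidisc w by split; apply/discE; exact: le_lt_trans r1.
have zr1 : normc z.1 <= r by rewrite /r; lra.
have zr2 : normc z.2 <= r by rewrite /r; lra.
have wzd : bidisc (z.1, w.2) by split => //; case: wd.
have h1 := H1 (exist _ w.2 w2) z.1 w.1 zr1 w1.
have h2 := H2 (exist _ z.1 zr1) z.2 w.2 zr2 w2.
rewrite /= in h1 h2.
rewrite (@pser2_d1 a (z.1, w.2) ta wzd) in h1.
have zd' : bidisc (z.2, z.1) by split.
rewrite (@pser2_d1 (tr a) (z.2, z.1) (tame2_tr ta) zd') in h2.
rewrite -/(pser2 (tr a) (w.2, z.1)) -/(pser2 (tr a) (z.2, z.1)) in h2.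
rewrite -(@pser2_tr a (z.1, w.2) ta wzd) in h2.
have zE : (z.1, z.2) = z by case: (z).
have zz : pser2 (tr a) (z.2, z.1) = pser2 a z by rewrite [RHS]pser2_tr.
rewrite zz in h2.
have h3 : normc (pser2 (d1 a) (z.1, w.2) - pser2 (d1 a) z) < e / 4.
  have := Hdl _ b2.
  rewrite -[pser _ w.2]/(pser2 (tr (d1 a)) (w.2, z.1)) -[pser _ z.2]/(pser2 (tr (d1 a)) (z.2, z.1)).
  by rewrite -(@pser2_tr (d1 a) (z.1, w.2) (tame2_d1 ta) wzd) -(@pser2_tr (d1 a) z (tame2_d1 ta) zd).
rewrite (fa w wd) (fa z zd).
set u := w.1 - z.1 in a1 a2 a3 h1 *; set v := w.2 - z.2 in b1 b2 b3 h2 *.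
have wE : pser2 a w = pser (fun m => pser (a m) w.2) w.1 := erefl.
rewrite -wE -/(pser2 a (z.1, w.2)) in h1.
set A' := pser2 (d1 a) (z.1, w.2) in h1 h3; set A := pser2 (d1 a) z in h3 *.
have -> : pser2 (tr (d2 a)) (z.2, z.1) = pser2 (d1 (tr a)) (z.2, z.1) := erefl.
set B := pser2 (d1 (tr a)) _ in h2 *.
exact: (@two_step_taylor _ (pser2 a (z.1, w.2)) _ _ _ _ A' _ K1 K2 K e e0 K0 h1 h2 h3 a3 b3 k1K k2K).
Qed.

(* by Parseval's identity on the circle *)
Lemma pser_coef0 (c : nat -> CC R) (s : R) M q : 0 < s -> gbound M q (fun n => c n * Complex s 0 ^+ n) ->
  (forall w, normc w = s -> csum (fun n => c n * w ^+ n) = 0) -> forall n, c n = 0.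
Proof.
move=> s0 gb H n.
have := parseval gb.
have -> : (\int[lebesgue_measure]_(t in `[0%R, (2 * pi)%R])
    (abs2 (csum (fun j => c j * Complex s 0 ^+ j * cis (j%:R * t))))%:E)%E = 0%E :> \bar R.
  apply: integral0_eq => t _.
  have -> : csum (fun j => c j * Complex s 0 ^+ j * cis (j%:R * t)) = 0.
    rewrite -(H (Complex s 0 * cis t)); last first.
      by rewrite Normc.normcM normc_real normc_cis mulr1 gtr0_norm.
    by apply: csum_ext => j; rewrite exprMn cisX mulrA.
  by rewrite abs2_0.
move=> /esym/eqP; rewrite mule_eq0 eqe gt_eqF ?twopi_gt0//= => /eqP S0.
have := @nneseries_lim_ge R (fun j => (abs2 (c j * Complex s 0 ^+ j))%:E) xpredT 0 n.+1.
rewrite S0 big_nat_recr//= sumEFin -EFinD lee_fin => H0'.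
have H0 := H0' (fun k _ _ => abs2_ge0 (c k * Complex s 0 ^+ k)).
have := abs2_ge0 (c n * Complex s 0 ^+ n).
have : 0 <= \sum_(0 <= j < n) abs2 (c j * Complex s 0 ^+ j) by apply: sumr_ge0 => j _; exact: abs2_ge0.
move=> h1 h2; have /eqP : abs2 (c n * Complex s 0 ^+ n) = 0 by lra.
rewrite abs2M mulf_eq0 => /orP[|].
  by rewrite /abs2 sqrf_eq0 => /eqP/Normc.eq0_normc.
by rewrite abs2X expf_eq0 /abs2 sqrf_eq0 normc_real normr_eq0 (gt_eqF s0) andbF.
Qed.

(** Each radius [r] has its own coefficients [C r], valid on the bidisc of radius [r]. By uniqueness
    they agree for all [r >= 1 / 2], so [C (1 / 2)] represents [f] on the whole bidisc and inherits
    the estimates of all radii. *)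
Lemma holomorphic_pser2 f : holomorphic f -> exists a, tame2 a /\
  forall z, bidisc z -> f z = pser2 a z.
Proof.
move=> hf.
pose C (r : R) m n := Complex r^-1 0 ^+ m * Complex r^-1 0 ^+ n * tcoef f r m n.
have nC (r : R) m n : 0 < r -> normc (C r m n) * r ^+ m * r ^+ n = normc (tcoef f r m n).
  move=> r0; rewrite /C !Normc.normcM !normc_X normc_real gtr0_norm ?invr_gt0// !exprVn.
  by field; rewrite !expf_neq0// gt_eqF.
have CB (r : R) : 0 < r < 1 -> exists2 B, 0 <= B & forall m n, normc (C r m n) * r ^+ m * r ^+ n <= B.
  move=> r01; have [B HB] := tcoef_bounded hf r01; exists B.
    exact: le_trans (normc_ge0 _) (HB 0%N 0%N).
  by move=> m n; rewrite nC//; case/andP: r01.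
have expand (r : R) (z : CC R * CC R) : 0 < r < 1 -> normc z.1 < r -> normc z.2 < r ->
    f z = csum (fun m => csum (fun n => C r m n * z.2 ^+ n) * z.1 ^+ m).
  move=> r01 h1 h2; have zE : z = (z.1, z.2) by case: (z).
  rewrite {1}zE (torus_taylor hf r01 h1 h2); apply: csum_ext => m.
  have [B HB] := tcoef_bounded hf r01; have /andP[r0 r1] := r01.
  have gb : gbound B (normc z.2 / r) (fun n => tcoef f r m n * (Complex r^-1 0 * z.2) ^+ n).
    split; first exact: le_trans (normc_ge0 _) (HB 0%N 0%N).
    split; first exact: (q01 r01 h2).
    move=> n; rewrite (Normc.normcM (tcoef f r m n)) normc_X (Normc.normcM _ z.2) normc_real.
    rewrite gtr0_norm ?invr_gt0//.
    by rewrite [r^-1 * _]mulrC ler_wpM2r// exprn_ge0// divr_ge0 ?normc_ge0 ?(ltW r0).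
  have E : csum (fun n => C r m n * z.2 ^+ n) = Complex r^-1 0 ^+ m *
      csum (fun n => tcoef f r m n * (Complex r^-1 0 * z.2) ^+ n).
    apply: etrans (csumZ (Complex r^-1 0 ^+ m) gb); congr csum; apply/funext => n.
    by rewrite /C; move: (tcoef f r m n) => t; rewrite exprMn; ring.
  rewrite E; move: (csum _) => t; rewrite exprMn; ring.
have gbin (r s : R) (w : CC R) : 0 < r < 1 -> 0 < s -> s < r -> normc w <= s ->
    exists2 B, 0 <= B & (forall m, gbound (B / r ^+ m) (s / r) (fun n => C r m n * w ^+ n)).
  move=> r01 s0 sr ws; have [B B0 HB] := CB r r01; exists B => // k.
  have /andP[r0 r1] := r01.
  split; first by rewrite divr_ge0 ?exprn_ge0 ?(ltW r0).
  split; first by rewrite divr_ge0 ?(ltW s0) ?(ltW r0)//= ltr_pdivrMr// mul1r.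
  move=> n; rewrite Normc.normcM normc_X expr_div_n mulrACA -invfM.
  rewrite ler_pdivlMr ?mulr_gt0 ?exprn_gt0//.
  have -> : normc (C r k n) * normc w ^+ n * (r ^+ k * r ^+ n) =
    normc (C r k n) * r ^+ k * r ^+ n * normc w ^+ n by ring.
  rewrite ler_pM ?mulr_ge0 ?normc_ge0 ?exprn_ge0 ?(ltW r0) ?normc_ge0//.
  by rewrite lerXn2r// nnegrE ?normc_ge0 ?(ltW s0).
have h2 : 0 < (1 / 2 : R) < 1 by apply/andP; split; lra.
have indep (r : R) m n : 1 / 2 <= r < 1 -> C r m n = C (1 / 2) m n.
  move=> /andP[r2 r1]; have r01 : 0 < r < 1 by apply/andP; split; lra.
  (* Expansions are compared on circles of radius [1 / 4], inside the domain of every [C r] with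
     [r >= 1 / 2]. *)
  pose s : R := 1 / 4; have s0 : 0 < s by rewrite /s; lra.
  have sr : s < r by rewrite /s; lra.
  have s2 : s < 1 / 2 by rewrite /s; lra.
  have qr : 0 <= s / r < 1 by have /andP[r0 _] := r01; rewrite divr_ge0 ?(ltW s0) ?(ltW r0)//= ltr_pdivrMr// mul1r.
  have q2 : 0 <= s / (1 / 2) < 1 by rewrite /s; apply/andP; split; lra.
  clearbody s.
  have outer (p : R) (w : CC R) : 0 < p < 1 -> s < p -> normc w <= s -> exists B q,
      gbound B q (fun m => csum (fun n => C p m n * w ^+ n) * Complex s 0 ^+ m).
    move=> p01 sp ws; have [B B0 HB] := gbin p s w p01 s0 sp ws.
    have /andP[p0 p1] := p01.
    have q01' : 0 <= s / p < 1 by rewrite divr_ge0 ?(ltW s0) ?(ltW p0)//= ltr_pdivrMr// mul1r.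
    have /andP[q0 q1] := q01'.
    exists (B / (1 - s / p)), (s / p); split; first by rewrite divr_ge0// subr_ge0 ltW.
    split => // k; rewrite Normc.normcM normc_X normc_real gtr0_norm// expr_div_n.
    have := csum_le (HB k) => hB.
    apply: (le_trans (ler_wpM2r (exprn_ge0 k (ltW s0)) hB)).
    by rewrite le_eqVlt; apply/orP; left; apply/eqP; field;
      rewrite ?expf_neq0 ?gt_eqF// subr_gt0.
  (* At fixed [w] the coefficients of the powers of the first variable agree; a second use of
     [pser_coef0] below separates the powers of [w]. *)
  have row (w : CC R) : normc w = s -> forall m, csum (fun n => C r m n * w ^+ n) - csum (fun n => C (1 / 2) m n * w ^+ n) = 0.
    move=> ws; have ws' : normc w <= s by rewrite ws.
    have [B1 [q1' G1]] := outer r w r01 sr ws'; have [B2 [q2' G2]] := outer _ w h2 s2 ws'.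
    have [B3 [q3 G3]] := gboundB G1 G2.
    apply: (@pser_coef0 _ s B3 q3) => //.
      by have -> : (fun n => (csum (fun k => C r n k * w ^+ k) - csum (fun k => C (1 / 2) n k * w ^+ k))
         * Complex s 0 ^+ n) = (fun n => csum (fun k => C r n k * w ^+ k) * Complex s 0 ^+ n
         - csum (fun k => C (1 / 2) n k * w ^+ k) * Complex s 0 ^+ n)
         by apply/funext => n'; rewrite mulrBl.
    move=> v vs.
    have toV (p : R) B q : gbound B q (fun m => csum (fun n => C p m n * w ^+ n) * Complex s 0 ^+ m) ->
       gbound B q (fun m => csum (fun n => C p m n * w ^+ n) * v ^+ m).
      move=> [b0 [q0 Hb]]; split => //; split => // k; apply: le_trans (Hb k).
      by rewrite !Normc.normcM !normc_X vs normc_real gtr0_norm.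
    under csum_ext do rewrite mulrBl.
    rewrite (csumB (toV _ _ _ G1) (toV _ _ _ G2)).
    have vr : normc v < r by rewrite vs.
    have wr : normc w < r by rewrite ws.
    have v2 : normc v < 1 / 2 by rewrite vs.
    have w2 : normc w < 1 / 2 by rewrite ws.
    apply/eqP; rewrite subr_eq0; apply/eqP.
    exact: etrans (esym (expand r (v, w) r01 vr wr)) (expand (1 / 2) (v, w) h2 v2 w2).
  apply/eqP; rewrite -subr_eq0; apply/eqP.
  have ws0 : normc (Complex s 0 : CC R) <= s by rewrite normc_real gtr0_norm.
  have [B1 _ G1] := gbin r s (Complex s 0) r01 s0 sr ws0.
  have [B2 _ G2] := gbin _ s (Complex s 0) h2 s0 s2 ws0.
  have [B3 [q3 G3]] := gboundB (G1 m) (G2 m).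
  apply: (@pser_coef0 (fun n => C r m n - C (1 / 2) m n) s B3 q3) => //.
    by have -> : (fun n => (C r m n - C (1 / 2) m n) * Complex s 0 ^+ n) =
      (fun n => C r m n * Complex s 0 ^+ n - C (1 / 2) m n * Complex s 0 ^+ n)
      by apply/funext => n'; rewrite mulrBl.
  move=> w ws; have ws' : normc w <= s by rewrite ws.
  have [B1' _ G1'] := gbin r s w r01 s0 sr ws'.
  have [B2' _ G2'] := gbin _ s w h2 s0 s2 ws'.
  under csum_ext do rewrite mulrBl.
  by rewrite (csumB (G1' m) (G2' m)); exact: row.
exists (C (1 / 2)); split.
  move=> r r01; set p := Num.max r (1 / 2).
  have p2 : 1 / 2 <= p < 1 by rewrite /p le_max lexx orbT gt_max; have /andP[_ ->] := r01; rewrite /=; lra.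
  have p01 : 0 < p < 1 by move/andP: p2 => [? ?]; apply/andP; split; lra.
  have [B B0 HB] := CB p p01; exists B; split => // m n; rewrite -(indep p)//.
  apply: le_trans (HB m n); have /andP[r0 r1] := r01; have /andP[p0 p1] := p01.
  have rp k : r ^+ k <= p ^+ k by rewrite lerXn2r ?nnegrE ?(ltW p0)// /p le_max lexx.
  by rewrite !ler_pM ?mulr_ge0 ?normc_ge0 ?exprn_ge0.
move=> z [/discE z1 /discE z2].
set x := Num.max (normc z.1) (normc z.2).
have x1 : x < 1 by rewrite gt_max z1.
have m1 : normc z.1 <= x by rewrite le_max lexx.
have m2 : normc z.2 <= x by rewrite le_max lexx orbT.
set p := Num.max ((1 + x) / 2) (1 / 2).
have p1 : p < 1 by rewrite gt_max; apply/andP; split; lra.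
have p2 : 1 / 2 <= p by rewrite le_max lexx orbT.
have px : (1 + x) / 2 <= p by rewrite le_max lexx.
have p01 : 0 < p < 1 by apply/andP; split; lra.
have xp : x < p.
  have h : x < (1 + x) / 2 by clear -x1; lra.
  exact: lt_le_trans h px.
have zp1 : normc z.1 < p := le_lt_trans m1 xp.
have zp2 : normc z.2 < p := le_lt_trans m2 xp.
have pp : 1 / 2 <= p < 1 by rewrite p2 p1.
have E : C p = C (1 / 2) by apply/funext => m; apply/funext => n; exact: indep p m n pp.
by rewrite (expand p z p01 zp1 zp2) /pser2 /pser E.
Qed.

End PowerSeries2.

(** * Area integrals over the disc *)

Section TonelliOn.
Context {R : realType} (d1 d2 : measure_display) (T1 : measurableType d1) (T2 : measurableType d2).
Variables (m1 : {sigma_finite_measure set T1 -> \bar R}) (m2 : {sigma_finite_measure set T2 -> \bar R}).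
Variables (D1 : set T1) (D2 : set T2) (f : T1 -> T2 -> \bar R).
Hypotheses (mD1 : measurable D1) (mD2 : measurable D2).
Hypothesis mf : measurable_fun (D1 `*` D2) (fun p => f p.1 p.2).
Hypothesis f0 : forall x y, D1 x -> D2 y -> (0 <= f x y)%E.
Local Open Scope ereal_scope.

(** Measurability and positivity are given on the product of the two domains; extension by 0 brings
    in Tonelli's theorem on the full product. *)
Let G := (fun p : T1 * T2 => f p.1 p.2) \_ (D1 `*` D2).

Let mG : measurable_fun setT G := (measurable_restrictT _ (measurableX mD1 mD2)).1 mf.

Let G0 x : 0 <= G x.
Proof. by apply: erestrict_ge0 => -[x1 x2] [/= Dx1 Dx2]; exact: f0. Qed.

Let GE1 x : \int[m2]_y G (x, y) = ((fun x => \int[m2]_(y in D2) f x y) \_ D1) x.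
Proof.
rewrite patchE; case: ifPn => xD.
  rewrite [RHS]integral_mkcond; apply: eq_integral => y _; rewrite /G !patchE.
  have -> // : ((x, y) \in D1 `*` D2) = (y \in D2).
  by apply/idP/idP; rewrite !inE; [by case|move=> yD; split => //; exact: set_mem].
apply: integral0_eq => y _; rewrite /G patchE ifF//.
by apply/negP; rewrite inE => -[/= /mem_set]; rewrite (negbTE xD).
Qed.

Let GE2 y : \int[m1]_x G (x, y) = ((fun y => \int[m1]_(x in D1) f x y) \_ D2) y.
Proof.
rewrite patchE; case: ifPn => yD.
  rewrite [RHS]integral_mkcond; apply: eq_integral => x _; rewrite /G !patchE.
  have -> // : ((x, y) \in D1 `*` D2) = (x \in D1).
  by apply/idP/idP; rewrite !inE; [by case|move=> xD; split => //; exact: set_mem].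
apply: integral0_eq => x _; rewrite /G patchE ifF//.
by apply/negP; rewrite inE => -[/= _ /mem_set]; rewrite (negbTE yD).
Qed.

Lemma tonelli_on : \int[m1]_(x in D1) \int[m2]_(y in D2) f x y =
  \int[m2]_(y in D2) \int[m1]_(x in D1) f x y.
Proof.
rewrite [LHS]integral_mkcond [RHS]integral_mkcond.
transitivity (\int[m1]_x \int[m2]_y G (x, y)).
  by apply: eq_integral => x _; rewrite GE1.
by rewrite (fubini_tonelli _ mG G0); apply: eq_integral => y _; rewrite GE2.
Qed.

Lemma measurable_integral_on : measurable_fun D1 (fun x => \int[m2]_(y in D2) f x y).
Proof.
apply: (measurable_restrictT _ mD1).2.
have := measurable_fun_fubini_tonelli_F (m2 := m2) _ mG G0; apply: eq_measurable_fun => x _.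
by rewrite -GE1.
Qed.

End TonelliOn.

Section Lebesgue2.
Context {R : realType}.
Local Notation leb := (@lebesgue_measure R).
Local Notation RM := (measurableTypeR R).

(* the library only declares products of finite measures as sigma-finite *)
Definition lebesgue2 := (leb \x leb)%E.

HB.instance Definition _ := Measure.on lebesgue2.

Lemma lebesgue2_square (x : R) : (lebesgue2 (`[(- x)%R, x] `*` `[(- x)%R, x]) < +oo)%E.
Proof.
rewrite /lebesgue2 product_measure1E; [|exact: measurable_itv|exact: measurable_itv].
have H : (leb `[(- x)%R, x] < +oo)%E.
  by rewrite lebesgue_measure_itv /=; case: ifP => _; rewrite -?EFinB ltry.
have H0 : (0 <= leb `[(- x)%R, x])%E by exact: measure_ge0.
by apply: (lte_mul_pinfty H0 _ H); rewrite ge0_fin_numE.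
Qed.

Lemma lebesgue2_sigma_finite : sigma_finite setT lebesgue2.
Proof.
exists (fun n => `[(- n%:R)%R, n%:R] `*` `[(- n%:R)%R, n%:R]).
  apply/seteqP; split => // -[x y] _ /=.
  exists (Num.truncn (Num.max `|x| `|y|)).+1 => //.
  have H : Num.max `|x| `|y| <= (Num.truncn (Num.max `|x| `|y|)).+1%:R.
    by apply/ltW/truncnS_gt.
  split; rewrite /= in_itv /= -ler_norml; apply: le_trans H; rewrite le_max lexx ?orbT//.
move=> n; split; last exact: lebesgue2_square.
by apply: measurableX; exact: measurable_itv.
Qed.

HB.instance Definition _ := Measure_isSigmaFinite.Build _ _ _ lebesgue2 lebesgue2_sigma_finite.

End Lebesgue2.

(** * Invariance of planar Lebesgue measure *)

Section Planar.
Context {R : realType}.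
Local Notation leb := (@lebesgue_measure R).
Local Notation RM := (measurableTypeR R).
Local Notation leb2 := (leb \x leb)%E.
Local Open Scope ereal_scope.

(** The image of Lebesgue measure under [x -> k x + b], multiplied by [k], has the right value on
    half-open intervals, and so is Lebesgue measure by uniqueness. *)
Lemma integral_affine (k b : R) (f : RM -> \bar R) : (0 < k)%R ->
  measurable_fun setT f -> (forall x, 0 <= f x) ->
  \int[leb]_x f (k * x + b)%R = (k^-1)%:E * \int[leb]_x f x.
Proof.
move=> k0 mf f0.
pose phi (x : RM) : RM := (k * x + b)%R.
have mphi : measurable_fun setT phi.
  by apply: measurable_funD => //; apply: measurable_funM => //; exact: measurable_cst.
have kge : (0 <= k)%R by exact: ltW.
pose kn : {nonneg R} := NngNum kge.
have H A : measurable A -> A `<=` setT -> leb A = mscale kn (pushforward leb phi) A.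
  move=> mA _; apply: (@lebesgue_measure_unique _ (mscale kn (pushforward leb phi))) => //.
  move=> _ [[u v]] _ <-; rewrite /mscale /= /pushforward.
  have E : phi @^-1` `]u, v]%classic = `](((u - b) / k)%R), (((v - b) / k)%R)]%classic.
    apply/seteqP; split => x /=; rewrite !in_itv /= /phi.
      by rewrite ltr_pdivrMr// ler_pdivlMr// ltrBlDr lerBrDr ![(x * k)%R]mulrC.
    by rewrite ltr_pdivrMr// ler_pdivlMr// ltrBlDr lerBrDr ![(x * k)%R]mulrC.
  transitivity (k%:E * leb (`](((u - b) / k)%R), (((v - b) / k)%R)]%classic)); last by rewrite -E.
  rewrite !lebesgue_measure_itv /= !lte_fin ltr_pM2r ?invr_gt0// ltrD2r.
  case: ifP => _; last by rewrite mule0.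
  by rewrite -!EFinB -EFinM; congr EFin; field; rewrite gt_eqF.
rewrite [in RHS](eq_measure_integral (mscale kn (pushforward leb phi)) (fun A mA sA => H mphi A mA sA)).
rewrite ge0_integral_mscale//= ge0_integral_pushforward//= preimage_setT.
by rewrite muleA -EFinM mulVf ?mul1e// gt_eqF.
Qed.

Lemma integral_shift (b : R) (f : RM -> \bar R) :
  measurable_fun setT f -> (forall x, 0 <= f x) ->
  \int[leb]_x f (x + b)%R = \int[leb]_x f x.
Proof.
move=> mf f0; have := @integral_affine 1%R b f ltr01 mf f0.
by rewrite invr1 mul1e => <-; under [in RHS]eq_integral do rewrite mul1r.
Qed.

Implicit Types F : RM * RM -> \bar R.

(** At fixed second coordinate the shear is a translation of the line; Tonelli puts that integral
    inside. *)
Lemma integral_shear1 (a : R) F : measurable_fun setT F -> (forall x, 0 <= F x) ->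
  \int[leb2]_p F (p.1 + a * p.2, p.2)%R = \int[leb2]_p F p.
Proof.
move=> mF F0.
have mp : measurable_fun setT (fun p : RM * RM => ((p.1 + a * p.2)%R : RM, p.2 : RM)).
  apply/measurable_fun_pairP; split; last exact: measurable_snd.
  apply: measurable_funD; first exact: measurable_fst.
  by apply: measurable_funM; [exact: measurable_cst|exact: measurable_snd].
rewrite fubini_tonelli2//; last exact: measurableT_comp mF mp.
rewrite [RHS]fubini_tonelli2//; apply: eq_integral => y _.
rewrite /fubini_G /=.
apply: (@integral_shift (a * y)%R (fun x => F (x, y))) => //.
exact: measurableT_comp.
Qed.

Lemma integral_shear2 (a : R) F : measurable_fun setT F -> (forall x, 0 <= F x) ->
  \int[leb2]_p F (p.1, p.2 + a * p.1)%R = \int[leb2]_p F p.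
Proof.
move=> mF F0.
have mp : measurable_fun setT (fun p : RM * RM => (p.1 : RM, (p.2 + a * p.1)%R : RM)).
  apply/measurable_fun_pairP; split; first exact: measurable_fst.
  apply: measurable_funD; first exact: measurable_snd.
  by apply: measurable_funM; [exact: measurable_cst|exact: measurable_fst].
rewrite fubini_tonelli1//; last exact: measurableT_comp mF mp.
rewrite [RHS]fubini_tonelli1//; apply: eq_integral => x _.
rewrite /fubini_F /=.
apply: (@integral_shift (a * x)%R (fun y => F (x, y))) => //.
exact: measurableT_comp.
Qed.

Lemma integral_scale (k : R) F : (0 < k)%R -> measurable_fun setT F -> (forall x, 0 <= F x) ->
  \int[leb2]_p F (k * p.1, k * p.2)%R = (k^-1 ^+ 2)%:E * \int[leb2]_p F p.
Proof.
move=> k0 mF F0.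
have mk (T : measurableType _) (h : T -> RM) : measurable_fun setT h -> measurable_fun setT (fun x => (k * h x)%R : RM).
  by move=> mh; apply: measurable_funM => //; exact: measurable_cst.
have mp : measurable_fun setT (fun p : RM * RM => ((k * p.1)%R : RM, (k * p.2)%R : RM)).
  apply/measurable_fun_pairP; split; apply: measurable_funM;
    by [exact: measurable_cst|exact: measurable_fst|exact: measurable_snd].
have aff (f : RM -> \bar R) : measurable_fun setT f -> (forall x, 0 <= f x) ->
    \int[leb]_x f (k * x)%R = (k^-1)%:E * \int[leb]_x f x.
  by move=> mf f0; rewrite -(integral_affine 0 k0 mf f0); under [in RHS]eq_integral do rewrite addr0.
rewrite fubini_tonelli1//; last exact: measurableT_comp mF mp.
rewrite [in RHS]fubini_tonelli1//.
have k1 : (0 <= k^-1)%R by rewrite invr_ge0 ltW.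
transitivity (\int[leb]_x ((k^-1)%:E * fubini_F leb F (k * x)%R)).
  apply: eq_integral => x _; rewrite /fubini_F /=.
  by apply: (aff (fun y => F ((k * x)%R, y))) => //; exact: measurableT_comp.
have mG := measurable_fun_fubini_tonelli_F F mF F0 (m2 := leb).
have G0 x : 0 <= fubini_F leb F x by apply: integral_ge0.
have mH : measurable_fun setT (fun x : RM => fubini_F leb F (k * x)%R).
  by apply: (measurableT_comp mG); apply: measurable_funM; [exact: measurable_cst|exact: measurable_id].
have k1' : 0 <= (k^-1)%:E by rewrite lee_fin.
rewrite (@ge0_integralZl _ _ _ leb setT measurableT _ mH _ (fun x _ => G0 _) k1').
by rewrite (aff (fubini_F leb F) mG G0) muleA -EFinM expr2.
Qed.

Definition rot (c s : R) (p : RM * RM) : RM * RM :=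
  ((c * p.1 - s * p.2)%R, (s * p.1 + c * p.2)%R).

Lemma measurable_rot c s : measurable_fun setT (rot c s).
Proof.
have m1 : measurable_fun setT (fst : RM * RM -> RM) := measurable_fst.
have m2 : measurable_fun setT (snd : RM * RM -> RM) := measurable_snd.
apply/measurable_fun_pairP; split.
  by apply: measurable_funB; apply: measurable_funM => //; exact: measurable_cst.
by apply: measurable_funD; apply: measurable_funM => //; exact: measurable_cst.
Qed.

(* a rotation other than the half-turn is a product of three shears *)
Lemma integral_rot_shears (c s : R) F : (c ^+ 2 + s ^+ 2 = 1)%R -> (c != -1)%R ->
  measurable_fun setT F -> (forall x, 0 <= F x) ->
  \int[leb2]_p F (rot c s p) = \int[leb2]_p F p.
Proof.
move=> cs c1 mF F0.
have c1' : (1 + c != 0)%R by rewrite addrC addr_eq0.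
(* For the rotation by [theta] this is [- tan (theta / 2)], the slope of the first and third shear;
   it has a pole at the half-turn. *)
pose a := (- s / (1 + c))%R.
have m1 : measurable_fun setT (fst : RM * RM -> RM) := measurable_fst.
have m2 : measurable_fun setT (snd : RM * RM -> RM) := measurable_snd.
have msh1 : measurable_fun setT (fun p : RM * RM => ((p.1 + a * p.2)%R : RM, p.2 : RM)).
  apply/measurable_fun_pairP; split => //.
  by apply: measurable_funD => //; apply: measurable_funM => //; exact: measurable_cst.
have msh2 : measurable_fun setT (fun p : RM * RM => (p.1 : RM, (p.2 + s * p.1)%R : RM)).
  apply/measurable_fun_pairP; split => //.
  by apply: measurable_funD => //; apply: measurable_funM => //; exact: measurable_cst.
rewrite -(integral_shear1 a mF F0).
pose F1 (p : RM * RM) := F ((p.1 + a * p.2)%R, p.2).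
have mF1 : measurable_fun setT F1 by exact: measurableT_comp mF msh1.
rewrite -(@integral_shear2 s F1 mF1 (fun x => F0 _)).
pose F2 (p : RM * RM) := F1 (p.1, (p.2 + s * p.1)%R).
have mF2 : measurable_fun setT F2 by exact: measurableT_comp mF1 msh2.
rewrite -(@integral_shear1 a F2 mF2 (fun x => F0 _)).
apply: eq_integral => -[x y] _; rewrite /F2 /F1 /rot /=; congr (F (_, _)).
  have -> : (x + a * y + a * (y + s * (x + a * y)) =
     (1 + a * s) * x + a * (2 + a * s) * y)%R by ring.
  have as_ : (1 + a * s = c)%R.
    have -> : (a * s = - s ^+ 2 / (1 + c))%R by rewrite /a; field.
    have -> : (s ^+ 2 = 1 - c ^+ 2)%R by rewrite -cs; ring.
    by field.
  have -> : (a * (2 + a * s) = - s)%R.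
    have -> : (2 + a * s = 1 + c)%R by rewrite -as_; ring.
    by rewrite /a; field.
  by rewrite as_; ring.
have -> : (y + s * (x + a * y) = s * x + (1 + a * s) * y)%R by ring.
have -> : (a * s = - s ^+ 2 / (1 + c))%R by rewrite /a; field.
have -> : (s ^+ 2 = 1 - c ^+ 2)%R by rewrite -cs; ring.
by congr (_ + _)%R; field.
Qed.

Lemma integral_rot (c s : R) F : (c ^+ 2 + s ^+ 2 = 1)%R ->
  measurable_fun setT F -> (forall x, 0 <= F x) ->
  \int[leb2]_p F (rot c s p) = \int[leb2]_p F p.
Proof.
move=> cs mF F0; have [c1|c1] := eqVneq c (-1)%R; last exact: integral_rot_shears.
have s0 : s = 0%R.
  apply/eqP; rewrite -sqrf_eq0; apply/eqP; move: cs; rewrite c1 => cs.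
  have -> : (s ^+ 2 = (-1) ^+ 2 + s ^+ 2 - 1)%R by ring.
  by rewrite cs subrr.
(* The half-turn is the square of the quarter-turn [rot 0 1], which is covered by the shears. *)
have h01 : (0 ^+ 2 + 1 ^+ 2 = 1 :> R)%R by ring.
have n01 : (0 != -1 :> R)%R by rewrite eq_sym oppr_eq0 oner_eq0.
rewrite -(integral_rot_shears h01 n01 mF F0).
have mF' := measurableT_comp mF (measurable_rot 0 1).
rewrite -(@integral_rot_shears _ _ (F \o rot 0 1) h01 n01 mF' (fun x => F0 _)).
apply: eq_integral => -[x y] _; rewrite c1 s0 /rot /=; congr (F (_, _)); ring.
Qed.

Definition Cx (p : RM * RM) : CC R := Complex p.1 p.2.
Definition D2 : set (RM * RM) := [set p | disc (Cx p)].

Lemma rotE (t : R) p : Cx (rot (cos t) (sin t) p) = (cis t * Cx p)%R.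
Proof. by apply: complexP; rewrite ?cReM ?cImM /=; ring. Qed.

Lemma cmeas_Cx D : cmeas D Cx.
Proof. by apply: cmeas_Complex; apply: measurable_funTS; [exact: measurable_fst|exact: measurable_snd]. Qed.

Lemma disc_abs2 (z : CC R) : disc z <-> (abs2 z < 1)%R.
Proof.
rewrite discE /abs2; split=> H.
  by rewrite expr_lt1// normc_ge0.
by move: H; rewrite expr_lt1// normc_ge0.
Qed.

Lemma D2E : D2 = [set p : RM * RM | (abs2 (Cx p) < 1)%R].
Proof. by apply/seteqP; split => p /disc_abs2. Qed.

Lemma measurable_sub (x : R) : measurable [set p : RM * RM | (abs2 (Cx p) < x)%R].
Proof.
have := @measurable_abs2 R _ _ setT Cx (cmeas_Cx setT) measurableT _ (measurable_itv `]-oo, x[).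
by rewrite setTI; congr measurable; apply/seteqP; split => p /=; rewrite in_itv.
Qed.

Lemma measurable_D2 : measurable D2.
Proof. by rewrite D2E; exact: measurable_sub. Qed.

Lemma disc_cis t (z : CC R) : disc (cis t * z)%R <-> disc z.
Proof. by rewrite !disc_abs2 abs2M abs2_cis mul1r. Qed.

Lemma integral_disc_rot (t : R) (H : CC R -> \bar R) :
  measurable_fun D2 (H \o Cx) -> (forall z, disc z -> 0 <= H z) ->
  \int[leb2]_(p in D2) H (cis t * Cx p)%R = \int[leb2]_(p in D2) H (Cx p).
Proof.
move=> mH H0; pose F := (H \o Cx) \_ D2.
have mF : measurable_fun setT F := (measurable_restrictT _ measurable_D2).1 mH.
have F0 p : 0 <= F p by apply: erestrict_ge0 => q Dq; exact: H0.
rewrite [RHS]integral_mkcond -/F -(@integral_rot (cos t) (sin t) F)//; last exact: cos2Dsin2.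
rewrite integral_mkcond; apply: eq_integral => p _; rewrite /F !patchE.
have -> : (rot (cos t) (sin t) p \in D2) = (p \in D2).
  by apply/idP/idP; rewrite !inE /D2 /= rotE => /disc_cis.
by case: ifP => // _; rewrite /= rotE.
Qed.

(** A substitute for polar coordinates: every rotation preserves the area integral, and averaging
    over all of them puts an integral over a circle inside. *)
Lemma integral_disc_average (H : CC R -> \bar R) :
  measurable_fun D2 (H \o Cx) -> (forall z, disc z -> 0 <= H z) ->
  (2 * pi)%:E * \int[leb2]_(p in D2) H (Cx p) =
  \int[leb2]_(p in D2) \int[leb]_(t in `[0%R, (2 * pi)%R]) H (cis t * Cx p)%R.
Proof.
move=> mH H0; pose F := (H \o Cx) \_ D2.
have mF : measurable_fun setT F := (measurable_restrictT _ measurable_D2).1 mH.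
have F0 p : 0 <= F p by apply: erestrict_ge0 => q Dq; exact: H0.
pose I := `[0%R, (2 * pi)%R]%classic : set RM.
have FE t p : p \in D2 -> F (rot (cos t) (sin t) p) = H (cis t * Cx p)%R.
  move=> pD; rewrite /F patchE.
  have -> : (rot (cos t) (sin t) p \in D2).
    by move: pD; rewrite !inE /D2 /= rotE => /disc_cis.
  by rewrite /= rotE.
have mG : measurable_fun setT (fun x : RM * (RM * RM) => F (rot (cos x.1) (sin x.1) x.2)).
  apply: (measurableT_comp mF).
  have m1 : measurable_fun setT (fun x : RM * (RM * RM) => x.2.1 : RM).
    exact: (measurableT_comp measurable_fst measurable_snd).
  have m2 : measurable_fun setT (fun x : RM * (RM * RM) => x.2.2 : RM).
    exact: (measurableT_comp measurable_snd measurable_snd).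
  have [mc ms] := @cmeas_cis R _ (RM * (RM * RM))%type setT fst measurable_fst.
  apply/measurable_fun_pairP; split.
    by apply: measurable_funB; apply: measurable_funM.
  by apply: measurable_funD; apply: measurable_funM.
have mI : measurable I by exact: measurable_itv.
have mH' : measurable_fun (I `*` D2) (fun x : RM * (RM * RM) => H (cis x.1 * Cx x.2)%R).
  apply: (@eq_measurable_fun _ _ _ _ _ (fun x : RM * (RM * RM) => F (rot (cos x.1) (sin x.1) x.2))).
    by move=> x /set_mem[_ xD]; rewrite FE//; exact/mem_set.
  exact: measurable_funTS mG.
have H0' t p : I t -> D2 p -> 0 <= H (cis t * Cx p)%R.
  by move=> _ pD; apply: H0; exact/disc_cis.
transitivity (\int[leb]_(t in I) \int[leb2]_(p in D2) H (cis t * Cx p)%R); last first.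
  exact: (@tonelli_on R _ _ RM (RM * RM)%type leb lebesgue2 _ _ (fun t p => H (cis t * Cx p)%R) mI measurable_D2 mH' H0').
transitivity (\int[leb]_(t in I) \int[leb2]_(p in D2) H (Cx p)); last first.
  by apply: eq_integral => t _; exact: esym (integral_disc_rot t mH H0).
by rewrite integral_cst//= lebesgue_measure_itv/= lte_fin twopi_gt0 -EFinB subr0 muleC.
Qed.

End Planar.

(** * Moments of the disc by scaling *)

Section Moments.
Context {R : realType}.
Local Notation leb := (@lebesgue_measure R).
Local Notation RM := (measurableTypeR R).
Local Notation leb2 := (leb \x leb)%E.
Implicit Types (s : R) (j : nat).
Local Open Scope ereal_scope.

Definition disc_moment j : \bar R := \int[leb2]_(p in @D2 R) (abs2 (Cx p) ^+ j)%:E.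

Let Ds s : set (RM * RM) := [set p | (abs2 (Cx p) < s)%R].

Let mpow D j : measurable_fun D (fun p : RM * RM => (abs2 (Cx p) ^+ j)%:E).
Proof.
apply/measurable_EFinP; apply: measurable_funX.
exact: measurable_abs2 (cmeas_Cx D).
Qed.

Let pow0 j (p : RM * RM) : 0 <= (abs2 (Cx p) ^+ j)%:E.
Proof. by rewrite lee_fin exprn_ge0// abs2_ge0. Qed.

(** The dilation by [Num.sqrt s] maps the disc onto the set where [abs2] is below [s]; area
    contributes a factor [s] and the integrand [s ^ j]. *)
Lemma disc_moment_scale j s : (0 < s)%R ->
  \int[leb2]_(p in Ds s) (abs2 (Cx p) ^+ j)%:E = (s ^+ j.+1)%:E * disc_moment j.
Proof.
move=> s0; have k0 : (0 < Num.sqrt s)%R by rewrite sqrtr_gt0.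
pose F := (fun p : RM * RM => (abs2 (Cx p) ^+ j)%:E) \_ (Ds s).
have mF : measurable_fun setT F := (measurable_restrictT _ (measurable_sub s)).1 (@mpow _ j).
have F0 x : 0 <= F x by apply: erestrict_ge0 => p _; exact: pow0.
have := integral_scale k0 mF F0.
have -> : \int[leb2]_p F ((Num.sqrt s * p.1)%R, (Num.sqrt s * p.2)%R) = (s ^+ j)%:E * disc_moment j.
  have s0' : 0 <= (s ^+ j)%:E by rewrite lee_fin exprn_ge0// ltW.
  rewrite /disc_moment -(@ge0_integralZl _ _ _ leb2 _ measurable_D2 _ (@mpow _ j) _ (fun x _ => pow0 j x) s0').
  rewrite [RHS]integral_mkcond; apply: eq_integral => p _.
  have E : abs2 (Cx ((Num.sqrt s * p.1)%R, (Num.sqrt s * p.2)%R)) = (s * abs2 (Cx p))%R.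
    rewrite !abs2E /= !exprMn sqr_sqrtr ?(ltW s0)//; ring.
  rewrite /F !patchE E.
  have -> : (((Num.sqrt s * p.1)%R, (Num.sqrt s * p.2)%R) \in Ds s) = (p \in @D2 R).
    by apply/idP/idP; rewrite !inE D2E /Ds /= E gtr_pMr.
  by case: ifP => // _; rewrite exprMn EFinM.
rewrite /F -integral_mkcond => H.
have ss : (s * (Num.sqrt s)^-1 ^+ 2 = 1)%R.
  by rewrite exprVn sqr_sqrtr ?(ltW s0)// mulfV// gt_eqF.
have := congr1 (fun x => s%:E * x) H; rewrite /= !muleA -!EFinM ss mul1e => <-.
by rewrite exprS.
Qed.

Definition disc_area : R := fine (leb2 (@D2 R)).

Lemma leb2_D2_fin : leb2 (@D2 R) \is a fin_num.
Proof.
rewrite ge0_fin_numE; last exact: measure_ge0.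
apply: le_lt_trans (lebesgue2_square 1%R); apply: le_measure; rewrite ?inE.
- exact: measurable_D2.
- by apply: measurableX; exact: measurable_itv.
move=> [x y]; rewrite D2E /= abs2E /= => H; rewrite !in_itv /=.
have B (a b : R) : (a ^+ 2 + b ^+ 2 < 1)%R -> (-1 <= a <= 1)%R.
  move=> ab; rewrite -ler_norml -(@ler_pXn2r _ 2)// ?nnegrE// expr1n real_normK ?num_real//.
  by apply: le_trans (ltW ab); rewrite lerDl sqr_ge0.
by split; [exact: B H|apply: (B y x); rewrite addrC].
Qed.

Lemma leb2_D2 : leb2 (@D2 R) = disc_area%:E.
Proof. by rewrite /disc_area fineK// leb2_D2_fin. Qed.

Lemma disc_area_gt0 : (0 < disc_area)%R.
Proof.
rewrite -lte_fin -leb2_D2.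
have H : leb2 (`[0%R, 2^-1%R] `*` `[0%R, 2^-1%R]) <= leb2 (@D2 R).
  apply: le_measure; rewrite ?inE; [by apply: measurableX; exact: measurable_itv|exact: measurable_D2|].
  move=> [x y] [/=]; rewrite !in_itv /= D2E /= abs2E /= => /andP[x0 x1] /andP[y0 y1]; nra.
apply: lt_le_trans H; rewrite product_measure1E; [|exact: measurable_itv|exact: measurable_itv].
have E : leb `[0%R, 2^-1%R] = (2^-1)%:E.
  by rewrite lebesgue_measure_itv /= lte_fin invr_gt0 ltr0n -EFinB subr0.
have E0 : 0 < leb `[0%R, 2^-1%R] by rewrite E lte_fin invr_gt0 ltr0n.
exact: (mule_gt0 E0 E0).
Qed.

Lemma disc_moment0 : disc_moment 0 = disc_area%:E.
Proof.
rewrite /disc_moment; under eq_integral do rewrite expr0.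
exact: (etrans (integral_cst _ measurable_D2 1) (etrans (mul1e _) leb2_D2)).
Qed.

Lemma disc_moment_fin j : disc_moment j \is a fin_num.
Proof.
rewrite ge0_fin_numE; last by apply: integral_ge0 => p _; exact: pow0.
apply: (@le_lt_trans _ _ (disc_moment 0)); last by rewrite disc_moment0 ltry.
apply: (ge0_le_integral _ measurable_D2 (fun p _ => pow0 j p) (@mpow _ j) (@mpow _ 0%N)) => p;
  rewrite D2E /= => p1; rewrite expr0 lee_fin exprn_ile1// ?abs2_ge0//; exact: ltW.
Qed.

(** By scaling, the annulus [s <= |z|^2 < 1] has area [(1 - s) disc_area] and carries the part
    [1 - s ^ (j + 1)] of the moment, while [|z|^(2 j)] lies between [s ^ j] and 1 on it. The factor
    [1 - s] cancels through the geometric sum. *)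
Lemma disc_moment_bounds j s : (0 < s < 1)%R ->
  (s ^+ j * disc_area <= fine (disc_moment j) * \sum_(i < j.+1) s ^+ i <= disc_area)%R.
Proof.
move=> /andP[s0 s1].
have sD : Ds s `<=` @D2 R by rewrite D2E => p /= /lt_trans; apply.
have mDs := measurable_sub s; have mR : measurable (@D2 R `\` Ds s) by apply: measurableD => //; exact: measurable_D2.
have split i : disc_moment i = \int[leb2]_(p in Ds s) (abs2 (Cx p) ^+ i)%:E
    + \int[leb2]_(p in @D2 R `\` Ds s) (abs2 (Cx p) ^+ i)%:E.
  rewrite /disc_moment -{1}(setDUK sD).
  have dj : [disjoint Ds s & @D2 R `\` Ds s] by apply/disj_setPRL => p [].
  exact: (ge0_integral_setU _ mDs mR (@mpow _ i) (fun p _ => pow0 i p) dj).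
pose A := \int[leb2]_(p in @D2 R `\` Ds s) 1%:E; pose B := \int[leb2]_(p in @D2 R `\` Ds s) (abs2 (Cx p) ^+ j)%:E.
have EA : \int[leb2]_(p in @D2 R `\` Ds s) (abs2 (Cx p) ^+ 0)%:E = A.
  by apply: eq_integral => p _; rewrite expr0.
have E0 : disc_area%:E = (s * disc_area)%:E + A.
  by have := split 0%N; rewrite (disc_moment_scale 0 s0) disc_moment0 EA expr1 -EFinM.
have Ej := split j; rewrite disc_moment_scale// -/B in Ej.
have BA : B <= A.
  apply: (ge0_le_integral _ mR (fun p _ => pow0 j p) (@mpow _ j) (measurable_cst _)).
  by move=> p [] + _; rewrite D2E /= => p1; rewrite lee_fin exprn_ile1// ?abs2_ge0//; exact: ltW.
have AB : (s ^+ j)%:E * A <= B.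
  rewrite /A -ge0_integralZl//; last by rewrite lee_fin exprn_ge0// ltW.
  have h1 (p : RM * RM) : (@D2 R `\` Ds s) p -> 0 <= (s ^+ j)%:E * 1.
    by move=> _; rewrite mule1 lee_fin exprn_ge0// ltW.
  apply: (ge0_le_integral _ mR h1 (measurable_cst _) (@mpow _ j)).
  by move=> p [_ /negP]; rewrite -leNgt => sp; rewrite mule1 lee_fin lerXn2r// nnegrE ?abs2_ge0// ltW.
have A0 : 0 <= A by apply: integral_ge0.
have Afin : A \is a fin_num.
  rewrite ge0_fin_numE//; apply: (@le_lt_trans _ _ disc_area%:E); last exact: ltry.
  by rewrite E0 leeDr// lee_fin mulr_ge0// ltW// disc_area_gt0.
have Bfin : B \is a fin_num.
  rewrite ge0_fin_numE; last by apply: integral_ge0 => p _; exact: pow0.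
  by apply: le_lt_trans BA _; rewrite -ge0_fin_numE.
have mE := fineK (disc_moment_fin j).
move: E0 Ej BA AB; rewrite -(fineK Afin) -(fineK Bfin) -mE.
set a := fine A; set b := fine B; set m := fine (disc_moment j).
rewrite -!EFinM -!EFinD !lee_fin => -[E0] -[Ej] BA AB.
have G := geo_sum s j.+1; set G' := (\sum_(i < j.+1) s ^+ i)%R in G *.
have s1' : (0 < 1 - s)%R by rewrite subr_gt0.
have mb : (m * (1 - s ^+ j.+1) = b)%R by rewrite (_ : _ * _ = m - s ^+ j.+1 * m)%R; [rewrite {1}Ej; ring|ring].
have ka : (disc_area * (1 - s) = a)%R by rewrite mulrBr mulr1 {1}E0; ring.
have mG : ((1 - s) * (m * G') = b)%R by rewrite mulrCA G.
apply/andP; split; rewrite -(ler_pM2l s1') mG.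
  by rewrite mulrCA [((1 - s) * disc_area)%R]mulrC ka.
by rewrite mulrC ka.
Qed.

(** Combined with Bernoulli's inequality, this carries out limits of polynomial bounds as the
    parameter [1 - e] tends to 1. *)
Lemma le_eps_limit (x y : R) n : (0 <= x)%R ->
  (forall e, 0 < e < 1 -> x * (1 - n%:R * e) <= y)%R -> (x <= y)%R.
Proof.
move=> x0 H; apply/ler_addgt0Pr => e e0.
have nx : (0 <= n%:R * x)%R by rewrite mulr_ge0.
have nx1 : (0 < n%:R * x + 1)%R by lra.
pose d := Num.min (1 / 2)%R (e / (n%:R * x + 1))%R.
have d0 : (0 < d)%R by rewrite lt_min; apply/andP; split; [lra|exact: divr_gt0].
have d1 : (d < 1)%R by rewrite gt_min; apply/orP; left; lra.
have de : (d * (n%:R * x + 1) <= e)%R by rewrite -ler_pdivlMr// ge_min lexx orbT.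
have := H d; rewrite d0 d1 => /(_ isT) Hd.
have -> : (x = x * (1 - n%:R * d) + d * (n%:R * x))%R by ring.
by apply: lerD => //; apply: le_trans de; rewrite ler_wpM2l ?(ltW d0)// lerDl.
Qed.

Lemma bernoulli (e : R) n : (0 < e < 1)%R -> (1 - n%:R * e <= (1 - e) ^+ n)%R.
Proof.
move=> /andP[e0 e1]; elim: n => [|n IH]; first by rewrite mul0r subr0 expr0.
have h : (0 <= (1 - e))%R by lra.
have n0 : (0 <= n%:R :> R)%R by exact: ler0n.
have := ler_wpM2l h IH; rewrite -exprS; apply: le_trans.
rewrite -natr1 -subr_ge0.
have -> : ((1 - e) * (1 - n%:R * e) - (1 - (n%:R + 1) * e) = n%:R * e ^+ 2)%R by ring.
by rewrite mulr_ge0// sqr_ge0.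
Qed.

(** As [s] tends to 1, the geometric sum in [disc_moment_bounds] tends to [j + 1] and [s ^ j] to
    1. *)
Lemma disc_momentE j : disc_moment j = (disc_area / j.+1%:R)%:E.
Proof.
rewrite -(fineK (disc_moment_fin j)); congr EFin; set m := fine _.
have j0 : (0 < j.+1%:R :> R)%R by rewrite ltr0n.
have m0 : (0 <= m)%R by apply: fine_ge0; apply: integral_ge0 => p _; exact: pow0.
apply/(mulIf (lt0r_neq0 j0)); rewrite divfK ?lt0r_neq0//; apply/eqP; rewrite eq_le; apply/andP; split.
  apply: (@le_eps_limit _ _ j.+1); first by rewrite mulr_ge0// ltW.
  move=> e e01; have s01 : (0 < 1 - e < 1)%R by move/andP: e01 => [? ?]; apply/andP; split; lra.
  have /andP[_] := disc_moment_bounds j s01; apply: le_trans.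
  rewrite -/m -mulrA ler_wpM2l//.
  have -> : (j.+1%:R * (1 - j.+1%:R * e) = \sum_(i < j.+1) (1 - j.+1%:R * e))%R.
    by rewrite sumr_const card_ord mulr_natl.
  apply: ler_sum => i _; apply: le_trans (bernoulli i e01).
  have /andP[e0 _] := e01.
  by rewrite lerD2l lerN2 ler_wpM2r ?(ltW e0)// ler_nat ltnW.
apply: (@le_eps_limit _ _ j); first exact/ltW/disc_area_gt0.
move=> e e01; have s01 : (0 < 1 - e < 1)%R by move/andP: e01 => [? ?]; apply/andP; split; lra.
have /andP[H _] := disc_moment_bounds j s01.
apply: le_trans (_ : (1 - e) ^+ j * disc_area <= _)%R.
  by rewrite mulrC ler_wpM2r ?bernoulli// ltW// disc_area_gt0.
apply: le_trans H _; rewrite -/m ler_wpM2l//.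
have -> : (j.+1%:R = \sum_(i < j.+1) 1 :> R)%R by rewrite sumr_const card_ord.
apply: ler_sum => i _; by have /andP[s0 s1] := s01; rewrite exprn_ile1// ltW.
Qed.

(** The difference of the consecutive moments [disc_area / (j + 1)] and [disc_area / (j + 2)]. *)
Definition wgt j : R := (disc_area / (j.+1%:R * j.+2%:R))%R.

Lemma wgt_ge0 j : (0 <= wgt j)%R.
Proof. by rewrite divr_ge0 ?(ltW disc_area_gt0)// mulr_ge0. Qed.

Lemma integral_wgt j :
  \int[leb2]_(p in @D2 R) ((1 - abs2 (Cx p)) * abs2 (Cx p) ^+ j)%:E = (wgt j)%:E.
Proof.
have mw : measurable_fun (@D2 R) (fun p : RM * RM => ((1 - abs2 (Cx p)) * abs2 (Cx p) ^+ j)%:E).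
  apply/measurable_EFinP; apply: measurable_funM; last by apply/measurable_EFinP; exact: (@mpow _ _).
  by apply: measurable_funB; [exact: measurable_cst|exact: measurable_abs2 (cmeas_Cx _)].
have w0 (p : RM * RM) : D2 p -> 0 <= ((1 - abs2 (Cx p)) * abs2 (Cx p) ^+ j)%:E.
  by rewrite D2E /= => /ltW; rewrite -subr_ge0 => p1; rewrite lee_fin; exact: mulr_ge0 p1 (exprn_ge0 _ (abs2_ge0 _)).
have H : disc_moment j = \int[leb2]_(p in @D2 R) ((1 - abs2 (Cx p)) * abs2 (Cx p) ^+ j)%:E + disc_moment j.+1.
  rewrite /disc_moment -(ge0_integralD _ measurable_D2 w0 mw (fun p _ => pow0 j.+1 p) (@mpow _ j.+1)).
  apply: eq_integral => p _; rewrite -EFinD; congr EFin; rewrite exprS; ring.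
move: H; rewrite !disc_momentE; set X := \int[_]_(_ in _) _.
have -> : (wgt j = disc_area / j.+1%:R - disc_area / j.+2%:R)%R.
  by rewrite /wgt -!natr1; field; rewrite !natr1 !pnatr_eq0.
have : 0 <= X by apply: integral_ge0.
case: X => [x| |]//= _; rewrite -EFinD => -[->]; congr EFin; ring.
Qed.

End Moments.

(** * Poisson integrals of squared moduli of power series *)

Section Bergman.
Context {R : realType}.
Local Notation leb := (@lebesgue_measure R).
Local Notation RM := (measurableTypeR R).
Local Notation leb2 := (leb \x leb)%E.
Local Notation normc := (@Normc.normc R).
Implicit Types (c : nat -> CC R) (z : CC R) (j : nat).

Lemma emul_cancel (k : R) (x y : \bar R) : k != 0 -> (k%:E * x = k%:E * y)%E -> x = y.
Proof.
move=> k0 H; have := congr1 (fun x => k^-1%:E * x)%E H.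
by rewrite /= !muleA -!EFinM mulVf// !mul1e.
Qed.

Lemma disc_ge0 z : disc z -> 0 <= 1 - abs2 z.
Proof. by move=> /disc_abs2 /ltW; rewrite subr_ge0. Qed.

Lemma cmeas_one_sub d (T : measurableType d) (D : set T) f :
  cmeas D f -> measurable_fun D (fun x => 1 - abs2 (f x) : R).
Proof.
by move=> mf; apply: measurable_funB; [exact: measurable_cst|exact: measurable_abs2].
Qed.

Local Open Scope ereal_scope.

(** The norm of the Bergman space with weight [1 - |z|^2]. After averaging over rotations,
    Parseval's identity acts on each circle and leaves the integrals of [integral_wgt]. *)
Lemma bergman c : tame c ->
  \int[leb2]_(p in @D2 R) ((1 - abs2 (Cx p)) * abs2 (pser c (Cx p)))%:E =
  \sum_(j <oo) (wgt j * abs2 (c j))%:E.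
Proof.
move=> tc; pose H z := ((1 - abs2 z) * abs2 (pser c z))%:E.
have mH : measurable_fun (@D2 R) (H \o Cx).
  apply/measurable_EFinP; apply: measurable_funM; first exact: cmeas_one_sub (cmeas_Cx _).
  apply: measurable_abs2.
  exact: (@cmeas_pser R _ _ (@D2 R) (fun n _ => c n) Cx (fun n => cmeas_cst _ (c n)) (fun _ _ => tc) (cmeas_Cx _) (fun p Dp => Dp)).
have H0 z : disc z -> 0 <= H z.
  by move=> zd; rewrite lee_fin; exact: mulr_ge0 (disc_ge0 zd) (abs2_ge0 _).
have tp := @twopi_gt0 R.
apply: (@emul_cancel (2 * pi)%R); first by rewrite gt_eqF.
rewrite (integral_disc_average mH H0).
pose f j (p : RM * RM) := ((abs2 (c j))%:E * ((1 - abs2 (Cx p)) * abs2 (Cx p) ^+ j)%:E).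
have f0 j p : D2 p -> 0 <= f j p.
  move=> pd; rewrite mule_ge0// lee_fin ?abs2_ge0//.
  exact: mulr_ge0 (disc_ge0 pd) (exprn_ge0 _ (abs2_ge0 _)).
have mw j : measurable_fun (@D2 R) (fun p : RM * RM => ((1 - abs2 (Cx p)) * abs2 (Cx p) ^+ j)%:E).
  apply/measurable_EFinP; apply: measurable_funM; first exact: cmeas_one_sub (cmeas_Cx _).
  by apply: measurable_funX; exact: measurable_abs2 (cmeas_Cx _).
have mf j : measurable_fun (@D2 R) (f j) by exact: measurable_funeM.
transitivity (\int[leb2]_(p in @D2 R) ((2 * pi)%:E * \sum_(j <oo) f j p)).
  apply: eq_integral => p /set_mem pd; set z := Cx p.
  have [M [q gz]] := tame_gboundz tc (pd : disc z).
  have HE t : H (cis t * z)%R = (1 - abs2 z)%:E * (abs2 (csum (fun j => c j * z ^+ j * cis (j%:R * t))%R))%:E.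
    rewrite /H abs2M abs2_cis mul1r -EFinM; congr (_ * abs2 _)%:E.
    by apply: csum_ext => n; rewrite exprMn cisX [(cis _ * _)%R]mulrC mulrA.
  under eq_integral do rewrite HE.
  have mI : measurable (`[0%R, (2 * pi)%R]%classic : set RM) by exact: measurable_itv.
  have mS : measurable_fun (`[0%R, (2 * pi)%R]%classic : set RM)
      (fun t => (abs2 (csum (fun j => c j * z ^+ j * cis (j%:R * t))%R))%:E).
    by apply: measurable_eabs2; apply: (csum_cis_cmeas gz); exact: measurable_id.
  have k0 : 0 <= (1 - abs2 z)%:E by rewrite lee_fin; exact: disc_ge0.
  rewrite (ge0_integralZl leb mI mS (fun t _ => _) k0); last by move=> t; rewrite lee_fin abs2_ge0.
  rewrite (parseval gz) muleCA; congr (_ * _).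
  rewrite -nneseriesZl; last by move=> j _; rewrite lee_fin abs2_ge0.
  apply: eq_eseriesr => j _; rewrite /f -!EFinM; congr EFin; rewrite abs2M abs2X; ring.
have k0 : 0 <= ((2 * pi)%R : R)%:E by rewrite lee_fin ltW.
have mS : measurable_fun (@D2 R) (fun p => \sum_(j <oo) f j p).
  by apply: (@ge0_emeasurable_sum _ _ _ _ f predT) => // k p Dp _; exact: f0.
rewrite (ge0_integralZl leb2 measurable_D2 mS (fun t Dt => nneseries_ge0 (fun j _ _ => f0 j t Dt)) k0).
congr (_ * _); rewrite (integral_nneseries leb2 measurable_D2 mf f0).
apply: eq_eseriesr => j _; rewrite /f.
have a0 : 0 <= (abs2 (c j))%:E by rewrite lee_fin abs2_ge0.
rewrite (ge0_integralZl leb2 measurable_D2 (mw j) _ a0); last first.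
  by move=> p pd; rewrite lee_fin; exact: mulr_ge0 (disc_ge0 pd) (exprn_ge0 _ (abs2_ge0 _)).
by rewrite integral_wgt -EFinM mulrC.
Qed.

Local Close Scope ereal_scope.

Definition ksum c (t : R) j : CC R := \sum_(m < j.+1) c m * cis (m%:R * t).
(** The coefficients of [pser c z / (1 - e^(-it) z)]: the convolution of [c] with a geometric
    sequence, from which the unimodular factor [e^(-ijt)] is pulled out. *)
Definition kcoef c t j : CC R := cis (- t) ^+ j * ksum c t j.

Lemma kcoef0 c t : kcoef c t 0 = c 0%N.
Proof. by rewrite /kcoef /ksum big_ord1 mul0r cis0 mulr1 expr0 mul1r. Qed.

Lemma kcoefS c t j : kcoef c t j.+1 = c j.+1 + cis (- t) * kcoef c t j.
Proof.
rewrite /kcoef /ksum big_ord_recr /= mulrDr addrC; congr (_ + _).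
  rewrite mulrCA -[RHS]mulr1; congr (_ * _).
  by rewrite cisX -cisD mulrN addrC subrr cis0.
by rewrite exprS mulrA.
Qed.

Lemma abs2_kcoef c t j : abs2 (kcoef c t j) = abs2 (ksum c t j).
Proof. by rewrite /kcoef abs2M abs2X abs2_cis expr1n mul1r. Qed.

Lemma tame_kcoef c t : tame c -> tame (kcoef c t).
Proof.
move=> tc r r01; have [M [q [M0 q01 H]]] := tame_gbound2 tc r01.
have /andP[r0 r1] := r01.
exists (M * (1 - q)^-1); split.
  by rewrite mulr_ge0// invr_ge0 subr_ge0; case/andP: q01 => _ /ltW.
move=> n; rewrite /kcoef Normc.normcM normc_X normc_cis expr1n mul1r.
apply: le_trans (ler_wpM2r (exprn_ge0 _ r0) (normc_sum _ _ _)) _.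
rewrite mulr_suml; apply: le_trans (_ : \sum_(i < n.+1) M * q ^+ i <= _); last first.
  by rewrite -mulr_sumr ler_wpM2l// geo_sum_le.
apply: ler_sum => i _; rewrite Normc.normcM normc_cis mulr1.
apply: le_trans (H i); rewrite -[leLHS]mulr1.
have ni : r ^+ n <= r ^+ i by apply: ler_wiXn2l => //; [exact: ltW|rewrite -ltnS].
apply: ler_pM; rewrite ?mulr_ge0 ?normc_ge0 ?exprn_ge0//.
  by rewrite ler_wpM2l ?normc_ge0.
by rewrite exprn_ege1// ler1n.
Qed.

(** The recursion [kcoefS] is the identity [h = g + e^(-it) z h] read on coefficients. *)
Lemma pser_kcoef c t z : tame c -> disc z ->
  pser (kcoef c t) z * (1 - cis (- t) * z) = pser c z.
Proof.
move=> tc zd; have tk := tame_kcoef t tc.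
have E : pser (kcoef c t) z = pser c z + z * cis (- t) * pser (kcoef c t) z.
  rewrite {1}(pserS tk zd) kcoef0 (pserS tc zd) -addrA; congr (_ + _).
  have -> : (fun n => kcoef c t n.+1) = (fun n => c n.+1 + cis (- t) * kcoef c t n).
    by apply/funext => j; exact: kcoefS.
  by rewrite (pserD (tameS tc) (tameZ _ tk) zd) (pserZ _ tk zd) mulrDr mulrA.
by rewrite mulrBr mulr1 {1}E; ring.
Qed.

Lemma kernel_mul c t z : tame c -> disc z ->
  abs2 (pser c z) * ((1 - abs2 z) / abs2 (polar 1 t - z)) =
  (1 - abs2 z) * abs2 (pser (kcoef c t) z).
Proof.
move=> tc zd; rewrite -(pser_kcoef t tc zd) abs2M.
have -> : polar 1 t - z = cis t * (1 - cis (- t) * z).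
  by rewrite polar1 mulrBr mulr1 mulrA cisN mulfV ?mul1r// cis_neq0.
rewrite abs2M abs2_cis mul1r.
have n0 : abs2 (1 - cis (- t) * z) != 0.
  rewrite /abs2 sqrf_eq0 gt_eqF// normc_gt0 subr_eq0; apply/eqP => E.
  have /discE zd1 := zd.
  have : normc (cis (- t) * z) = normc z by rewrite Normc.normcM normc_cis mul1r.
  by rewrite -E Normc.normc1 => E1; rewrite -E1 ltxx in zd1.
by set x := abs2 _ in n0 *; field.
Qed.

Local Open Scope ereal_scope.

Definition kint (nu : circle_measure R) c : \bar R :=
  \int[nu]_(t in `[0%R, (2 * pi)%R[) \sum_(j <oo) (wgt j * abs2 (ksum c t j))%:E.

Lemma cmeas_ksum d (T : measurableType d) (D : set T) c (f : T -> RM) j :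
  measurable_fun D f -> cmeas D (fun x => ksum c (f x) j).
Proof.
move=> mf; rewrite /ksum.
apply: (@cmeas_sum _ _ _ D (fun m x => c m * cis (m%:R * f x))%R) => m.
apply: cmeasM; first exact: cmeas_cst.
by apply: cmeas_cis; apply: measurable_funM => //; exact: measurable_cst.
Qed.

Lemma measurable_ksums c (D : set RM) :
  measurable_fun D (fun t : RM => \sum_(j <oo) (wgt j * abs2 (ksum c t j))%:E).
Proof.
apply: (@ge0_emeasurable_sum _ _ _ _ (fun j (t : RM) => (wgt j * abs2 (ksum c t j))%:E) predT).
  by move=> k t _ _; rewrite lee_fin mulr_ge0 ?wgt_ge0 ?abs2_ge0.
move=> k _; apply/measurable_EFinP; apply: measurable_funM; first exact: measurable_cst.
by apply: measurable_abs2; apply: cmeas_ksum; exact: measurable_id.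
Qed.

Lemma cmeas_fstCx (T : set RM) : cmeas (@D2 R `*` T) (fun x : (RM * RM) * RM => Cx x.1).
Proof.
have [m1 m2] := @cmeas_Cx R setT.
by split; apply: measurable_funTS; [exact: (measurableT_comp m1 measurable_fst)|exact: (measurableT_comp m2 measurable_fst)].
Qed.

Lemma measurable_kcoef (T0 : set RM) c : tame c ->
  measurable_fun (@D2 R `*` T0)
    (fun x : (RM * RM) * RM => ((1 - abs2 (Cx x.1)) * abs2 (pser (kcoef c x.2) (Cx x.1)))%:E).
Proof.
move=> tc; apply/measurable_EFinP; apply: measurable_funM; first exact: cmeas_one_sub (cmeas_fstCx _).
apply: measurable_abs2.
apply: (@cmeas_pser R _ _ (@D2 R `*` T0) (fun n x => kcoef c x.2 n) (fun x => Cx x.1)).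
- move=> n; apply: cmeasM; last by apply: cmeas_ksum; apply: measurable_funTS; exact: measurable_snd.
  apply: cmeasX; apply: cmeas_cis; apply: measurable_funTS.
  by apply: measurableT_comp; [exact: oppr_measurable|exact: measurable_snd].
- by move=> x _; exact: tame_kcoef.
- exact: cmeas_fstCx.
- by move=> x [].
Qed.

(** The constant function 1: with it the Poisson kernel itself becomes an instance of [kernel_mul],
    and its joint measurability follows from that of the series. *)
Definition one_coef : nat -> CC R := scons 1%R (fun=> 0%R).

Lemma tame_one : tame one_coef.
Proof. by apply: tame_scons; apply: (@tame_bounded R _ 0%R) => n; rewrite Normc.normc0. Qed.

Lemma pser_one z : disc z -> pser one_coef z = 1%R.
Proof.
move=> zd; rewrite pser_scons//; last by apply: (@tame_bounded R _ 0%R) => n; rewrite Normc.normc0.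
rewrite /pser; under csum_ext do rewrite mul0r.
by rewrite csum0 mulr0 addr0.
Qed.

Lemma poisson_kernel t z : disc z ->
  ((1 - abs2 z) / abs2 (polar 1 t - z) = (1 - abs2 z) * abs2 (pser (kcoef one_coef t) z))%R.
Proof.
have a1 : abs2 (1%R : CC R) = 1%R by rewrite -(abs2_cis 0) cis0.
by move=> zd; rewrite -(kernel_mul _ tame_one zd) (pser_one zd) a1 mul1r.
Qed.

Lemma poisson_ge0 (nu : circle_measure R) z : disc z -> 0 <= poisson nu z.
Proof.
move=> zd; rewrite /poisson mule_ge0//; first by rewrite lee_fin invr_ge0 ltW// twopi_gt0.
by apply: integral_ge0 => t _; rewrite lee_fin divr_ge0 ?abs2_ge0// disc_ge0.
Qed.

Lemma measurable_poisson (nu : circle_measure R) :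
  measurable_fun (@D2 R) (fun p => poisson nu (Cx p)).
Proof.
pose T0 := `[0%R, (2 * pi)%R[%classic : set RM.
have mT : measurable T0 by exact: measurable_itv.
pose G (p : RM * RM) (t : RM) := ((1 - abs2 (Cx p)) * abs2 (pser (kcoef one_coef t) (Cx p)))%:E.
have G0 p t : D2 p -> T0 t -> 0 <= G p t.
  by move=> pd _; rewrite lee_fin; exact: mulr_ge0 (disc_ge0 pd) (abs2_ge0 _).
have mI := @measurable_integral_on R _ _ _ _ nu _ _ _ measurable_D2 mT (measurable_kcoef (T0 := T0) tame_one) G0.
apply: measurable_funeM; apply: eq_measurable_fun mI => p /set_mem pd.
by apply: eq_integral => t _; rewrite poisson_kernel.
Qed.

(** Tonelli exchanges area and [nu]; at fixed [t], the kernel times the squared modulus is the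
    integrand of [bergman] for the coefficients [kcoef c t]. *)
Lemma area_poisson (nu : circle_measure R) c : tame c ->
  area_int (fun z => (abs2 (pser c z))%:E * poisson nu z) =
  (pi^-1)%:E * ((2 * pi)^-1)%:E * kint nu c.
Proof.
move=> tc; rewrite /area_int -muleA; congr (_ * _).
have tp := @twopi_gt0 R.
pose T0 := `[0%R, (2 * pi)%R[%classic : set RM.
have mT : measurable T0 by exact: measurable_itv.
pose G (p : RM * RM) (t : RM) := ((1 - abs2 (Cx p)) * abs2 (pser (kcoef c t) (Cx p)))%:E.
have G0 p t : D2 p -> T0 t -> 0 <= G p t.
  by move=> pd _; rewrite lee_fin; exact: mulr_ge0 (disc_ge0 pd) (abs2_ge0 _).
have mG : measurable_fun (@D2 R `*` T0) (fun x => G x.1 x.2) := measurable_kcoef (T0 := T0) tc.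
have mGp c' p : tame c' -> D2 p ->
    measurable_fun T0 (fun t => ((1 - abs2 (Cx p)) * abs2 (pser (kcoef c' t) (Cx p)))%:E).
  move=> tc' pd; apply/measurable_EFinP; apply: measurable_funM; first exact: measurable_cst.
  apply: measurable_abs2.
  apply: (@cmeas_pser R _ _ T0 (fun n t => kcoef c' t n) (fun=> Cx p)).
  - move=> n; apply: cmeasM; last by apply: cmeas_ksum; exact: measurable_id.
    by apply: cmeasX; apply: cmeas_cis; exact: oppr_measurable.
  - by move=> t _; exact: tame_kcoef.
  - exact: cmeas_cst.
  - by move=> t _; exact: pd.
have k0 : 0 <= ((2 * pi)^-1%R : R)%:E by rewrite lee_fin invr_ge0 ltW.
transitivity (\int[leb2]_(p in @D2 R) (((2 * pi)^-1)%:E * \int[nu]_(t in T0) G p t)).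
  apply: eq_integral => p /set_mem pd; rewrite /poisson muleCA; congr (_ * _).
  have a0 : 0 <= (abs2 (pser c (Cx p)))%:E by rewrite lee_fin abs2_ge0.
  have E t : (abs2 (pser c (Cx p)))%:E * ((1 - abs2 (Cx p)) / abs2 (polar 1 t - Cx p))%:E = G p t.
    by rewrite -EFinM kernel_mul.
  rewrite -(ge0_integralZl nu mT _ _ a0).
  - by apply: eq_integral => t _; exact: E.
  - apply: eq_measurable_fun (mGp _ p tame_one pd) => t _.
    by rewrite poisson_kernel.
  - by move=> t _; rewrite lee_fin divr_ge0 ?abs2_ge0//; exact: disc_ge0.
have mI := @measurable_integral_on R _ _ _ _ nu _ _ _ measurable_D2 mT mG G0.
rewrite (ge0_integralZl leb2 measurable_D2 mI _ k0); last first.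
  by move=> p pd; apply: integral_ge0 => t tt; exact: G0.
congr (_ * _).
transitivity (\int[nu]_(t in T0) \int[leb2]_(p in @D2 R) G p t).
  exact: (@tonelli_on R _ _ (RM * RM)%type RM (@lebesgue2 R) nu _ _ G measurable_D2 mT mG G0).
apply: eq_integral => t _; rewrite (bergman (tame_kcoef t tc)).
by apply: eq_eseriesr => j _; rewrite abs2_kcoef.
Qed.

End Bergman.

(** * Inequalities between coefficients *)

Section Coefficients.
Context {R : realType}.
Local Notation disc_area := (@disc_area R).
Implicit Types (u v : nat -> CC R) (t : R) (j n m : nat).

(** Offsets: [NN v j] runs over the indices 1 to [j], [SS v j] over 0 to [j], and [qq v j] uses
    [NN v j.+1], which matches the partial sum [ksum] of index [j] of the derivative. *)
Definition NN v j : CC R := \sum_(m < j) m.+1%:R * v m.+1.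
Definition SS v j : CC R := \sum_(m < j.+1) v m.
Definition qq v j : R := abs2 (NN v j.+1) / (j.+1%:R * j.+2%:R).
Definition QQ v n : R := \sum_(j < n) qq v j.
(** Absorbs the point [t] of the circle into the coefficients, so that the estimates concern plain
    partial sums. *)
Definition twist t u m : CC R := u m * cis (m%:R * t).

Lemma NN0 v : NN v 0 = 0. Proof. by rewrite /NN big_ord0. Qed.
Lemma NNS v j : NN v j.+1 = NN v j + j.+1%:R * v j.+1.
Proof. by rewrite /NN big_ord_recr. Qed.
Lemma SS0 v : SS v 0 = v 0%N. Proof. by rewrite /SS big_ord1. Qed.
Lemma SSS v j : SS v j.+1 = SS v j + v j.+1.
Proof. by rewrite /SS big_ord_recr. Qed.
Lemma QQS v n : QQ v n.+1 = QQ v n + qq v n.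
Proof. by rewrite /QQ big_ord_recr. Qed.

Lemma qq_ge0 v j : 0 <= qq v j.
Proof. by rewrite /qq divr_ge0 ?abs2_ge0// mulr_ge0. Qed.

Lemma QQ_ge0 v n : 0 <= QQ v n.
Proof. by rewrite /QQ sumr_ge0// => j _; exact: qq_ge0. Qed.

Lemma QQ_le v n k : (n <= k)%N -> QQ v n <= QQ v k.
Proof.
move=> /subnK <-; elim: (k - n)%N => [|i IH]; first by rewrite add0n.
by rewrite addSn QQS; apply: le_trans IH _; rewrite lerDl qq_ge0.
Qed.

Lemma natS_neq0 j : (j.+1%:R : CC R) != 0.
Proof. by rewrite -normc_gt0 normc_natr ltr0n. Qed.

Lemma abs2_div_natr z j : abs2 (z / j.+1%:R : CC R) = abs2 z / j.+1%:R ^+ 2.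
Proof.
have E : abs2 (z / j.+1%:R) * j.+1%:R ^+ 2 = abs2 z.
  by rewrite -abs2_natr -abs2M divfK// natS_neq0.
by rewrite -E mulfK// expf_eq0 /= pnatr_eq0.
Qed.

(* summation by parts *)
Lemma SS_NN v j : SS v j - v 0%N =
  NN v j / j.+1%:R + \sum_(m < j) NN v m.+1 / (m.+1%:R * m.+2%:R).
Proof.
elim: j => [|j IH]; first by rewrite SS0 NN0 big_ord0 subrr mul0r addr0.
rewrite SSS big_ord_recr /= addrAC IH NNS.
set X := \sum_(m < j) _; have h1 := natS_neq0 j; have h2 := natS_neq0 j.+1.
have E : (j.+2%:R : CC R) = j.+1%:R + 1 by rewrite natr1.
move: (NN v j) (v j.+1) X => a b X; move: h1 h2; rewrite E.
by move: (j.+1%:R : CC R) => x h1 h2; field; rewrite h1 h2.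
Qed.

(** Inductive step of the weighted Cauchy-Schwarz inequality; [W] and [Q] are the sums of weights
    and of weighted squares so far. It comes down to [2 a n <= Q + W n^2], which after
    multiplication by [W] is the hypothesis plus the square of [a - W n]; the case [W = 0] forces
    [a = 0]. *)
Lemma cauchy_schwarz_step (a n w W Q : R) : 0 <= w -> 0 <= W -> 0 <= Q -> a ^+ 2 <= W * Q ->
  (a + w * n) ^+ 2 <= (W + w) * (Q + w * n ^+ 2).
Proof.
move=> w0 W0 Q0 aWQ.
suff H : 2 * a * n <= Q + W * n ^+ 2.
  rewrite -subr_ge0; have -> : (W + w) * (Q + w * n ^+ 2) - (a + w * n) ^+ 2 =
    (W * Q - a ^+ 2) + w * (Q + W * n ^+ 2 - 2 * a * n) by ring.
  by rewrite addr_ge0 ?mulr_ge0// subr_ge0.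
have [W00|Wn] := eqVneq W 0.
  have a0 : a = 0.
    by apply/eqP; rewrite -sqrf_eq0 eq_le sqr_ge0 andbT; move: aWQ; rewrite W00 mul0r.
  by rewrite W00 a0 !mul0r mulr0 mul0r addr0.
have Wp : 0 < W by rewrite lt_neqAle eq_sym Wn.
rewrite -(ler_pM2l Wp) -subr_ge0.
have -> : W * (Q + W * n ^+ 2) - W * (2 * a * n) = (W * Q - a ^+ 2) + (a - W * n) ^+ 2 by ring.
by rewrite addr_ge0 ?sqr_ge0// subr_ge0.
Qed.

Lemma abs2_step (A N : CC R) (k : nat) (W Q : R) : 0 <= W -> 0 <= Q -> abs2 A <= W * Q ->
  abs2 (A + N / (k.+1%:R * k.+2%:R)) <=
  (W + (k.+1%:R * k.+2%:R)^-1) * (Q + abs2 N / (k.+1%:R * k.+2%:R)).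
Proof.
move=> W0 Q0 H; set w := (k.+1%:R * k.+2%:R)^-1 : R.
have w0 : 0 <= w by rewrite invr_ge0 mulr_ge0.
have nN : Normc.normc (N / (k.+1%:R * k.+2%:R)) = w * Normc.normc N.
  apply: (@mulIf _ ((k.+1%:R * k.+2%:R) : R)); first by rewrite mulf_neq0// pnatr_eq0.
  rewrite mulrAC /w mulVf ?mul1r ?mulf_neq0 ?pnatr_eq0//.
  rewrite -[in LHS](normc_natr k.+1) -[in LHS](normc_natr k.+2) -!Normc.normcM divfK//.
have := cauchy_schwarz_step (Normc.normc N) w0 W0 Q0 H; rewrite -/(abs2 N) mulrC [w * abs2 N]mulrC mulrC.
apply: le_trans; rewrite /abs2 lerXn2r ?nnegrE ?normc_ge0 ?addr_ge0 ?mulr_ge0 ?normc_ge0//.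
by rewrite -nN normcD.
Qed.

(** The weights [1 / ((m + 1) (m + 2))] telescope to [1 - 1 / (j + 1)], the first factor in
    Cauchy-Schwarz. *)
Lemma abs2_tail v j : abs2 (\sum_(m < j) NN v m.+1 / (m.+1%:R * m.+2%:R)) <=
  (1 - j.+1%:R^-1) * QQ v j.
Proof.
elim: j => [|j IH]; first by rewrite big_ord0 abs2_0 /QQ big_ord0 mulr0.
have W0 : 0 <= 1 - j.+1%:R^-1 :> R by rewrite subr_ge0 invf_le1 ?ltr0n// ler1n.
rewrite big_ord_recr /= QQS; apply: le_trans (abs2_step (NN v j.+1) j W0 (QQ_ge0 v j) IH) _.
rewrite le_eqVlt; apply/orP; left; apply/eqP; congr (_ * _).
have E : (j.+2%:R : R) = j.+1%:R + 1 by rewrite natr1.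
have h1 : (j.+1%:R : R) != 0 by rewrite pnatr_eq0.
have h2 : (j.+2%:R : R) != 0 by rewrite pnatr_eq0.
move: h1 h2; rewrite E; move: (j.+1%:R : R) => x h1 h2; field; by rewrite h1 h2.
Qed.

Lemma qq_ge v j : abs2 (NN v j.+1) / j.+2%:R ^+ 2 <= qq v j.
Proof.
rewrite /qq ler_wpM2l ?abs2_ge0// lef_pV2 ?posrE ?mulr_gt0 ?exprn_gt0 ?ltr0n//.
by rewrite expr2 ler_wpM2r// ler_nat.
Qed.

(** [4 = 2 + 2]: the boundary term of the summation by parts is at most the last [qq], the remaining
    sum at most [QQ v j], and [abs2_le2] doubles both. *)
Lemma abs2_SS v j : abs2 (SS v j - v 0%N) <= 4 * QQ v j.
Proof.
rewrite SS_NN; apply: le_trans (abs2_le2 _ _) _.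
have -> : 4 * QQ v j = 2 * QQ v j + 2 * QQ v j by ring.
apply: lerD; rewrite ler_wpM2l//.
  case: j => [|j]; first by rewrite NN0 mul0r abs2_0 QQ_ge0.
  rewrite abs2_div_natr; apply: le_trans (qq_ge v j) _.
  by rewrite QQS lerDr QQ_ge0.
apply: le_trans (abs2_tail v j) _; by rewrite ler_piMl ?QQ_ge0// lerBlDr lerDl invr_ge0.
Qed.

Lemma abs2_SS' v j : abs2 (SS v j) <= 2 * abs2 (v 0%N) + 8 * QQ v j.
Proof.
rewrite -{1}(subrK (v 0%N) (SS v j)); apply: le_trans (abs2_le2 _ _) _.
rewrite addrC lerD2l; have -> : 8 * QQ v j = 2 * (4 * QQ v j) by ring.
by rewrite ler_wpM2l// abs2_SS.
Qed.

Lemma sum_inv n : \sum_(j < n) (j.+1%:R * j.+2%:R)^-1 = 1 - n.+1%:R^-1 :> R.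
Proof.
elim: n => [|n IH]; first by rewrite big_ord0 invr1 subrr.
rewrite big_ord_recr /= IH.
have E : (n.+2%:R : R) = n.+1%:R + 1 by rewrite natr1.
have h1 : (n.+1%:R : R) != 0 by rewrite pnatr_eq0.
have h2 : (n.+2%:R : R) != 0 by rewrite pnatr_eq0.
move: h1 h2; rewrite E; move: (n.+1%:R : R) => x h1 h2; field; by rewrite h1 h2.
Qed.

Lemma sum_inv_le1 n : \sum_(j < n) (j.+1%:R * j.+2%:R)^-1 <= 1 :> R.
Proof. by rewrite sum_inv lerBlDr lerDl invr_ge0. Qed.

Lemma invM_decr j : (j.+2%:R * j.+3%:R)^-1 <= (j.+1%:R * j.+2%:R)^-1 :> R.
Proof.
rewrite lef_pV2 ?posrE ?mulr_gt0 ?ltr0n//.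
by rewrite [leLHS]mulrC ler_wpM2l// ler_nat leqW.
Qed.

Lemma sum_NN_prev v n : \sum_(j < n.+1) abs2 (NN v j) / (j.+1%:R * j.+2%:R) <= QQ v n.
Proof.
elim: n => [|n IH]; first by rewrite big_ord1 NN0 abs2_0 mul0r QQ_ge0.
rewrite big_ord_recr /= QQS lerD// /qq ler_wpM2l ?abs2_ge0//; exact: invM_decr.
Qed.

(** Consecutive weights have the quotient [(j + 3) / (j + 1)], which is at most 3, with equality at
    [j = 0]. *)
Lemma sum_NN_next v n : \sum_(j < n) abs2 (NN v j.+2) / (j.+1%:R * j.+2%:R) <= 3 * QQ v n.+1.
Proof.
elim: n => [|n IH]; first by rewrite big_ord0 mulr_ge0// QQ_ge0.
rewrite big_ord_recr /= QQS (mulrDr 3) lerD// /qq mulrCA ler_wpM2l ?abs2_ge0//.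
have x0 : 0 <= (n%:R : R) by exact: ler0n.
have -> : (n.+1%:R = n%:R + 1 :> R) by rewrite natr1.
have -> : (n.+2%:R = n%:R + 2 :> R) by rewrite -addn2 natrD.
have -> : (n.+3%:R = n%:R + 3 :> R) by rewrite -addn3 natrD.
move: (n%:R : R) x0 => x x0.
rewrite ler_pdivlMr; last by rewrite mulr_gt0//; lra.
by rewrite ler_pdivrMl; [nra|rewrite mulr_gt0//; lra].
Qed.

Definition PP u t n : R := \sum_(j < n) abs2 (ksum (dcoef u) t j) / (j.+1%:R * j.+2%:R).

Lemma cisS t m : cis (m.+1%:R * t) = cis t * cis (m%:R * t).
Proof. by rewrite -natr1 mulrDl mul1r cisD mulrC. Qed.

Lemma NN_ksum u t j : NN (twist t u) j.+1 = cis t * ksum (dcoef u) t j.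
Proof.
rewrite /NN /ksum mulr_sumr; apply: eq_bigr => m _.
rewrite /twist /dcoef cisS; ring.
Qed.

Lemma PP_QQ u t n : PP u t n = QQ (twist t u) n.
Proof.
apply: eq_bigr => j _; rewrite /qq NN_ksum abs2M abs2_cis mul1r; reflexivity.
Qed.

Lemma twist0 t u : twist t u 0 = u 0%N.
Proof. by rewrite /twist mul0r cis0 mulr1. Qed.

Lemma twist_scons t u m : twist t (scons 0 u) m.+1 = cis t * twist t u m.
Proof. by rewrite /twist cisS [scons _ _ _]/= mulrCA. Qed.

Lemma twist_unshift t u m : cis t * twist t (fun m => u m.+1) m = twist t u m.+1.
Proof. by rewrite /twist cisS mulrCA. Qed.

(** After the shift [v m] carries the factor [m + 1], and the sum of [(m + 1) v m] splits into [N_j]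
    and [S_j]. *)
Lemma NN_shift u t j : NN (twist t (scons 0 u)) j.+1 =
  cis t * (NN (twist t u) j + SS (twist t u) j).
Proof.
elim: j => [|j IH].
  by rewrite NNS !NN0 SS0 !add0r mul1r twist_scons.
rewrite NNS IH twist_scons NNS SSS.
have -> : (j.+2%:R : CC R) = j.+1%:R + 1 by rewrite natr1.
ring.
Qed.

(** Here [v m.+1] carries [m = (m + 1) - 1]; the partial sum subtracted starts at index 1, so the
    constant coefficient cancels. *)
Lemma NN_unshift u t j : cis t * NN (twist t (fun m => u m.+1)) j =
  NN (twist t u) j.+1 - (SS (twist t u) j.+1 - twist t u 0).
Proof.
elim: j => [|j IH].
  by rewrite NNS !NN0 SSS SS0; ring.
rewrite NNS mulrDr IH mulrCA twist_unshift [in RHS]NNS [in RHS]SSS.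
have -> : (j.+2%:R : CC R) = j.+1%:R + 1 by rewrite natr1.
ring.
Qed.

(** [18 = 2 + 2 * 8] and [4 = 2 * 2]: [abs2_le2] doubles the part of [N_j] and the bound of
    [abs2_SS'] for [S_j]. The latter is made uniform in [j] and summed against weights of total at
    most 1. *)
Lemma PP_shift u t n : PP (scons 0 u) t n <= 18 * PP u t n + 4 * abs2 (u 0%N).
Proof.
rewrite !PP_QQ; set v := twist t u; set Q := QQ v n.
have Q0 : 0 <= Q := QQ_ge0 v n.
have a0 : 0 <= abs2 (u 0%N) := abs2_ge0 _.
have H (j : 'I_n) : qq (twist t (scons 0 u)) j <=
    2 * (abs2 (NN v j) / (j.+1%:R * j.+2%:R)) +
    (4 * abs2 (u 0%N) + 16 * Q) * (j.+1%:R * j.+2%:R)^-1.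
  rewrite /qq NN_shift abs2M abs2_cis mul1r mulrA -mulrDl ler_wpM2r ?invr_ge0 ?mulr_ge0//.
  apply: le_trans (abs2_le2 _ _) _; rewrite lerD2l.
  have jn : QQ v j <= Q by apply: QQ_le; exact: ltnW.
  have := abs2_SS' v j; rewrite [v 0%N](twist0 t u) => S.
  have -> : 4 * abs2 (u 0%N) + 16 * Q = 2 * (2 * abs2 (u 0%N) + 8 * Q) by ring.
  rewrite ler_wpM2l//; apply: le_trans S _; rewrite lerD2l ler_wpM2l//.
have HS := ler_sum (index_enum 'I_n) (P := predT) (fun (j : 'I_n) _ => H j).
apply: le_trans HS _.
rewrite big_split /= -!mulr_sumr.
have -> : 18 * Q + 4 * abs2 (u 0%N) = 2 * Q + (4 * abs2 (u 0%N) + 16 * Q) * 1 by ring.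
apply: lerD; last by rewrite ler_wpM2l ?sum_inv_le1// addr_ge0// mulr_ge0.
rewrite ler_wpM2l//; apply: le_trans (sum_NN_prev v n).
by rewrite big_ord_recr /= lerDl divr_ge0 ?abs2_ge0// mulr_ge0.
Qed.

(** [14 = 2 * 3 + 2 * 4], from [sum_NN_next] and [abs2_SS]. The sums [N_(j+2)] with [j < n] reach
    one index further, hence [n.+1] on the right. *)
Lemma PP_unshift u t n : PP (fun m => u m.+1) t n <= 14 * PP u t n.+1.
Proof.
rewrite !PP_QQ; set v := twist t u; set Q := QQ v n.+1.
have Q0 : 0 <= Q := QQ_ge0 v n.+1.
have H (j : 'I_n) : qq (twist t (fun m => u m.+1)) j <=
    2 * (abs2 (NN v j.+2) / (j.+1%:R * j.+2%:R)) + 8 * Q * (j.+1%:R * j.+2%:R)^-1.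
  have E : abs2 (NN (twist t (fun m => u m.+1)) j.+1) =
      abs2 (cis t * NN (twist t (fun m => u m.+1)) j.+1) by rewrite abs2M abs2_cis mul1r.
  rewrite /qq E NN_unshift.
  rewrite mulrA -mulrDl ler_wpM2r ?invr_ge0 ?mulr_ge0//.
  apply: le_trans (abs2_le2 _ _) _; rewrite lerD2l abs2N.
  have jn : QQ v j.+2 <= Q by apply: QQ_le; rewrite ltnS ltn_ord.
  have -> : 8 * Q = 2 * (4 * Q) by ring.
  rewrite ler_wpM2l//; apply: le_trans (abs2_SS v j.+2) _; rewrite ler_wpM2l//.
have HS := ler_sum (index_enum 'I_n) (P := predT) (fun (j : 'I_n) _ => H j).
apply: le_trans HS _.
rewrite big_split /= -!mulr_sumr.
have -> : 14 * Q = 2 * (3 * Q) + 8 * Q * 1 by ring.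
by apply: lerD; rewrite ler_wpM2l ?sum_inv_le1 ?sum_NN_next// mulr_ge0.
Qed.

(** Up to a unimodular factor, [(m + 1) u_(m+1)] is [N_(m+1) - N_m]. With
    [1 / (m + 1)^2 <= 2 / ((m + 1) (m + 2))] each of the two sums costs 4. *)
Lemma sum_abs2_PP u t n : \sum_(m < n) abs2 (u m.+1) <= 8 * PP u t n.
Proof.
rewrite PP_QQ; set v := twist t u.
have H (m : 'I_n) : abs2 (u m.+1) <=
    4 * qq v m + 2 * (2 * (abs2 (NN v m) / (m.+1%:R * m.+2%:R))).
  have mm : 0 <= (m%:R : R) by exact: ler0n.
  have E : abs2 (u m.+1) * m.+1%:R ^+ 2 = abs2 (NN v m.+1 - NN v m).
    by rewrite NNS addrAC subrr add0r /v /twist abs2M abs2M abs2_cis mulr1 abs2_natr mulrC.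
  have := abs2_le2 (NN v m.+1) (- NN v m); rewrite abs2N -E /qq.
  have a0 := abs2_ge0 (NN v m.+1); have b0 := abs2_ge0 (NN v m).
  move: (abs2 (NN v m.+1)) (abs2 (NN v m)) (abs2 (u m.+1)) a0 b0 => a b x a0 b0.
  have -> : (m.+1%:R = m%:R + 1 :> R) by rewrite natr1.
  have -> : (m.+2%:R = m%:R + 2 :> R) by rewrite -addn2 natrD.
  move: (m%:R : R) mm => y y0 H.
  have y1 : 0 < y + 1 by lra.
  have y2 : 0 < (y + 1) * (y + 2) by rewrite mulr_gt0//; lra.
  have -> : 4 * (a / ((y + 1) * (y + 2))) + 2 * (2 * (b / ((y + 1) * (y + 2)))) =
     (4 * a + 4 * b) / ((y + 1) * (y + 2)) by field; apply/andP; split; rewrite gt_eqF//; lra.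
  rewrite ler_pdivlMr// -(ler_pM2r y1).
  have -> : x * ((y + 1) * (y + 2)) * (y + 1) = (x * (y + 1) ^+ 2) * (y + 2) by ring.
  have y2' : 0 <= y + 2 by lra.
  apply: le_trans (ler_wpM2r y2' H) _.
  rewrite -subr_ge0.
  have -> : (4 * a + 4 * b) * (y + 1) - (2 * a + 2 * b) * (y + 2) = 2 * y * (a + b) by ring.
  by rewrite !mulr_ge0// addr_ge0.
have HS := ler_sum (index_enum 'I_n) (P := predT) (fun (j : 'I_n) _ => H j).
apply: le_trans HS _; rewrite big_split /= -!mulr_sumr -/(QQ v n).
have Hp : \sum_(j < n) abs2 (NN v j) / (j.+1%:R * j.+2%:R) <= QQ v n.
  apply: le_trans (sum_NN_prev v n).
  by rewrite big_ord_recr /= lerDl divr_ge0 ?abs2_ge0// mulr_ge0.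
have -> : 8 * QQ v n = 4 * QQ v n + 2 * (2 * QQ v n) by ring.
by rewrite lerD2l !ler_wpM2l.
Qed.

End Coefficients.

(** * The functionals in terms of coefficients *)

Section Abel.
Context {R : realType}.
Local Open Scope ereal_scope.

Lemma abel_le (x s : \bar R) k : 0 <= x ->
  (forall r : R, (0 < r < 1)%R -> (r ^+ k)%:E * x <= s) -> x <= s.
Proof.
move=> x0 H; case: s H => [s| |] H; last 2 first.
- by rewrite leey.
- have := H (2^-1)%R; rewrite invr_gt0 ltr0n invf_lt1 ?ltr0n// ltr1n => /(_ isT).
  by move=> /le_trans/(_ (leNye 0)) => ?; have := H (2^-1)%R; rewrite invr_gt0 ltr0n invf_lt1 ?ltr0n// ltr1n => /(_ isT) /(le_trans _) => /(_ 0); rewrite mule_ge0 ?lee_fin ?exprn_ge0 ?invr_ge0// => /(_ isT).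
case: x x0 H => [x| |]// x0 H; last first.
  have := H (2^-1)%R; rewrite invr_gt0 ltr0n invf_lt1 ?ltr0n// ltr1n => /(_ isT).
  by rewrite gt0_muley ?lte_fin ?exprn_gt0 ?invr_gt0 ?ltr0n.
rewrite lee_fin; apply: (@le_eps_limit R x s k) => // e e01.
have r01 : (0 < 1 - e < 1)%R by move/andP: e01 => [? ?]; apply/andP; split; lra.
have := H _ r01; rewrite -EFinM lee_fin; apply: le_trans.
by rewrite mulrC ler_wpM2r// bernoulli.
Qed.

Lemma pow_split (r : R) n N : (0 < r < 1)%R -> (n <= N)%N -> (r ^+ N <= r ^+ n)%R.
Proof. by move=> /andP[r0 r1] nN; apply: ler_wiXn2l => //; exact: ltW. Qed.

(** In the partial sum of the first [N] terms all factors [r ^ (2 n)] are at least [r ^ (2 N)], and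
    this common factor is removed by [abel_le]. *)
Lemma abel_sum_le (u : nat -> \bar R) s : (forall n, 0 <= u n) ->
  (forall r : R, (0 < r < 1)%R -> \sum_(n <oo) ((r ^+ 2) ^+ n)%:E * u n <= s) ->
  \sum_(n <oo) u n <= s.
Proof.
move=> u0 H; apply: lime_le; first by apply: is_cvg_nneseries => n _ _; exact: u0.
apply: nearW => N; rewrite big_mkord.
apply: (@abel_le _ _ (2 * N)); first by apply: sume_ge0.
move=> r r01; apply: le_trans (H r r01); have /andP[r0 r1] := r01.
rewrite ge0_sume_distrr//.
apply: (@le_trans _ _ (\sum_(0 <= n < N) ((r ^+ 2) ^+ n)%:E * u n)); last first.
  by apply: nneseries_lim_ge => n _ _; rewrite mule_ge0// lee_fin !exprn_ge0// ltW.
rewrite big_mkord; apply: lee_sum => n _; apply: lee_wpmul2r => //.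
by rewrite lee_fin -exprM pow_split// leq_mul2l ltnW.
Qed.

Lemma abel_sum_ge (u : nat -> \bar R) (r : R) : (forall n, 0 <= u n) -> (0 <= r < 1)%R ->
  \sum_(n <oo) ((r ^+ 2) ^+ n)%:E * u n <= \sum_(n <oo) u n.
Proof.
move=> u0 /andP[r0 r1]; apply: lee_nneseries => n.
  by rewrite mule_ge0// lee_fin !exprn_ge0.
rewrite -[leRHS]mul1e => _; apply: lee_wpmul2r => //.
by rewrite lee_fin -exprM exprn_ile1// ltW.
Qed.

(** The sum increases with [r]. Reflecting [r] to [- r] turns the left limit at 1 into a right limit
    at -1 of a nonincreasing function, that is, into a supremum, whether finite or not. *)
Lemma lim_abel (u : nat -> \bar R) (F : R -> \bar R) : (forall n, 0 <= u n) ->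
  (forall r : R, (0 < r < 1)%R -> F r = \sum_(n <oo) ((r ^+ 2) ^+ n)%:E * u n) ->
  lim (F @ 1^'-) = \sum_(n <oo) u n.
Proof.
move=> u0 FE; apply: cvg_lim => //.
apply/cvg_at_leftNP.
have h01 : (BRight (-1)%R < BLeft (0%R : R))%O by rewrite bnd_simp ltrN10.
have D (x : R) : (x \in Interval (BRight (-1)) (BLeft 0))%R = (0 < - x < 1)%R.
  by rewrite in_itv /= oppr_gt0 ltrNl andbC.
have ni : {in Interval (BRight (-1)%R) (BLeft (0%R : R)) &, nonincreasing_fun (F \o -%R)%R}.
  move=> x y; rewrite !D => xi yi xy /=; rewrite !FE//.
  have /andP[y0 y1] := yi; have /andP[x0 x1] := xi.
  apply: lee_nneseries => n; first by rewrite mule_ge0// lee_fin !exprn_ge0// ltW.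
  move=> _; apply: lee_wpmul2r => //; rewrite lee_fin lerXn2r ?nnegrE ?exprn_ge0 ?(ltW x0) ?(ltW y0)//.
  by rewrite lerXn2r ?nnegrE ?(ltW x0) ?(ltW y0)// lerN2.
have := nonincreasing_at_right_cvge _ h01 ni; congr (_ --> _).
apply/eqP; rewrite eq_le; apply/andP; split.
  apply: ge_ereal_sup => y [x /=]; rewrite D => xi <-; rewrite /= FE//.
  by apply: abel_sum_ge => //; case/andP: xi => /ltW -> ->.
apply: abel_sum_le => // r r01; rewrite -FE//; apply: ereal_sup_ubound.
by exists (- r)%R; rewrite /= ?D opprK.
Qed.

(** The factor may be [+oo], so that the value of a Poisson integral can be moved across a series
    without a proof of finiteness. *)
Lemma ge0_nneseriesZl (u : nat -> \bar R) (k : \bar R) : 0 <= k -> (forall n, 0 <= u n) ->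
  k * \sum_(n <oo) u n = \sum_(n <oo) k * u n.
Proof.
move=> k0 u0; case: k k0 => [k| |]//; first by rewrite nneseriesZl.
move=> _; have [[n un]|H] := pselect (exists n, u n != 0).
  have un0 : 0 < u n by rewrite lt_neqAle eq_sym un u0.
  have ku0 m : true -> 0 <= +oo * u m by move=> _; exact: mule_ge0.
  rewrite (@nneseries_pinfty _ (fun n => +oo * u n) predT n ku0 isT (gt0_mulye un0)).
  rewrite gt0_mulye//; apply: lt_le_trans un0 _.
  apply: le_trans (nneseries_lim_ge n.+1 (fun m _ _ => u0 m)).
  by rewrite big_nat_recr//= leeDr// sume_ge0.
have z n : u n = 0 by apply/eqP; apply: contrapT => /negP un; apply: H; exists n.
rewrite !eseries0 ?mule0// => n _ _; by rewrite z mule0.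
Qed.

Lemma nneseriesS (u : nat -> \bar R) : (forall n, 0 <= u n) ->
  \sum_(n <oo) u n = u 0%N + \sum_(n <oo) u n.+1.
Proof.
move=> u0; rewrite (nneseries_recl (fun n _ => u0 n))//; congr (_ + _).
by rewrite -(nneseries_addn 1 u0); apply: eq_eseriesr => n _; rewrite addn1.
Qed.

End Abel.

Section Functionals.
Context {R : realType}.
Local Notation leb := (@lebesgue_measure R).
Local Notation RM := (measurableTypeR R).
Local Notation leb2 := (leb \x leb)%E.
Implicit Types (c : nat -> CC R) (a b : nat -> nat -> CC R) (f : CC R * CC R -> CC R).

Lemma polarX (r t : R) n : polar r t ^+ n = Complex r 0 ^+ n * cis (n%:R * t).
Proof. by rewrite polarE exprMn cisX. Qed.

Lemma disc_polar (r t : R) : 0 <= r < 1 -> disc (polar r t).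
Proof. by move=> /andP[r0 r1]; apply/discE; rewrite normc_polar ger0_norm. Qed.

Lemma cmeas_polar (r : R) (D : set RM) : cmeas D (fun t => polar r t).
Proof.
apply: (cmeas_eq (fun t _ => polarE r t)); apply: cmeasM; first exact: cmeas_cst.
by apply: cmeas_cis; exact: measurable_id.
Qed.

Local Open Scope ereal_scope.

Lemma parseval_polar c (r : R) : tame c -> (0 <= r < 1)%R ->
  angle_int (fun t => (abs2 (pser c (polar r t)))%:E) =
  ((2 * pi)%R : R)%:E * \sum_(n <oo) ((r ^+ 2) ^+ n * abs2 (c n))%:E.
Proof.
move=> tc r01; have rd : disc (Complex r 0%R : CC R).
  by apply/discE; rewrite normc_real ger0_norm; case/andP: r01.
have [M [q G]] := tame_gboundz tc rd; rewrite /angle_int.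
have E t : pser c (polar r t) = csum (fun n => c n * Complex r 0%R ^+ n * cis (n%:R * t))%R.
  by rewrite /pser; apply: csum_ext => n; rewrite polarX mulrA.
under eq_integral do rewrite E.
rewrite (parseval G); congr (_ * _); apply: eq_eseriesr => n _; congr EFin.
have E2 : abs2 (Complex r 0%R : CC R) = (r ^+ 2)%R by rewrite abs2E /=; ring.
by rewrite abs2M abs2X E2 mulrC.
Qed.

Definition hsum a : \bar R := \sum_(m <oo) \sum_(n <oo) (abs2 (a m n))%:E.

Lemma hsum_tr a : hsum (tr a) = hsum a.
Proof. by rewrite /hsum nneseries_interchange// => i j; rewrite lee_fin abs2_ge0. Qed.

Lemma cmeas_pser_polar (r : R) c (D : set RM) : tame c -> (0 <= r < 1)%R ->
  cmeas D (fun t => pser c (polar r t)).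
Proof.
move=> tc r01; apply: (@cmeas_pser R _ _ D (fun n _ => c n) (fun t => polar r t)).
- by move=> n; exact: cmeas_cst.
- by [].
- exact: cmeas_polar.
- by move=> t _; exact: disc_polar.
Qed.

Lemma hardy_circle a f (r : R) : tame2 a -> (forall z, bidisc z -> f z = pser2 a z) ->
  (0 <= r < 1)%R ->
  ((2 * pi) ^- 2)%R%:E *
    angle_int (fun s => angle_int (fun t => (abs2 (f (polar r s, polar r t)))%:E)) =
  \sum_(n <oo) ((r ^+ 2) ^+ n)%:E * \sum_(m <oo) ((r ^+ 2) ^+ m)%:E * (abs2 (tr a n m))%:E.
Proof.
move=> ta fa r01; have tp := @twopi_gt0 R; have tt := tame2_tr ta.
have /andP[r0 r1] := r01.
have pd s : disc (polar r s) := disc_polar s r01.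
have k0 : 0 <= ((2 * pi)%R : R)%:E by rewrite lee_fin ltW.
have mI : measurable (`[0%R, (2 * pi)%R]%classic : set RM) by exact: measurable_itv.
pose g n s := pser (tr a n) (polar r s).
have in0 s : angle_int (fun t => (abs2 (f (polar r s, polar r t)))%:E) =
    ((2 * pi)%R : R)%:E * \sum_(n <oo) ((r ^+ 2) ^+ n * abs2 (g n s))%:E.
  rewrite -(parseval_polar (tame2_rows tt (pd s)) r01); apply: eq_integral => t _.
  by rewrite (fa (polar r s, polar r t) (conj (pd s) (pd t))) (pser2_tr ta (z := (polar r s, polar r t)) (conj (pd s) (pd t))).
have E0 n s : 0 <= ((r ^+ 2) ^+ n * abs2 (g n s))%:E.
  by rewrite lee_fin mulr_ge0 ?abs2_ge0// !exprn_ge0.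
have mg n : measurable_fun (`[0%R, (2 * pi)%R]%classic : set RM) (fun s => (abs2 (g n s))%:E).
  by apply: measurable_eabs2; apply: cmeas_pser_polar => //; exact: tame2_row.
have mE n : measurable_fun (`[0%R, (2 * pi)%R]%classic : set RM)
    (fun s => ((r ^+ 2) ^+ n * abs2 (g n s))%:E).
  by apply: eq_measurable_fun (measurable_funeM ((r ^+ 2) ^+ n)%:E (mg n)) => s _; rewrite EFinM.
have mS : measurable_fun (`[0%R, (2 * pi)%R]%classic : set RM)
    (fun s => \sum_(n <oo) ((r ^+ 2) ^+ n * abs2 (g n s))%:E).
  exact: (@ge0_emeasurable_sum _ _ _ _ (fun n s => ((r ^+ 2) ^+ n * abs2 (g n s))%:E) predT (fun n s _ _ => E0 n s) (fun n _ => mE n)).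
rewrite {1}/angle_int; under eq_integral do rewrite in0.
rewrite (ge0_integralZl leb mI mS (fun s _ => nneseries_ge0 (fun n _ _ => E0 n s)) k0).
rewrite (integral_nneseries leb mI mE (fun n s _ => E0 n s)).
have -> : \sum_(n <oo) \int[leb]_(s in `[0%R, (2 * pi)%R]) ((r ^+ 2) ^+ n * abs2 (g n s))%:E =
    ((2 * pi)%R : R)%:E * \sum_(n <oo) ((r ^+ 2) ^+ n)%:E *
      \sum_(m <oo) ((r ^+ 2) ^+ m)%:E * (abs2 (tr a n m))%:E.
  rewrite -nneseriesZl; last first.
    move=> n _; rewrite mule_ge0//; first by rewrite lee_fin !exprn_ge0.
    by apply: nneseries_ge0 => m _ _; rewrite mule_ge0// lee_fin ?abs2_ge0// !exprn_ge0.
  apply: eq_eseriesr => n _; under eq_integral do rewrite EFinM.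
  have c0 : 0 <= ((r ^+ 2) ^+ n)%:E by rewrite lee_fin !exprn_ge0.
  rewrite (ge0_integralZl leb mI (mg n) (fun s _ => _) c0); last by move=> s; rewrite lee_fin abs2_ge0.
  have := parseval_polar (tame2_row n tt) r01; rewrite /angle_int => ->.
  by rewrite muleCA; congr (_ * (_ * _)); apply: eq_eseriesr => m _; rewrite EFinM.
rewrite !muleA -!EFinM -[RHS]mul1e; congr (_%:E * _).
by rewrite -mulrA -expr2 mulVf// expf_eq0 /= gt_eqF.
Qed.

(** For the upper bound the Abel factors are at most 1. For the lower bound they are removed one
    after the other, which takes two independent radii, while the supremum runs over a common one;
    [two] dominates the pair by the larger radius. *)
Lemma hardy_formula a f : tame2 a -> (forall z, bidisc z -> f z = pser2 a z) ->
  hardy_sqnorm f = hsum a.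
Proof.
move=> ta fa; rewrite -hsum_tr /hardy_sqnorm.
have x0 n m : 0 <= (abs2 (tr a n m))%:E by rewrite lee_fin abs2_ge0.
apply/eqP; rewrite eq_le; apply/andP; split.
  apply: ge_ereal_sup => x [r]; rewrite /= in_itv /= => r01 <-.
  rewrite (hardy_circle ta fa r01); have /andP[r0 r1] := r01.
  have y0 n : 0 <= \sum_(m <oo) ((r ^+ 2) ^+ m)%:E * (abs2 (tr a n m))%:E.
    by apply: nneseries_ge0 => m _ _; rewrite mule_ge0// lee_fin !exprn_ge0.
  apply: le_trans (abel_sum_ge y0 r01) _; apply: lee_nneseries => // n _.
  exact: abel_sum_ge.
set S := ereal_sup _.
have two (r q : R) : (0 < r < 1)%R -> (0 < q < 1)%R ->
    \sum_(n <oo) ((r ^+ 2) ^+ n)%:E * \sum_(m <oo) ((q ^+ 2) ^+ m)%:E * (abs2 (tr a n m))%:E <= S.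
  move=> /andP[r0 r1] /andP[q0 q1]; set p := Num.max r q.
  have rp : (r <= p)%R by rewrite le_max lexx.
  have qp : (q <= p)%R by rewrite le_max lexx orbT.
  have p0 : (0 < p)%R by exact: lt_le_trans rp.
  have p1 : (p < 1)%R by rewrite gt_max r1 q1.
  have p01 : (0 <= p < 1)%R by rewrite (ltW p0) p1.
  apply: (@le_trans _ _ (\sum_(n <oo) ((p ^+ 2) ^+ n)%:E * \sum_(m <oo) ((p ^+ 2) ^+ m)%:E * (abs2 (tr a n m))%:E)).
    have pw (x : R) n : (0 < x)%R -> (x <= p)%R -> ((x ^+ 2) ^+ n)%:E <= ((p ^+ 2) ^+ n)%:E.
      move=> xp xl; rewrite lee_fin -!exprM lerXn2r ?nnegrE//; exact: ltW.
    have e0 (x : R) n : (0 < x)%R -> 0 <= ((x ^+ 2) ^+ n)%:E by move=> xp; rewrite lee_fin !exprn_ge0// ltW.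
    have s0 (x : R) n : (0 < x)%R -> 0 <= \sum_(m <oo) ((x ^+ 2) ^+ m)%:E * (abs2 (tr a n m))%:E.
      by move=> xp; apply: nneseries_ge0 => m _ _; exact: mule_ge0 (e0 x m xp) (x0 n m).
    apply: lee_nneseries => n => [_ _|_]; first exact: mule_ge0 (e0 r n r0) (s0 q n q0).
    apply: lee_pmul; [exact: e0|exact: s0|exact: pw|].
    apply: lee_nneseries => m => [_ _|_]; first exact: mule_ge0 (e0 q m q0) (x0 n m).
    by apply: lee_wpmul2r; [exact: x0|exact: pw].
  rewrite -(hardy_circle ta fa p01); apply: ereal_sup_ubound; by exists p.
have tr0 (q : R) n : (0 < q < 1)%R -> 0 <= \sum_(m <oo) ((q ^+ 2) ^+ m)%:E * (abs2 (tr a n m))%:E.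
  move=> /andP[q0 q1]; apply: nneseries_ge0 => m _ _; apply: mule_ge0 => //.
  by rewrite lee_fin !exprn_ge0// ltW.
rewrite hsum_tr /hsum; apply: abel_sum_le => [n|q q01]; first by apply: nneseries_ge0 => m _ _; exact: x0.
have := abel_sum_le (fun n => tr0 q n q01) (fun r r01 => two r q r01 q01).
rewrite nneseries_interchange; last first.
  move=> n m; apply: mule_ge0 => //; case/andP: q01 => q0 _.
  by rewrite lee_fin !exprn_ge0// ltW.
by congr (_ <= _); apply: eq_eseriesr => m _; rewrite nneseriesZl// => n _; exact: (x0 n m).
Qed.

Lemma eq_area_int (F G : CC R -> \bar R) : (forall z, disc z -> F z = G z) ->
  area_int F = area_int G.
Proof. by move=> FG; rewrite /area_int; congr (_ * _); apply: eq_integral => p /set_mem pd; exact: FG. Qed.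

Lemma area_intZl (k : \bar R) (F : CC R -> \bar R) : 0 <= k ->
  measurable_fun (@D2 R) (F \o Cx) -> (forall z, disc z -> 0 <= F z) ->
  area_int (fun z => k * F z) = k * area_int F.
Proof.
move=> k0 mF F0; rewrite /area_int muleCA; congr (_ * _).
exact: (ge0_integralZl leb2 measurable_D2 mF (fun p pd => F0 _ pd) k0).
Qed.

Lemma area_int_sum (F : nat -> CC R -> \bar R) :
  (forall n, measurable_fun (@D2 R) (F n \o Cx)) -> (forall n z, disc z -> 0 <= F n z) ->
  area_int (fun z => \sum_(n <oo) F n z) = \sum_(n <oo) area_int (F n).
Proof.
move=> mF F0; rewrite /area_int.
have E := integral_nneseries leb2 measurable_D2 mF (fun n p pd => F0 n _ pd).
rewrite nneseriesZl; last by move=> n _; apply: integral_ge0 => p pd; exact: F0.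
by congr (_ * _); exact: E.
Qed.

Lemma cmeas_pser_Cx c : tame c -> cmeas (@D2 R) (fun p => pser c (Cx p)).
Proof.
by move=> tc; exact: (@cmeas_pser R _ _ (@D2 R) (fun n _ => c n) Cx (fun n => cmeas_cst _ (c n)) (fun _ _ => tc) (cmeas_Cx _) (fun p Dp => Dp)).
Qed.

(** The normalizations of area and of the Poisson integral; that of the circle mean cancels against
    the factor in Parseval's identity. *)
Definition cst0 : R := (pi^-1 * (2 * pi)^-1)%R.

Lemma cst0_gt0 : (0 < cst0)%R.
Proof. by rewrite mulr_gt0// invr_gt0 ?pi_gt0// twopi_gt0. Qed.

Definition kint_rows (nu : circle_measure R) a : \bar R := \sum_(n <oo) kint nu (dcoef (a n)).

Lemma kint_ge0 nu c : 0 <= kint nu c.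
Proof.
apply: integral_ge0 => t _; apply: nneseries_ge0 => j _ _.
by rewrite lee_fin mulr_ge0 ?wgt_ge0 ?abs2_ge0.
Qed.

(** Parseval's identity in the second variable separates the powers [z2 ^ n]; for each of them
    [area_poisson] applies to the derivative of the column [tr a n]. The limit in [r] removes the
    factors [r ^ (2 n)]. *)
Lemma dirichlet1_formula nu a f : tame2 a -> (forall z, bidisc z -> f z = pser2 a z) ->
  dirichlet1 nu f = cst0%:E * kint_rows nu (tr a).
Proof.
move=> ta fa; have tp := @twopi_gt0 R; have tt := tame2_tr ta.
have k0 : 0 <= ((2 * pi)%R : R)%:E by rewrite lee_fin ltW.
have c0 : 0 <= cst0%:E by rewrite lee_fin ltW// cst0_gt0.
rewrite /kint_rows -nneseriesZl; last by move=> n _; exact: kint_ge0.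
apply: lim_abel => [n|r r01]; first by rewrite mule_ge0// kint_ge0.
have r01' : (0 <= r < 1)%R by case/andP: r01 => /ltW -> ->.
have rn n : 0 <= ((r ^+ 2) ^+ n)%:E by rewrite lee_fin !exprn_ge0//; case/andP: r01'.
pose g n z := pser (dcoef (tr a n)) z.
have tg n : tame (dcoef (tr a n)) by apply: tame_dcoef; exact: tame2_row.
have trow z : disc z -> tame (g ^~ z).
  move=> zd; have := tame2_rows (tame2_d2 tt) zd; congr (tame _); apply/funext => n.
pose F n z := (abs2 (g n z))%:E * poisson nu z.
have F0 n z : disc z -> 0 <= F n z.
  by move=> zd; rewrite mule_ge0 ?poisson_ge0// lee_fin abs2_ge0.
have mF n : measurable_fun (@D2 R) (F n \o Cx).
  apply: emeasurable_funM; last exact: measurable_poisson.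
  by apply: measurable_eabs2; exact: cmeas_pser_Cx.
have in0 z : disc z -> angle_int (fun t => (abs2 (partial1 f (z, polar r t)))%:E * poisson nu z) =
    ((2 * pi)%R : R)%:E * \sum_(n <oo) ((r ^+ 2) ^+ n)%:E * F n z.
  move=> zd; pose b n := g n z.
  have pE t : partial1 f (z, polar r t) = pser b (polar r t).
    have zb : bidisc (z, polar r t) := conj zd (disc_polar t r01').
    rewrite (eq_partial1 ta fa zb) (pser2_tr (tame2_d1 ta) zb) /pser2 /=.
    by congr (pser _ _); apply/funext => n.
  rewrite /angle_int; under eq_integral do rewrite pE muleC.
  have mI : measurable (`[0%R, (2 * pi)%R]%classic : set RM) by exact: measurable_itv.
  have mp : measurable_fun (`[0%R, (2 * pi)%R]%classic : set RM) (fun t => (abs2 (pser b (polar r t)))%:E).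
    by apply: measurable_eabs2; apply: cmeas_pser_polar => //; exact: trow.
  rewrite (ge0_integralZl leb mI mp (fun t _ => _) (poisson_ge0 nu zd)); last first.
    by move=> t; rewrite lee_fin abs2_ge0.
  have := parseval_polar (trow z zd) r01'; rewrite /angle_int => ->.
  rewrite muleCA; congr (_ * _).
  rewrite ge0_nneseriesZl ?poisson_ge0//; last by move=> n; rewrite lee_fin mulr_ge0 ?abs2_ge0// -lee_fin.
  by apply: eq_eseriesr => n _; rewrite /F EFinM muleCA [poisson nu z * _]muleC.
rewrite (eq_area_int in0).
have G0 n z : disc z -> 0 <= ((r ^+ 2) ^+ n)%:E * F n z by move=> zd; rewrite mule_ge0// F0.
have mG n : measurable_fun (@D2 R) ((fun z => ((r ^+ 2) ^+ n)%:E * F n z) \o Cx).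
  exact: (measurable_funeM _ (mF n)).
rewrite area_intZl//; last 2 first.
- exact: (@ge0_emeasurable_sum _ _ _ _ (fun n p => ((r ^+ 2) ^+ n)%:E * F n (Cx p)) predT (fun k x Dx _ => G0 k _ Dx) (fun k _ => mG k)).
- by move=> z zd; apply: nneseries_ge0 => n _ _; exact: G0.
rewrite muleA -EFinM mulVf ?mul1e; last by rewrite gt_eqF.
rewrite (area_int_sum mG G0); apply: eq_eseriesr => n _.
rewrite (area_intZl (rn n) (mF n) (F0 n)); congr (_ * _).
by rewrite (area_poisson nu (tg n)) -EFinM.
Qed.

Definition ssum2 b t i p j : CC R := ksum (fun m => ksum (b m) p j) t i.

Lemma ssum2_tr b t i p j : ssum2 (tr b) p j t i = ssum2 b t i p j.
Proof.
rewrite /ssum2 /ksum; under eq_bigr do rewrite mulr_suml.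
rewrite exchange_big; apply: eq_bigr => m _; rewrite mulr_suml; apply: eq_bigr => n _.
by rewrite /tr mulrAC.
Qed.

(** Deliberately asymmetric: the second variable is reduced to its partial sums and the first enters
    through the one-variable [kint], so that inequalities for [kint] apply inside. *)
Definition kint_mixed (nu1 nu2 : circle_measure R) b : \bar R :=
  \int[nu2]_(p in `[0%R, (2 * pi)%R[) \sum_(j <oo)
    (wgt j)%:E * kint nu1 (fun m => ksum (b m) p j).

(** The symmetric form of the integrand, through which [K3_tr] compares the two orders of the
    variables. *)
Definition S4 b (t p : R) : \bar R :=
  \sum_(j <oo) \sum_(i <oo) (wgt j * (wgt i * abs2 (ssum2 b t i p j)))%:E.

Local Notation T0 := (`[0%R, (2 * pi)%R[%classic : set RM).

Let mT : measurable T0. Proof. exact: measurable_itv. Qed.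

Lemma S4_term_ge0 b t p j i : 0 <= (wgt j * (wgt i * abs2 (ssum2 b t i p j)))%:E.
Proof. by rewrite lee_fin mulr_ge0 ?wgt_ge0// mulr_ge0 ?wgt_ge0 ?abs2_ge0. Qed.

Lemma S4_tr b t p : S4 (tr b) p t = S4 b t p.
Proof.
rewrite /S4 nneseries_interchange; last by move=> i j; exact: S4_term_ge0.
by apply: eq_eseriesr => j _; apply: eq_eseriesr => i _; rewrite ssum2_tr mulrCA.
Qed.

Lemma cmeas_ssum2 d (T : measurableType d) (D : set T) b (f g : T -> RM) i j :
  measurable_fun D f -> measurable_fun D g -> cmeas D (fun x => ssum2 b (f x) i (g x) j).
Proof.
move=> mf mg; apply: (@cmeas_sum _ _ _ D (fun m x => ksum (b m) (g x) j * cis (m%:R * f x))%R) => m.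
apply: cmeasM; first exact: cmeas_ksum.
by apply: cmeas_cis; apply: measurable_funM => //; exact: measurable_cst.
Qed.

Lemma measurable_S4_term d (T : measurableType d) (D : set T) b (f g : T -> RM) j i :
  measurable_fun D f -> measurable_fun D g ->
  measurable_fun D (fun x => (wgt j * (wgt i * abs2 (ssum2 b (f x) i (g x) j)))%:E).
Proof.
move=> mf mg; apply/measurable_EFinP; apply: measurable_funM; first exact: measurable_cst.
apply: measurable_funM; first exact: measurable_cst.
by apply: measurable_abs2; exact: cmeas_ssum2.
Qed.

Lemma measurable_S4 d (T : measurableType d) (D : set T) b (f g : T -> RM) :
  measurable_fun D f -> measurable_fun D g -> measurable_fun D (fun x => S4 b (f x) (g x)).
Proof.
move=> mf mg.
apply: (@ge0_emeasurable_sum _ _ _ _ (fun j x => \sum_(i <oo) (wgt j * (wgt i * abs2 (ssum2 b (f x) i (g x) j)))%:E) predT).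
  by move=> j x _ _; apply: nneseries_ge0 => i _ _; exact: S4_term_ge0.
move=> j _; apply: (@ge0_emeasurable_sum _ _ _ _ (fun i x => (wgt j * (wgt i * abs2 (ssum2 b (f x) i (g x) j)))%:E) predT).
  by move=> i x _ _; exact: S4_term_ge0.
by move=> i _; exact: measurable_S4_term.
Qed.

Lemma S4_ge0 b t p : 0 <= S4 b t p.
Proof. by apply: nneseries_ge0 => j _ _; apply: nneseries_ge0 => i _ _; exact: S4_term_ge0. Qed.

Lemma ksums_ge0 c t : 0 <= \sum_(j <oo) (wgt j * abs2 (ksum c t j))%:E.
Proof. by apply: nneseries_ge0 => j _ _; rewrite lee_fin mulr_ge0 ?wgt_ge0 ?abs2_ge0. Qed.

Lemma kintZl (nu : circle_measure R) c (k : \bar R) : 0 <= k ->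
  k * kint nu c = \int[nu]_(t in T0) (k * \sum_(j <oo) (wgt j * abs2 (ksum c t j))%:E).
Proof.
move=> k0.
exact: (esym (ge0_integralZl nu mT (@measurable_ksums R c T0) (fun t _ => ksums_ge0 c t) k0)).
Qed.

Lemma sum_kint (nu1 : circle_measure R) b p :
  \sum_(j <oo) (wgt j)%:E * kint nu1 (fun m => ksum (b m) p j) = \int[nu1]_(t in T0) S4 b t p.
Proof.
pose h j t := \sum_(i <oo) (wgt j * (wgt i * abs2 (ssum2 b t i p j)))%:E.
have h0 j t : T0 t -> 0 <= h j t by move=> _; apply: nneseries_ge0 => i _ _; exact: S4_term_ge0.
have mh j : measurable_fun T0 (h j).
  apply: (@ge0_emeasurable_sum _ _ _ _ (fun i x => (wgt j * (wgt i * abs2 (ssum2 b x i p j)))%:E) predT).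
    by move=> i x _ _; exact: S4_term_ge0.
  by move=> i _; apply: measurable_S4_term; [exact: measurable_id|exact: measurable_cst].
transitivity (\sum_(j <oo) \int[nu1]_(t in T0) h j t); last exact: esym (integral_nneseries nu1 mT mh h0).
apply: eq_eseriesr => j _; rewrite kintZl; last by rewrite lee_fin wgt_ge0.
apply: eq_integral => t _; rewrite -nneseriesZl; last by move=> i _; rewrite lee_fin mulr_ge0 ?wgt_ge0 ?abs2_ge0.
by apply: eq_eseriesr => i _; rewrite -EFinM.
Qed.

Lemma K3E nu1 nu2 b : kint_mixed nu1 nu2 b = \int[nu2]_(p in T0) \int[nu1]_(t in T0) S4 b t p.
Proof. by apply: eq_integral => p _; exact: sum_kint. Qed.

Lemma K3_tr nu1 nu2 b : kint_mixed nu2 nu1 (tr b) = kint_mixed nu1 nu2 b.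
Proof.
rewrite !K3E.
have mS : measurable_fun (T0 `*` T0) (fun x : RM * RM => S4 b x.1 x.2).
  by apply: measurable_S4; apply: measurable_funTS; [exact: measurable_fst|exact: measurable_snd].
rewrite -(@tonelli_on R _ _ RM RM nu1 nu2 T0 T0 (S4 b) mT mT mS (fun t p _ _ => S4_ge0 b t p)).
by apply: eq_integral => t _; apply: eq_integral => p _; exact: S4_tr.
Qed.

Lemma measurable_sum_kint (nu1 : circle_measure R) b :
  measurable_fun T0 (fun p => \sum_(j <oo) (wgt j)%:E * kint nu1 (fun m => ksum (b m) p j)).
Proof.
have mS : measurable_fun (T0 `*` T0) (fun x : RM * RM => S4 b x.2 x.1).
  by apply: measurable_S4; apply: measurable_funTS; [exact: measurable_snd|exact: measurable_fst].
have := @measurable_integral_on R _ _ RM RM nu1 T0 T0 (fun p t => S4 b t p) mT mT mS (fun t p _ _ => S4_ge0 b p t).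
by apply: eq_measurable_fun => p _; rewrite sum_kint.
Qed.

Lemma pser_sum (b : nat -> nat -> CC R) (e : nat -> CC R) k z : (forall m, tame (b m)) -> disc z ->
  tame (fun n => \sum_(m < k) b m n * e m)%R /\
  pser (fun n => \sum_(m < k) b m n * e m)%R z = (\sum_(m < k) pser (b m) z * e m)%R.
Proof.
move=> tb zd; elim: k => [|k [tk pk]].
  have E : (fun n => \sum_(m < 0) b m n * e m)%R = (fun=> 0%R : CC R) by apply/funext => n; rewrite big_ord0.
  rewrite E big_ord0; split; first by apply: (@tame_bounded R _ 0%R) => n; rewrite Normc.normc0.
  by rewrite /pser; under csum_ext do rewrite mul0r; exact: csum0.
have E : (fun n => \sum_(m < k.+1) b m n * e m)%R =
    (fun n => (\sum_(m < k) b m n * e m) + e k * b k n)%R.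
  by apply/funext => n; rewrite big_ord_recr /= [(b k n * _)%R]mulrC.
rewrite E big_ord_recr /=; split; first by apply: tameD => //; exact: tameZ.
by rewrite pserD ?pserZ ?pk// 1?mulrC//; exact: tameZ.
Qed.

Lemma ksum_pser b t i z : (forall m, tame (b m)) -> disc z ->
  ksum (fun m => pser (b m) z) t i = pser (fun n => ksum (fun m => b m n) t i) z.
Proof. by move=> tb zd; rewrite /ksum; have [_ ->] := pser_sum (fun m => cis (m%:R * t)) i.+1 tb zd. Qed.

Lemma sum_kint_ge0 nu1 b p : 0 <= \sum_(j <oo) (wgt j)%:E * kint nu1 (fun m => ksum (b m) p j).
Proof. by apply: nneseries_ge0 => j _ _; rewrite mule_ge0 ?kint_ge0// lee_fin wgt_ge0. Qed.

(** [area_poisson] is used twice: in [z1] at fixed [z2], and then in [z2] for the partial sums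
    [B t i], which are coefficients of power series in [z2]. In between, Tonelli moves the integral
    against [mu1] outside. *)
Lemma dirichlet3_formula mu1 mu2 a f : tame2 a -> (forall z, bidisc z -> f z = pser2 a z) ->
  dirichlet3 mu1 mu2 f = (cst0 * cst0)%:E * kint_mixed mu1 mu2 (d1 (d2 a)).
Proof.
move=> ta fa; set b := d1 (d2 a).
have ta2 := tame2_d2 ta; have tb : tame2 b := tame2_d1 ta2.
have tbr m : tame (b m) by exact: tame2_row.
have f2 w : bidisc w -> partial2 f w = pser2 (d2 a) w by exact: eq_partial2.
have f12 w : bidisc w -> partial1 (partial2 f) w = pser2 b w by exact: eq_partial1.
have c0 : 0 <= cst0%:E by rewrite lee_fin ltW// cst0_gt0.
pose B t i n := ksum (fun m => b m n) t i.
have tB t i : tame (B t i).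
  by have [H _] := pser_sum (fun m => cis (m%:R * t)) i.+1 tbr (@disc0 R).
pose Q z t := \sum_(i <oo) (wgt i)%:E * ((abs2 (pser (B t i) z))%:E * poisson mu2 z).
have Qt0 z t i : disc z -> 0 <= (wgt i)%:E * ((abs2 (pser (B t i) z))%:E * poisson mu2 z).
  by move=> zd; rewrite mule_ge0 ?lee_fin ?wgt_ge0// mule_ge0 ?lee_fin ?abs2_ge0 ?poisson_ge0.
have Q0 z t : disc z -> 0 <= Q z t by move=> zd; apply: nneseries_ge0 => i _ _; exact: Qt0.
have in1 z2 : disc z2 -> area_int (fun z1 => (abs2 (partial1 (partial2 f) (z1, z2)))%:E
      * poisson mu1 z1 * poisson mu2 z2) = cst0%:E * \int[mu1]_(t in T0) Q z2 t.
  move=> zd2.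
  pose c m := pser (b m) z2; have tc : tame c := tame2_rows tb zd2.
  transitivity (area_int (fun z1 => poisson mu2 z2 * ((abs2 (pser c z1))%:E * poisson mu1 z1))).
    apply: eq_area_int => z1 zd1; rewrite muleC; congr (_ * (_ * _)).
    by rewrite (f12 (z1, z2) (conj zd1 zd2)).
  rewrite area_intZl ?poisson_ge0//; last 2 first.
  - apply: emeasurable_funM; last exact: measurable_poisson.
    by apply: measurable_eabs2; exact: cmeas_pser_Cx.
  - by move=> z1 zd1; rewrite mule_ge0 ?poisson_ge0// lee_fin abs2_ge0.
  rewrite (area_poisson mu1 tc) -EFinM muleCA; congr (_ * _).
  rewrite (kintZl mu1 c (poisson_ge0 mu2 zd2)).
  apply: eq_integral => t _; rewrite ge0_nneseriesZl ?poisson_ge0//; last first.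
    by move=> i; rewrite lee_fin mulr_ge0 ?wgt_ge0 ?abs2_ge0.
  apply: eq_eseriesr => i _; rewrite EFinM muleCA; congr (_ * _); rewrite muleC; congr (_ * _).
  by rewrite /c (ksum_pser t i tbr zd2).
rewrite /dirichlet3 (eq_area_int in1).
have mQg (d : measure_display) (T : measurableType d) (D : set T) (u : T -> RM * RM) (v : T -> RM) :
    measurable_fun setT u -> measurable_fun setT v -> (forall x, D x -> D2 (u x)) ->
    measurable_fun D (fun x => Q (Cx (u x)) (v x)).
  move=> mu mv Du.
  have mC : cmeas D (fun x => Cx (u x)).
    have [m1 m2] := @cmeas_Cx R setT.
    by split; apply: measurable_funTS; [exact: (measurableT_comp m1 mu)|exact: (measurableT_comp m2 mu)].
  have mBj i : cmeas D (fun x => pser (B (v x) i) (Cx (u x))).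
    apply: (@cmeas_pser R _ _ D (fun n x => B (v x) i n) (fun x => Cx (u x))).
    - by move=> n; apply: cmeas_ksum; apply: measurable_funTS.
    - by move=> x _; exact: tB.
    - exact: mC.
    - by move=> x /Du.
  have mP : measurable_fun D (fun x => poisson mu2 (Cx (u x))).
    have mD := measurable_poisson mu2; have mE := (measurable_restrictT _ (@measurable_D2 R)).1 mD.
    apply: eq_measurable_fun (measurable_funTS (measurableT_comp mE mu)) => x /set_mem/Du ux.
    by rewrite /= patchE mem_set.
  apply: (@ge0_emeasurable_sum _ _ _ _ (fun i x => (wgt i)%:E * ((abs2 (pser (B (v x) i) (Cx (u x))))%:E * poisson mu2 (Cx (u x)))) predT).
    by move=> i x /Du ux _; exact: Qt0.
  move=> i _; apply: measurable_funeM; apply: emeasurable_funM mP.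
  exact: measurable_eabs2 (mBj i).
have mQ : measurable_fun (@D2 R `*` T0) (fun x : (RM * RM) * RM => Q (Cx x.1) x.2).
  by apply: mQg; [exact: measurable_fst|exact: measurable_snd|move=> x []].
have Q0' (p : RM * RM) (t : RM) : D2 p -> T0 t -> 0 <= Q (Cx p) t by move=> pd _; exact: Q0.
have mIQ := @measurable_integral_on R _ _ (RM * RM)%type RM mu1 (@D2 R) T0 (fun p t => Q (Cx p) t) (@measurable_D2 R) mT mQ Q0'.
rewrite area_intZl//; last by move=> z zd; apply: integral_ge0 => t _; exact: Q0.
rewrite (EFinM cst0 cst0) -(muleA cst0%:E); congr (_ * _).
(* This order of integration produces [kint_mixed] with the measures exchanged, so the right-hand
   side is brought into that form. *)
rewrite -K3_tr /kint_mixed -(ge0_integralZl mu1 mT (@measurable_sum_kint mu2 (tr b)) (fun t _ => sum_kint_ge0 mu2 (tr b) t) c0).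
have pi0 : 0 <= ((pi^-1)%R : R)%:E by rewrite lee_fin invr_ge0 pi_ge0.
rewrite /area_int.
transitivity (((pi^-1)%R : R)%:E * \int[mu1]_(t in T0) \int[leb2]_(p in @D2 R) Q (Cx p) t).
  congr (_ * _).
  exact: (@tonelli_on R _ _ (RM * RM)%type RM (@lebesgue2 R) mu1 (@D2 R) T0 (fun p t => Q (Cx p) t) (@measurable_D2 R) mT mQ Q0').
have mQ' : measurable_fun (T0 `*` @D2 R) (fun x : RM * (RM * RM) => Q (Cx x.2) x.1).
  by apply: mQg; [exact: measurable_snd|exact: measurable_fst|move=> x []].
have mI2 := @measurable_integral_on R _ _ RM (RM * RM)%type (@lebesgue2 R) T0 (@D2 R) (fun t p => Q (Cx p) t) mT (@measurable_D2 R) mQ' (fun t p tt pd => Q0' p t pd tt).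
rewrite -(ge0_integralZl mu1 mT mI2 (fun t _ => integral_ge0 _ (fun p pd => Q0 _ t pd)) pi0).
apply: eq_integral => t _; rewrite -nneseriesZl; last first.
  by move=> i _; rewrite mule_ge0 ?kint_ge0// lee_fin wgt_ge0.
have mF i : measurable_fun (@D2 R) ((fun z => (abs2 (pser (B t i) z))%:E * poisson mu2 z) \o Cx).
  apply: emeasurable_funM; last exact: measurable_poisson.
  by apply: measurable_eabs2; exact: cmeas_pser_Cx.
have F0 i z : disc z -> 0 <= (abs2 (pser (B t i) z))%:E * poisson mu2 z.
  by move=> zd; rewrite mule_ge0 ?poisson_ge0// lee_fin abs2_ge0.
have mF' i : measurable_fun (@D2 R) ((fun z => (wgt i)%:E * ((abs2 (pser (B t i) z))%:E * poisson mu2 z)) \o Cx).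
  exact: (measurable_funeM _ (mF i)).
transitivity (area_int (fun z => Q z t)); first by [].
rewrite (area_int_sum mF' (fun i z zd => Qt0 z t i zd)); apply: eq_eseriesr => i _.
have w0 : 0 <= (@wgt R i)%:E by rewrite lee_fin wgt_ge0.
by rewrite (area_intZl w0 (mF i) (F0 i)) (area_poisson mu2 (tB t i)) -EFinM muleCA.
Qed.

End Functionals.

(** * Boundedness of the operators *)

Section KintInequalities.
Context {R : realType}.
Local Notation RM := (measurableTypeR R).
Local Notation T0 := (`[0%R, (2 * pi)%R[%classic : set RM).
Implicit Types (u : nat -> CC R) (a b : nat -> nat -> CC R) (nu : circle_measure R).
Local Notation mT := (measurable_itv `[0%R, (2 * pi)%R[ : measurable T0).
Local Open Scope ereal_scope.

Definition ksums u t : \bar R := \sum_(j <oo) (wgt j * abs2 (ksum (dcoef u) t j))%:E.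

Lemma ksums_partial u t n : \sum_(0 <= j < n) (wgt j * abs2 (ksum (dcoef u) t j))%:E = (@disc_area R * PP u t n)%:E.
Proof.
rewrite big_mkord sumEFin; congr EFin; rewrite /PP mulr_sumr; apply: eq_bigr => j _.
by rewrite /wgt mulrAC mulrA.
Qed.

Lemma PP_ksums u t n : (@disc_area R * PP u t n)%:E <= ksums u t.
Proof.
rewrite -ksums_partial; apply: nneseries_lim_ge => j _ _.
by rewrite lee_fin mulr_ge0 ?wgt_ge0 ?abs2_ge0.
Qed.

Lemma ksums_le u t (x : \bar R) : (forall n, (@disc_area R * PP u t n)%:E <= x) -> ksums u t <= x.
Proof.
move=> H; apply: lime_le.
  by apply: is_cvg_nneseries => j _ _; rewrite lee_fin mulr_ge0 ?wgt_ge0 ?abs2_ge0.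
by apply: nearW => n; rewrite ksums_partial.
Qed.

Lemma ksums_shift u t : ksums (scons 0%R u) t <= 18%:E * ksums u t + (4 * @disc_area R * abs2 (u 0%N))%:E.
Proof.
apply: ksums_le => n.
apply: (@le_trans _ _ (18%:E * (@disc_area R * PP u t n)%:E + (4 * @disc_area R * abs2 (u 0%N))%:E)).
  rewrite -EFinM -EFinD lee_fin.
  have := ler_wpM2l (ltW (@disc_area_gt0 R)) (PP_shift u t n); congr (_ <= _)%R; ring.
by apply: leeD2r; apply: lee_wpmul2l; [rewrite lee_fin|exact: PP_ksums].
Qed.

Lemma ksums_unshift u t : ksums (fun m => u m.+1) t <= 14%:E * ksums u t.
Proof.
apply: ksums_le => n; apply: (@le_trans _ _ (14%:E * (@disc_area R * PP u t n.+1)%:E)).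
  rewrite -EFinM lee_fin.
  have := ler_wpM2l (ltW (@disc_area_gt0 R)) (PP_unshift u t n); congr (_ <= _)%R; ring.
by apply: lee_wpmul2l; [rewrite lee_fin|exact: PP_ksums].
Qed.

Lemma sum_abs2_ksums u t : (@disc_area R)%:E * \sum_(m <oo) (abs2 (u m.+1))%:E <= 8%:E * ksums u t.
Proof.
rewrite -nneseriesZl; last by move=> m _; rewrite lee_fin abs2_ge0.
apply: lime_le.
  apply: is_cvg_nneseries => m _ _; rewrite mule_ge0// lee_fin ?abs2_ge0//; exact/ltW/disc_area_gt0.
apply: nearW => n; rewrite big_mkord; under eq_bigr do rewrite -EFinM.
rewrite sumEFin -mulr_sumr.
apply: (@le_trans _ _ (8%:E * (@disc_area R * PP u t n)%:E)).
  rewrite -EFinM lee_fin.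
  have := ler_wpM2l (ltW (@disc_area_gt0 R)) (sum_abs2_PP u t n); congr (_ <= _)%R; ring.
by apply: lee_wpmul2l; [rewrite lee_fin|exact: PP_ksums].
Qed.

Lemma kint_shift nu u :
  kint nu (dcoef (scons 0%R u)) <= 18%:E * kint nu (dcoef u) + (4 * @disc_area R * abs2 (u 0%N))%:E * nu T0.
Proof.
have k0 : 0 <= (4 * @disc_area R * abs2 (u 0%N))%:E by rewrite lee_fin mulr_ge0 ?abs2_ge0// mulr_ge0// ltW// disc_area_gt0.
have e0 : 0 <= 18%:E :> \bar R by rewrite lee_fin.
have m1 := @measurable_ksums R (dcoef u) T0.
have m18 : measurable_fun T0 (fun t => 18%:E * ksums u t) by exact: measurable_funeM.
rewrite (kintZl nu _ e0) -(integral_cst nu mT).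
rewrite -(ge0_integralD nu mT (fun t _ => mule_ge0 e0 (ksums_ge0 _ t)) m18 (fun _ _ => k0) (measurable_cst _)).
apply: (ge0_le_integral nu mT (fun t _ => ksums_ge0 _ t) (@measurable_ksums R _ T0)).
  by apply: emeasurable_funD => //; exact: measurable_cst.
by move=> t _; exact: ksums_shift.
Qed.

Lemma kint_unshift nu u : kint nu (dcoef (fun m => u m.+1)) <= 14%:E * kint nu (dcoef u).
Proof.
have e0 : 0 <= 14%:E :> \bar R by rewrite lee_fin.
rewrite (kintZl nu _ e0).
apply: (ge0_le_integral nu mT (fun t _ => ksums_ge0 _ t) (@measurable_ksums R _ T0)).
  by apply: measurable_funeM; exact: measurable_ksums.
by move=> t _; exact: ksums_unshift.
Qed.

Lemma kint_sum_abs2 nu u :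
  (@disc_area R)%:E * (\sum_(m <oo) (abs2 (u m.+1))%:E) * nu T0 <= 8%:E * kint nu (dcoef u).
Proof.
have e0 : 0 <= 8%:E :> \bar R by rewrite lee_fin.
rewrite (kintZl nu _ e0) -(integral_cst nu mT).
apply: (ge0_le_integral nu mT).
- move=> t _; apply: mule_ge0; first by rewrite lee_fin; exact/ltW/disc_area_gt0.
  by apply: nneseries_ge0 => m _ _; rewrite lee_fin abs2_ge0.
- exact: measurable_cst.
- by apply: measurable_funeM; exact: measurable_ksums.
- by move=> t _; exact: sum_abs2_ksums.
Qed.

Lemma circle_measure_total nu : nu T0 = nu setT.
Proof.
have E : setT = T0 `|` ~` T0 by rewrite setUv.
rewrite E measureU//; last 2 first.
- exact: measurableC mT.
- by rewrite setICr.
transitivity (nu T0 + 0); first by rewrite adde0.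
exact: esym (congr1 (fun x => nu T0 + x) (circle_measure_supp nu)).
Qed.

(** The squared Hardy norm of [f (0, z2)], the quantity that multiplication by [z1] brings in. *)
Definition fstrow a : \bar R := \sum_(n <oo) (abs2 (a 0%N n))%:E.

Lemma nneseries_le_lin (x y z : nat -> \bar R) (c : R) (d : R) : (0 <= c)%R -> (0 <= d)%R ->
  (forall n, 0 <= x n) -> (forall n, 0 <= y n) -> (forall n, 0 <= z n) ->
  (forall n, x n <= c%:E * y n + d%:E * z n) ->
  \sum_(n <oo) x n <= c%:E * \sum_(n <oo) y n + d%:E * \sum_(n <oo) z n.
Proof.
move=> c0 d0 x0 y0 z0 H.
rewrite -!nneseriesZl// -nneseriesD.
- by apply: lee_nneseries => n _.
- by move=> n _ _; rewrite mule_ge0// lee_fin.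
- by move=> n _ _; rewrite mule_ge0// lee_fin.
Qed.

Lemma tr_sc1 a n : tr (sc1 a) n = scons 0%R (tr a n).
Proof. by apply/funext => -[|m]. Qed.

Lemma K1_sc1 nu a : kint_rows nu (tr (sc1 a)) <=
  18%:E * kint_rows nu (tr a) + (4 * @disc_area R * fine (nu setT))%:E * fstrow a.
Proof.
have kp := @disc_area_gt0 R.
have nf : (fine (nu setT))%:E = nu T0 by rewrite circle_measure_total fineK// fin_num_measure.
have n0 : (0 <= fine (nu setT))%R by rewrite fine_ge0.
apply: nneseries_le_lin => //.
- by rewrite mulr_ge0// mulr_ge0// ltW.
- by move=> n; exact: kint_ge0.
- by move=> n; exact: kint_ge0.
- by move=> n; rewrite lee_fin abs2_ge0.
move=> n; rewrite tr_sc1; apply: le_trans (kint_shift nu (tr a n)) _.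
by rewrite -nf -!EFinM mulrAC.
Qed.

Lemma K1_sh1 nu a : kint_rows nu (tr (sh1 a)) <= 14%:E * kint_rows nu (tr a).
Proof.
rewrite /kint_rows -nneseriesZl; last by move=> n _; exact: kint_ge0.
apply: lee_nneseries => [n _ _|n _]; first exact: kint_ge0.
exact: kint_unshift.
Qed.

Lemma dcoef0 : dcoef (fun=> 0%R : CC R) = (fun=> 0%R).
Proof. by apply/funext => n; rewrite /dcoef mulr0. Qed.

Lemma kint0 nu : kint nu (fun=> 0%R) = 0.
Proof.
apply: integral0_eq => t _; apply: eseries0 => j _ _.
by rewrite /ksum big1 ?abs2_0 ?mulr0// => m _; rewrite mul0r.
Qed.

Lemma sc1_0 a : sc1 a 0%N = (fun=> 0%R). Proof. by []. Qed.

Lemma K1_row nu a : kint_rows nu a = kint nu (dcoef (a 0%N)) + kint_rows nu (sh1 a).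
Proof.
exact: (nneseriesS (fun n => kint_ge0 nu (dcoef (a n)))).
Qed.

(** For the Dirichlet part of the second variable the shift merely inserts a zero row. *)
Lemma K1_sc1' nu a : kint_rows nu (sc1 a) = kint_rows nu a.
Proof. by rewrite K1_row sc1_0 dcoef0 kint0 add0e. Qed.

Lemma K1_sh1' nu a : kint_rows nu (sh1 a) <= kint_rows nu a.
Proof. by rewrite [leRHS]K1_row leeDr// kint_ge0. Qed.

Lemma K1_ge_row nu a : kint nu (dcoef (a 0%N)) <= kint_rows nu a.
Proof. by rewrite [leRHS]K1_row leeDl//; apply: nneseries_ge0 => n _ _; exact: kint_ge0. Qed.

Lemma mixed_coef a p j : (fun m => ksum (d1 (d2 a) m) p j) = dcoef (fun m => ksum (dcoef (a m)) p j).
Proof.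
apply/funext => m; rewrite /dcoef /ksum mulr_sumr; apply: eq_bigr => n _.
by rewrite /d1 /d2 !mulrA.
Qed.

Lemma ksum0 p j : ksum (fun=> 0%R : CC R) p j = 0%R.
Proof. by rewrite /ksum big1// => m _; rewrite mul0r. Qed.

(** For each [p] and [j] the shift inequality is applied to the sequence
    [m -> ksum (dcoef (a m)) p j]. Its constant term, summed over [j] with the weights and
    integrated against [nu2], is the Dirichlet sum of the row [a 0]. *)
Lemma K3_sc1 nu1 nu2 a : kint_mixed nu1 nu2 (d1 (d2 (sc1 a))) <=
  18%:E * kint_mixed nu1 nu2 (d1 (d2 a)) + (4 * @disc_area R * fine (nu1 setT))%:E * kint nu2 (dcoef (a 0%N)).
Proof.
have kp := @disc_area_gt0 R.
have nf : (fine (nu1 setT))%:E = nu1 T0 by rewrite circle_measure_total fineK// fin_num_measure.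
have n0 : (0 <= fine (nu1 setT))%R by rewrite fine_ge0.
have d0 : (0 <= 4 * @disc_area R * fine (nu1 setT))%R by rewrite mulr_ge0// mulr_ge0// ltW.
have e0 : 0 <= 18%:E :> \bar R by rewrite lee_fin.
have d0' : 0 <= (4 * @disc_area R * fine (nu1 setT))%:E by rewrite lee_fin.
have mk b := @measurable_sum_kint R nu1 b.
have m1 := @measurable_ksums R (dcoef (a 0%N)) T0.
have m18 := measurable_funeM 18%:E (mk (d1 (d2 a))).
have md := measurable_funeM (4 * @disc_area R * fine (nu1 setT))%:E m1.
rewrite (kintZl nu2 _ d0').
rewrite /kint_mixed -(ge0_integralZl nu2 mT (mk _) (fun p _ => sum_kint_ge0 nu1 (d1 (d2 a)) p) e0).
rewrite -(ge0_integralD nu2 mT (fun p _ => mule_ge0 e0 (sum_kint_ge0 nu1 (d1 (d2 a)) p)) m18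
  (fun p _ => mule_ge0 d0' (ksums_ge0 _ p)) md).
apply: (ge0_le_integral nu2 mT (fun p _ => sum_kint_ge0 nu1 (d1 (d2 (sc1 a))) p) (mk _)).
  exact: emeasurable_funD.
move=> p _; apply: nneseries_le_lin => //.
- by move=> j; rewrite mule_ge0 ?kint_ge0// lee_fin wgt_ge0.
- by move=> j; rewrite mule_ge0 ?kint_ge0// lee_fin wgt_ge0.
- by move=> j; rewrite lee_fin mulr_ge0 ?wgt_ge0 ?abs2_ge0.
move=> j; rewrite !mixed_coef.
have -> : (fun m => ksum (dcoef (sc1 a m)) p j) = scons 0%R (fun m => ksum (dcoef (a m)) p j).
  by apply/funext => -[|m] //=; rewrite sc1_0 dcoef0 ksum0.
have w0 : 0 <= (@wgt R j)%:E by rewrite lee_fin wgt_ge0.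
apply: le_trans (lee_wpmul2l w0 (kint_shift nu1 _)) _.
have x0 : (0 <= 4 * @disc_area R * abs2 (ksum (dcoef (a 0%N)) p j))%R.
  by rewrite mulr_ge0 ?abs2_ge0// mulr_ge0// ltW.
rewrite -nf -EFinM ge0_muleDr; [|by rewrite mule_ge0 ?kint_ge0|by rewrite lee_fin mulr_ge0].
rewrite muleCA; apply: leeD2l; rewrite -EFinM lee_fin.
by rewrite le_eqVlt; apply/orP; left; apply/eqP; ring.
Qed.

Lemma K3_sh1 nu1 nu2 a : kint_mixed nu1 nu2 (d1 (d2 (sh1 a))) <= 14%:E * kint_mixed nu1 nu2 (d1 (d2 a)).
Proof.
have e0 : 0 <= 14%:E :> \bar R by rewrite lee_fin.
have mk b := @measurable_sum_kint R nu1 b.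
rewrite /kint_mixed -(ge0_integralZl nu2 mT (mk _) (fun p _ => sum_kint_ge0 nu1 (d1 (d2 a)) p) e0).
apply: (ge0_le_integral nu2 mT (fun p _ => sum_kint_ge0 nu1 (d1 (d2 (sh1 a))) p) (mk _)).
  by apply: measurable_funeM; exact: mk.
move=> p _; rewrite -nneseriesZl; last by move=> j _; rewrite mule_ge0 ?kint_ge0// lee_fin wgt_ge0.
apply: lee_nneseries => [j _ _|j _]; first by rewrite mule_ge0 ?kint_ge0// lee_fin wgt_ge0.
rewrite !mixed_coef muleCA; apply: lee_wpmul2l; first by rewrite lee_fin wgt_ge0.
exact: (kint_unshift nu1 (fun m => ksum (dcoef (a m)) p j)).
Qed.

Lemma hsum_row a : hsum a = fstrow a + hsum (sh1 a).
Proof.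
by rewrite /hsum nneseriesS// => m; apply: nneseries_ge0 => n _ _; rewrite lee_fin abs2_ge0.
Qed.

Lemma fstrow_ge0 a : 0 <= fstrow a.
Proof. by apply: nneseries_ge0 => n _ _; rewrite lee_fin abs2_ge0. Qed.

Lemma hsum_ge0 a : 0 <= hsum a.
Proof. by apply: nneseries_ge0 => m _ _; apply: nneseries_ge0 => n _ _; rewrite lee_fin abs2_ge0. Qed.

Lemma hsum_sh1 a : hsum (sh1 a) <= hsum a.
Proof. by rewrite [leRHS]hsum_row leeDr// fstrow_ge0. Qed.

Lemma fstrow_hsum a : fstrow a <= hsum a.
Proof. by rewrite hsum_row leeDl// hsum_ge0. Qed.

Lemma hsum_sc1 a : hsum (sc1 a) = hsum a.
Proof.
rewrite hsum_row /fstrow (@eseries0 _ _ _ xpredT) ?add0e// => n _ _.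
by rewrite abs2_0.
Qed.

(** The row [a 0] has a finite Dirichlet sum, which by [kint_sum_abs2] bounds the mass of [nu] times
    the squared coefficients from index 1 on. An infinite sum is excluded since the mass is
    positive. *)
Lemma fstrow_fin nu a : 0 < nu setT -> kint_rows nu a < +oo -> fstrow a < +oo.
Proof.
move=> nu0 Kf; have kp := @disc_area_gt0 R.
have := le_lt_trans (K1_ge_row nu a) Kf => kf.
have H := kint_sum_abs2 nu (a 0%N).
rewrite circle_measure_total in H.
have E : fstrow a = (abs2 (a 0%N 0%N))%:E + \sum_(m <oo) (abs2 (a 0%N m.+1))%:E.
  by rewrite /fstrow nneseriesS// => m; rewrite lee_fin abs2_ge0.
rewrite E {E}; move: (\sum_(m <oo) (abs2 (a 0%N m.+1))%:E) H.
case=> [x| |] H; rewrite ?ltry//.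
- by move: H; rewrite gt0_muley ?lte_fin// gt0_mulye// leNgt lte_mul_pinfty ?lee_fin.
Qed.

End KintInequalities.

(** * Operators on coefficients and exchange of the variables *)

Section Operators.
Context {R : realType}.
Implicit Types (a b : nat -> nat -> CC R) (f g : CC R * CC R -> CC R) (z : CC R * CC R).
Implicit Types (nu mu : circle_measure R).

Definition expands_as f a := tame2 a /\ forall z, bidisc z -> f z = pser2 a z.

Lemma repr_holomorphic f a : expands_as f a -> holomorphic f.
Proof. by move=> [ta fa]; exact: pser2_holomorphic ta fa. Qed.

Lemma holomorphic_repr f : holomorphic f -> exists a, expands_as f a.
Proof. by move=> /holomorphic_pser2[a [ta fa]]; exists a. Qed.

Definition swap_args f z := f (z.2, z.1).

Lemma swK f : swap_args (swap_args f) = f. Proof. by apply/funext => -[]. Qed.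

Lemma bidisc_sw z : bidisc z -> bidisc (z.2, z.1).
Proof. by move=> [? ?]; split. Qed.

Lemma repr_sw f a : expands_as f a -> expands_as (swap_args f) (tr a).
Proof.
move=> [ta fa]; split; first exact: tame2_tr.
move=> z zd; have zd' := bidisc_sw zd; rewrite /swap_args (fa _ zd') (pser2_tr ta zd').
by case: z zd zd'.
Qed.

Lemma pser_zero w : pser (fun=> 0 : CC R) w = 0.
Proof. by rewrite /pser; under csum_ext do rewrite mul0r; exact: csum0. Qed.

Lemma repr_Mz1 f a : expands_as f a -> expands_as (Mz1 f) (sc1 a).
Proof.
move=> [ta fa]; split; first exact: tame2_sc1.
move=> z zd; have [z1 z2] := zd; rewrite /Mz1 (fa z zd) /pser2.
have -> : (fun m => pser (sc1 a m) z.2) = scons 0 (fun m => pser (a m) z.2).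
  by apply/funext => -[|m] //; exact: pser_zero.
by rewrite (pser_scons _ (tame2_rows ta z2) z1) add0r.
Qed.

(** Off [z.1 = 0] the constant term of the series in [z.1] cancels; at [z.1 = 0] both the derivative
    and the shifted series reduce to row 1 of [a]. *)
Lemma repr_L1 f a : expands_as f a -> expands_as (L1 f) (sh1 a).
Proof.
move=> [ta fa]; split; first exact: tame2_sh1.
move=> z zd; have [z1 z2] := zd; rewrite /L1.
have tr1 := tame2_rows ta z2; have ts1 := tame2_rows (tame2_sh1 ta) z2.
have [z0|zn0] := eqVneq z.1 0.
  rewrite (eq_partial1 ta fa zd) /pser2 z0 (pser0 (tame2_rows (tame2_d1 ta) z2)) (pser0 ts1).
  by apply: pser_ext => n; rewrite /d1 /sh1 mul1r.
have zd0 : bidisc (0, z.2) := conj (@disc0 R) z2.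
rewrite (fa z zd) (fa (0, z.2) zd0) /pser2 (pserS tr1 z1) [(0, z.2).1]/= [(0, z.2).2]/= (pser0 tr1).
by rewrite addrAC subrr add0r mulrAC mulfV// mul1r.
Qed.

Definition lin2 (k : CC R) a b m n : CC R := k * a m n + b m n.

Lemma repr_lin (k : CC R) f g a b : expands_as f a -> expands_as g b -> expands_as (fun z => k * f z + g z) (lin2 k a b).
Proof.
move=> [ta fa] [tb gb]; split.
  move=> r r01; have [M [M0 HM]] := ta r r01; have [N [N0 HN]] := tb r r01.
  have /andP[r0 r1] := r01.
  exists (Normc.normc k * M + N); split; first by rewrite addr_ge0// mulr_ge0// normc_ge0.
  move=> m n; apply: le_trans (lerD (ler_wpM2l (normc_ge0 k) (HM m n)) (HN m n)).
  rewrite !mulrA -!mulrDl -Normc.normcM; do 2 (apply: ler_wpM2r; first exact: exprn_ge0).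
  exact: normcD.
move=> z zd; have [z1 z2] := zd; rewrite (fa z zd) (gb z zd) /pser2.
have tra := tame2_rows ta z2; have trb := tame2_rows tb z2.
rewrite -(pserZ k tra z1) -(pserD (tameZ k tra) trb z1).
apply: pser_ext => m.
by rewrite -(pserZ k (tame2_row m ta) z2) -(pserD (tameZ k (tame2_row m ta)) (tame2_row m tb) z2).
Qed.

Local Open Scope ereal_scope.

(** The Dirichlet integral in coefficients. It is compared with [dirichlet] under [product_nonzero],
    since otherwise the latter is 0 by convention. *)
Definition dsum mu1 mu2 a : \bar R :=
  (@cst0 R)%:E * kint_rows mu1 (tr a) + (@cst0 R)%:E * kint_rows mu2 a +
  (@cst0 R * @cst0 R)%:E * kint_mixed mu1 mu2 (d1 (d2 a)).

Lemma tr_d1d2 a : tr (d1 (d2 a)) = d1 (d2 (tr a)).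
Proof. by apply/funext => m; apply/funext => n; rewrite /tr /d1 /d2 mulrCA. Qed.

Lemma dsum_tr mu1 mu2 a : dsum mu2 mu1 (tr a) = dsum mu1 mu2 a.
Proof. by rewrite /dsum -tr_d1d2 K3_tr [X in X + _]addeC. Qed.

Lemma dirichlet_repr mu1 mu2 f a : expands_as f a -> product_nonzero mu1 mu2 ->
  dirichlet mu1 mu2 f = dsum mu1 mu2 a.
Proof.
move=> fa nz; have [ta fE] := fa; have [tt sE] := repr_sw fa.
rewrite /dirichlet; case: asboolP => // _.
rewrite (dirichlet1_formula mu1 ta fE) (dirichlet3_formula mu1 mu2 ta fE).
by have := dirichlet1_formula mu2 tt sE; rewrite /dirichlet2 /dirichlet1 => ->.
Qed.

Lemma dirichlet_zero mu1 mu2 f : ~ product_nonzero mu1 mu2 -> dirichlet mu1 mu2 f = 0.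
Proof. by move=> nz; rewrite /dirichlet; case: asboolP. Qed.

Lemma product_nonzeroE mu1 mu2 : product_nonzero mu1 mu2 <-> 0 < mu1 setT /\ 0 < mu2 setT.
Proof.
have E : (mu1 \x mu2) setT = mu1 setT * mu2 setT by rewrite -setXTT product_measure1E.
have m1 : 0 <= mu1 setT by exact: measure_ge0.
have m2 : 0 <= mu2 setT by exact: measure_ge0.
rewrite /product_nonzero E; move: (mu1 setT) (mu2 setT) m1 m2 => x y m1 m2.
split=> [H|[h1 h2] H]; last by have := mule_gt0 h1 h2; rewrite H ltxx.
by split; rewrite lt_neqAle ?m1 ?m2 andbT eq_sym; apply/eqP => E0; apply: H; rewrite E0 ?mul0e ?mule0.
Qed.

Lemma product_nonzeroC mu1 mu2 : product_nonzero mu1 mu2 <-> product_nonzero mu2 mu1.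
Proof. by rewrite !product_nonzeroE; split => -[? ?]; split. Qed.

Lemma dirichlet_sw mu1 mu2 f a : expands_as f a -> dirichlet mu2 mu1 (swap_args f) = dirichlet mu1 mu2 f.
Proof.
move=> fa; have [nz|nz] := pselect (product_nonzero mu1 mu2).
  rewrite (dirichlet_repr fa nz) (dirichlet_repr (repr_sw fa) ((product_nonzeroC _ _).1 nz)).
  exact: dsum_tr.
rewrite (dirichlet_zero _ nz) dirichlet_zero// => nz'; apply: nz; exact/product_nonzeroC.
Qed.

Lemma hardy_repr f a : expands_as f a -> hardy_sqnorm f = hsum a.
Proof. by move=> [ta fa]; exact: hardy_formula ta fa. Qed.

Lemma hardy_sw f a : expands_as f a -> hardy_sqnorm (swap_args f) = hardy_sqnorm f.
Proof. by move=> fa; rewrite (hardy_repr fa) (hardy_repr (repr_sw fa)) hsum_tr. Qed.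

Lemma D2_sqnorm_sw mu1 mu2 f : holomorphic f -> D2_sqnorm mu2 mu1 (swap_args f) = D2_sqnorm mu1 mu2 f.
Proof.
by move=> /holomorphic_repr[a fa]; rewrite /D2_sqnorm (hardy_sw fa) (dirichlet_sw mu1 mu2 fa).
Qed.

Lemma in_D2_sw mu1 mu2 f : in_D2 mu1 mu2 f -> in_D2 mu2 mu1 (swap_args f).
Proof.
move=> [hf H]; have [a fa] := holomorphic_repr hf; split; first exact: repr_holomorphic (repr_sw fa).
rewrite (dirichlet_sw mu1 mu2 fa) (hardy_sw fa); move: H.
by case: asboolP => nz; case: asboolP => nz' //; [case: nz'|case: nz]; exact/product_nonzeroC.
Qed.

(** Reduces the operators in the second variable to those in the first; the measures are exchanged
    along with the variables. *)
Lemma bounded_operator_sw mu1 mu2 T : bounded_operator mu2 mu1 T ->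
  bounded_operator mu1 mu2 (fun f => swap_args (T (swap_args f))).
Proof.
move=> [Tin Tlin [M TM]]; split.
- by move=> f /in_D2_sw/Tin/in_D2_sw.
- move=> k f g /in_D2_sw fD /in_D2_sw gD z zd.
  exact: (Tlin k _ _ fD gD (z.2, z.1) (bidisc_sw zd)).
- exists M => f fD; have fD' := in_D2_sw fD.
  have [h1 _] := Tin _ fD'; have [h2 _] := fD.
  by rewrite (D2_sqnorm_sw mu2 mu1 h1) -(D2_sqnorm_sw mu1 mu2 h2); exact: TM.
Qed.

Lemma cst0_ege0 : 0 <= (@cst0 R)%:E.
Proof. by rewrite lee_fin; exact/ltW/cst0_gt0. Qed.

Lemma cst0M_ege0 : 0 <= (@cst0 R * @cst0 R)%:E.
Proof. by rewrite EFinM mule_ge0// cst0_ege0. Qed.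

Lemma K1_ge0 nu a : 0 <= kint_rows nu a.
Proof. by apply: nneseries_ge0 => n _ _; exact: kint_ge0. Qed.

Lemma K3_ge0 mu1 mu2 a : 0 <= kint_mixed mu1 mu2 a.
Proof. by apply: integral_ge0 => p _; exact: sum_kint_ge0. Qed.

Lemma dsum_terms_ge0 mu1 mu2 a : [/\ 0 <= (@cst0 R)%:E * kint_rows mu1 (tr a),
  0 <= (@cst0 R)%:E * kint_rows mu2 a & 0 <= (@cst0 R * @cst0 R)%:E * kint_mixed mu1 mu2 (d1 (d2 a))].
Proof.
split; [exact: mule_ge0 cst0_ege0 (K1_ge0 _ _)|exact: mule_ge0 cst0_ege0 (K1_ge0 _ _)|].
exact: mule_ge0 cst0M_ege0 (K3_ge0 _ _ _).
Qed.

Lemma dsum_ge0 mu1 mu2 a : 0 <= dsum mu1 mu2 a.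
Proof. by have [? ? ?] := dsum_terms_ge0 mu1 mu2 a; rewrite /dsum !adde_ge0. Qed.

(** The part of [dsum] attached to [mu2] contains the row, and a non-zero product gives [mu2]
    positive mass. *)
Lemma fstrow_lt_pinfty mu1 mu2 a :
  product_nonzero mu1 mu2 -> dsum mu1 mu2 a < +oo -> fstrow a < +oo.
Proof.
move=> /product_nonzeroE[_ m2] H; apply: (fstrow_fin m2).
have [x0 y0 w0] := dsum_terms_ge0 mu1 mu2 a.
have : (@cst0 R)%:E * kint_rows mu2 a < +oo.
  apply: le_lt_trans H; rewrite /dsum; apply: le_trans (leeDl _ w0).
  by rewrite leeDr.
case: (kint_rows mu2 a) (K1_ge0 mu2 a) => [x| |] //.
  by move=> _ _; exact: ltry.
by move=> _; rewrite gt0_muley ?lte_fin ?cst0_gt0.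
Qed.

Section Transfer.
Variables (mu1 mu2 : circle_measure R).
Variables (T : (CC R * CC R -> CC R) -> (CC R * CC R -> CC R)).
Variables (C : (nat -> nat -> CC R) -> (nat -> nat -> CC R)) (B : R).
Hypothesis reprT : forall f a, expands_as f a -> expands_as (T f) (C a).
Hypothesis linC : forall k a b, C (lin2 k a b) = lin2 k (C a) (C b).
Hypothesis hsumC : forall a, hsum (C a) <= hsum a.
Hypothesis B0 : (0 <= B)%R.
(** The first row is kept as a separate term because it is handled in two ways: by [hsum] for the
    norm inequality, and by the finite Dirichlet integral for membership. *)
Hypothesis dsumC : forall a, dsum mu1 mu2 (C a) <= B%:E * dsum mu1 mu2 a + B%:E * fstrow a.

Lemma bounded_transfer : bounded_operator mu1 mu2 T.
Proof.
split.
- move=> f [hf H]; have [a fa] := holomorphic_repr hf; have Tfa := reprT fa.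
  split; first exact: repr_holomorphic Tfa.
  move: H; case: asboolP => nz; last first.
    by rewrite (hardy_repr fa) (hardy_repr Tfa); exact: le_lt_trans.
  rewrite (dirichlet_repr fa nz) (dirichlet_repr Tfa nz) => H.
  have rf := fstrow_lt_pinfty nz H.
  apply: le_lt_trans (dsumC a) _; apply: lte_add_pinfty; apply: lte_mul_pinfty; rewrite ?lee_fin//.
- move=> k f g [hf _] [hg _] z zd.
  have [a fa] := holomorphic_repr hf; have [b gb] := holomorphic_repr hg.
  have [_ ->//] := reprT (repr_lin k fa gb).
  by rewrite linC; have [_ <-] := repr_lin k (reprT fa) (reprT gb).
(* The Hardy part costs [hsum a] and the row another [B] times it, so [B + 1] bounds both
   coefficients. *)
exists (Num.sqrt (B + 1)) => f [hf _]; have [a fa] := holomorphic_repr hf; have Tfa := reprT fa.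
have B1 : (0 <= B + 1)%R by rewrite addr_ge0.
rewrite sqr_sqrtr// /D2_sqnorm (hardy_repr fa) (hardy_repr Tfa).
have h0 := hsum_ge0 a; have hB : 0 <= B%:E by rewrite lee_fin.
have [nz|nz] := pselect (product_nonzero mu1 mu2); last first.
  rewrite !(dirichlet_zero _ nz) !adde0; apply: le_trans (hsumC a) _.
  rewrite -[leLHS]mul1e; apply: lee_wpmul2r => //.
  by rewrite lee_fin lerDr.
rewrite (dirichlet_repr fa nz) (dirichlet_repr Tfa nz).
have d0 := dsum_ge0 mu1 mu2 a.
have H : dsum mu1 mu2 (C a) <= B%:E * dsum mu1 mu2 a + B%:E * hsum a.
  apply: le_trans (dsumC a) _; apply: leeD2l; apply: lee_wpmul2l => //.
  exact: fstrow_hsum.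
apply: le_trans (leeD (hsumC a) H) _.
move: (hsum a) (dsum mu1 mu2 a) h0 d0 => h D h0 d0.
rewrite EFinD ge0_muleDl ?lee_fin// mul1e ge0_muleDr//.
by rewrite [leLHS]addeC [X in X + (h + D)]addeC; apply: leeD2l; rewrite leeDl.
Qed.

End Transfer.

Lemma lin2_sc1 (k : CC R) a b : sc1 (lin2 k a b) = lin2 k (sc1 a) (sc1 b).
Proof.
by apply/funext => -[|m]; apply/funext => n //; rewrite /lin2 /sc1 mulr0 addr0.
Qed.

(** Here [x], [y], [w] are the parts of [mu1], of [mu2] and the mixed one, and [r] is the first row.
    The mixed part brings in [c * c * d * y], that is, [c * d] times the term [c * y] already
    present; relative to the terms on the right the coefficients are [18], [1 + c * d], [18] and
    [c * d]. *)
Lemma combine_le (c d : R) (x y w r x' w' : \bar R) : (0 < c)%R -> (0 <= d)%R ->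
  0 <= x -> 0 <= y -> 0 <= w -> 0 <= r ->
  x' <= 18%:E * x + d%:E * r -> w' <= 18%:E * w + d%:E * y ->
  c%:E * x' + c%:E * y + (c * c)%:E * w' <=
  (18 + c * d)%:E * (c%:E * x + c%:E * y + (c * c)%:E * w) + (18 + c * d)%:E * r.
Proof.
move=> c0 d0 x0 y0 w0 r0 Hx Hw.
have cc0 : (0 < c * c)%R by rewrite mulr_gt0.
have cd0 : (0 <= c * d)%R by rewrite mulr_ge0// ltW.
have c0' : 0 <= c%:E by rewrite lee_fin ltW.
have cc0' : 0 <= (c * c)%:E by rewrite lee_fin ltW.
have e18 : 0 <= 18%:E :> \bar R by rewrite lee_fin.
have d0' : 0 <= d%:E by rewrite lee_fin.
have ccd0 : (0 <= c * c * d)%R by rewrite mulr_ge0// ltW.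
have B0 : 0 <= (18 + c * d)%:E by rewrite lee_fin addr_ge0.
apply: (@le_trans _ _ (c%:E * (18%:E * x + d%:E * r) + c%:E * y + (c * c)%:E * (18%:E * w + d%:E * y))).
  by apply: leeD; [apply: leeD => //|]; apply: lee_wpmul2l.
have E5 (X1 X2 X3 X4 X5 : \bar R) : X1 + X2 + X3 + (X4 + X5) = X1 + (X3 + X5) + X4 + X2.
  by rewrite -!addeA; congr (_ + _); rewrite addeC -!addeA; congr (_ + _); rewrite addeCA.
have mono (k l : R) (X : \bar R) : 0 <= X -> (k <= l)%R -> k%:E * X <= l%:E * X.
  by move=> X0 kl; apply: lee_wpmul2r; rewrite ?lee_fin.
rewrite (ge0_muleDr c%:E (mule_ge0 e18 x0) (mule_ge0 d0' r0)).
rewrite (ge0_muleDr (c * c)%:E (mule_ge0 e18 w0) (mule_ge0 d0' y0)) E5.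
rewrite (ge0_muleDr (18 + c * d)%:E (adde_ge0 (mule_ge0 c0' x0) (mule_ge0 c0' y0)) (mule_ge0 cc0' w0)).
rewrite (ge0_muleDr (18 + c * d)%:E (mule_ge0 c0' x0) (mule_ge0 c0' y0)) !muleA -!EFinM.
rewrite -ge0_muleDl ?lee_fin ?(ltW c0)//.
by apply: leeD; [apply: leeD; [apply: leeD|]|]; apply: mono => //; nra.
Qed.

Lemma dsum_sc1 mu1 mu2 : exists2 B : R, (0 <= B)%R & forall a,
  dsum mu1 mu2 (sc1 a) <= B%:E * dsum mu1 mu2 a + B%:E * fstrow a.
Proof.
have kp := @disc_area_gt0 R; have c0 := @cst0_gt0 R.
pose d := (4 * @disc_area R * fine (mu1 setT))%R.
have d0 : (0 <= d)%R by rewrite mulr_ge0 ?fine_ge0// mulr_ge0// ltW.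
exists (18 + @cst0 R * d)%R; first by rewrite addr_ge0// mulr_ge0// ltW.
move=> a; rewrite /dsum K1_sc1'; apply: combine_le => //.
- exact: K1_ge0.
- exact: K1_ge0.
- exact: K3_ge0.
- exact: fstrow_ge0.
- exact: K1_sc1.
(* The row [a 0] in the mixed estimate is one of those summed in [kint_rows mu2 a]. *)
apply: le_trans (K3_sc1 mu1 mu2 a) _; apply: leeD2l; apply: lee_wpmul2l; first by rewrite lee_fin.
exact: K1_ge_row.
Qed.

(** No row term appears because [kint_unshift] has none; the part of [mu2] just loses a row. *)
Lemma dsum_sh1 mu1 mu2 a : dsum mu1 mu2 (sh1 a) <= 14%:E * dsum mu1 mu2 a.
Proof.
have c0 := cst0_ege0; have cc0 := cst0M_ege0.
have [x0 y0 w0] := dsum_terms_ge0 mu1 mu2 a.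
rewrite /dsum (ge0_muleDr 14%:E (adde_ge0 x0 y0) w0) (ge0_muleDr 14%:E x0 y0).
apply: leeD; [apply: leeD|].
- by rewrite muleCA; apply: lee_wpmul2l => //; exact: K1_sh1.
- apply: le_trans (lee_wpmul2l c0 (K1_sh1' mu2 a)) _.
  rewrite -[leLHS]mul1e; apply: lee_wpmul2r; first exact: y0.
  by rewrite lee_fin ler1n.
- by rewrite muleCA; apply: lee_wpmul2l => //; exact: K3_sh1.
Qed.

Lemma bounded_Mz1 mu1 mu2 : bounded_operator mu1 mu2 (@Mz1 R).
Proof.
have [B B0 HB] := dsum_sc1 mu1 mu2.
apply: (@bounded_transfer mu1 mu2 _ (@sc1 R) B).
- exact: repr_Mz1.
- exact: lin2_sc1.
- by move=> a; rewrite hsum_sc1.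
- exact: B0.
- exact: HB.
Qed.

Lemma bounded_L1 mu1 mu2 : bounded_operator mu1 mu2 (@L1 R).
Proof.
apply: (@bounded_transfer mu1 mu2 _ (@sh1 R) 14%:R).
- exact: repr_L1.
- by [].
- exact: hsum_sh1.
- by [].
- move=> a; apply: le_trans (dsum_sh1 mu1 mu2 a) _.
  by rewrite leeDl// mule_ge0 ?lee_fin// fstrow_ge0.
Qed.

Lemma Mz2_sw : @Mz2 R = fun f => swap_args (Mz1 (swap_args f)).
Proof. by apply/funext => f; apply/funext => -[x y]. Qed.

Lemma L2_sw : @L2 R = fun f => swap_args (L1 (swap_args f)).
Proof. by apply/funext => f; apply/funext => -[x y]. Qed.

Definition sc2 a := tr (sc1 (tr a)).

Lemma repr_Mz2 f a : expands_as f a -> expands_as (Mz2 f) (sc2 a).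
Proof. by move=> fa; rewrite Mz2_sw; apply: repr_sw; apply: repr_Mz1; exact: repr_sw. Qed.

(** The two shifts act on different indices; this is the commutation of [L1] with [Mz2] on
    coefficients. *)
Lemma sh1_sc2 a : sh1 (sc2 a) = sc2 (sh1 a).
Proof. by apply/funext => m; apply/funext => -[|n]. Qed.

Lemma L1_Mz1 f : holomorphic f -> eq_bidisc (L1 (Mz1 f)) f.
Proof.
move=> /holomorphic_repr[a fa] z zd.
(* On coefficients, [sh1 (sc1 a)] is [a] by computation. *)
have [_ ->//] := repr_L1 (repr_Mz1 fa); have [_ ->//] := fa.
Qed.

Lemma L1_Mz2 f : holomorphic f -> eq_bidisc (L1 (Mz2 f)) (Mz2 (L1 f)).
Proof.
move=> /holomorphic_repr[a fa] z zd.
by have [_ ->//] := repr_L1 (repr_Mz2 fa); have [_ ->//] := repr_Mz2 (repr_L1 fa); rewrite sh1_sc2.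
Qed.

Lemma holomorphic_sw f : holomorphic f -> holomorphic (swap_args f).
Proof. by move=> /holomorphic_repr[a /repr_sw]; exact: repr_holomorphic. Qed.

End Operators.

Theorem theorem3p24 (R : realType) (mu1 mu2 : circle_measure R) :
  [/\ bounded_operator mu1 mu2 (@Mz1 R),
      bounded_operator mu1 mu2 (@Mz2 R),
      bounded_operator mu1 mu2 (@L1 R) &
      bounded_operator mu1 mu2 (@L2 R)] /\
  forall f, in_D2 mu1 mu2 f ->
    [/\ eq_bidisc (L1 (Mz1 f)) f,
        eq_bidisc (L2 (Mz2 f)) f,
        eq_bidisc (L1 (Mz2 f)) (Mz2 (L1 f)) &
        eq_bidisc (L2 (Mz1 f)) (Mz1 (L2 f))].
Proof.
split.
  split; [exact: bounded_Mz1| |exact: bounded_L1|].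
  - by rewrite Mz2_sw; apply: bounded_operator_sw; exact: bounded_Mz1.
  - by rewrite L2_sw; apply: bounded_operator_sw; exact: bounded_L1.
move=> f [hf _]; have hs := holomorphic_sw hf; split.
- exact: L1_Mz1.
(* Conjugated by the exchange of variables, the claim is [L1_Mz1] for [swap_args f]; [swK] removes
   the double exchange in the middle. *)
- rewrite L2_sw Mz2_sw swK => z zd.
  by rewrite /swap_args (L1_Mz1 hs (bidisc_sw zd)); case: z zd.
- exact: L1_Mz2.
- rewrite L2_sw => z zd; exact: (L1_Mz2 hs (bidisc_sw zd)).
Qed.
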